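(* Assume that $p/n_j \to y_j \in (0,\infty)$ for $j=1,2$, that $y := y_1y_2/(y_1+y_2)<1$, and that $\Delta=\sqrt{(\mu_1-\mu_2)^{T}\Sigma^{-1}(\mu_1-\mu_2)}$ is a constant. Let $R^c_{\mathrm{LDA}}$ be the misclassification rate (conditional on the samples) of the bias-corrected LDA classifier $$\delta_{\mathrm{LDA}}^c(X)=\mathbb{I}\left\{\left(X-\frac{\bar{X}_1+\bar{X}_2}{2}\right)^{T} S_n^{-1}(\bar{X}_1-\bar{X}_2)+\frac{n-2}{n-p-3}\left(\frac{p}{2 n_1}-\frac{p}{2 n_2}\right)>0 \right\}.$$ Then $$R_{\mathrm{LDA}}^c \xrightarrow{\;p\;} \Phi\left(- \frac{\Delta^2}{2\sqrt{\Delta^2+y_1+y_2}} \sqrt{1-y}\right).$$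
   Context: Setting (asymptotic along a sequence of problems with $p,n_1,n_2\to\infty$): $\mu_1\neq\mu_2$ are vectors in $\mathbb{R}^p$ and $\Sigma$ is a $p\times p$ (invertible) covariance matrix, all allowed to depend on $p$. $\{X_{1,j}\}_{j=1}^{n_1}$ and $\{X_{2,j}\}_{j=1}^{n_2}$ are independent i.i.d. samples from $N_p(\mu_1,\Sigma)$ and $N_p(\mu_2,\Sigma)$ respectively, $n=n_1+n_2$, $\bar X_k=\frac{1}{n_k}\sum_{j=1}^{n_k}X_{k,j}$, and $$S_n=\frac{1}{n-2}\sum_{k=1}^2\sum_{j=1}^{n_k}(X_{k,j}-\bar X_k)(X_{k,j}-\bar X_k)^{T}.$$ $\Phi$ is the standard normal distribution function, $\mathbb{I}$ the indicator function, and $\xrightarrow{p}$ denotes convergence in probability. The quantity $\Delta$ is assumed to be a constant (not depending on $p,n_1,n_2$). A classifier $\delta$ (depending on the samples) assigns $X$ to class 1 if and only if $\delta(X)=1$. Its misclassification rate, conditional on the samples and for a new observation $X$ independent of them, is $\frac12 \Pr\{\delta(X)=0\mid X\sim N(\mu_1,\Sigma)\}+\frac12\Pr\{\delta(X)=1\mid X\sim N(\mu_2,\Sigma)\}$. Explicitly, with $\alpha=\frac{n-2}{n-p-3}\left(\frac{p}{2n_1}-\frac{p}{2n_2}\right)$, $$R^c_{\mathrm{LDA}}=\frac12\sum_{j=1}^2\Phi\left(\frac{(-1)^j\left[\left(\mu_j-\frac{\bar X_1+\bar X_2}{2}\right)^{T}S_n^{-1}(\bar X_1-\bar X_2)+\alpha\right]}{\sqrt{(\bar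 X_1-\bar X_2)^{T}S_n^{-1}\Sigma S_n^{-1}(\bar X_1-\bar X_2)}}\right).$$ *)

(* Defs.v *)
From HB Require Import structures.
From mathcomp Require Import all_boot all_order all_algebra.
From mathcomp Require Import all_classical all_reals all_analysis.
Import Order.TTheory GRing.Theory Num.Theory.
Import numFieldNormedType.Exports.

Set Implicit Arguments.
Unset Strict Implicit.
Unset Printing Implicit Defensive.

Local Open Scope classical_set_scope.
Local Open Scope ring_scope.

Definition cvector_display : measure_display -> measure_display.
Proof. exact. Qed.

(* Column vectors carry the sigma-algebra generated by the coordinates; for
   T = R this is the Borel sigma-algebra of R^n. *)
Section measurable_cvector.
Context {d} {T : measurableType d}.
Variable n : nat.

Let coord_fun : 'I_n -> 'cV[T]_n -> T := fun i x => x i ord0.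

Let cvector_set0 : g_sigma_preimage coord_fun set0.
Proof. exact: sigma_algebra0. Qed.

Let cvector_setC A :
  g_sigma_preimage coord_fun A -> g_sigma_preimage coord_fun (~` A).
Proof. exact: sigma_algebraC. Qed.

Let cvector_bigcup (F : (set 'cV[T]_n)^nat) :
  (forall i, g_sigma_preimage coord_fun (F i)) ->
  g_sigma_preimage coord_fun (\bigcup_i (F i)).
Proof. exact: sigma_algebra_bigcup. Qed.

HB.instance Definition _ := @isMeasurable.Build (cvector_display d)
  'cV[T]_n (g_sigma_preimage coord_fun)
  cvector_set0 cvector_setC cvector_bigcup.

End measurable_cvector.

Section probability_notions.
Context {R : realType}.

Definition Phi (x : R) : R := fine (normal_prob 0 1 `]-oo, x]).

(* Mutual independence of a finite family: the product rule for subfamilies is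
   the case where some of the B i are the whole space. *)
Definition independent_RVs d d' (Omega : measurableType d)
    (T : measurableType d') (P : probability Omega R) (I : finType)
    (X : I -> {RV P >-> T}) : Prop :=
  forall B : I -> set T, (forall i, measurable (B i)) ->
    P [set w | forall i, B i (X i w)] = (\prod_(i : I) P (X i @^-1` B i))%E.

(* G is the law of a vector of p independent N(0,1) coordinates. *)
Definition std_gaussian p (G : probability 'cV[R]_p R) : Prop :=
  forall B : 'I_p -> set R, (forall i, measurable (B i)) ->
    G [set z : 'cV[R]_p | forall i, B i (z i ord0)] =
    (\prod_(i < p) normal_prob 0 1 (B i))%E.

(* Q = N_p(mu, Sigma): Q is the law of mu + A Z for Z standard Gaussian and
   A A^T = Sigma. *)
Definition is_mvnormal p (Q : probability 'cV[R]_p R)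
    (mu : 'cV[R]_p) (Sigma : 'M[R]_p) : Prop :=
  exists (A : 'M[R]_p) (G : probability 'cV[R]_p R),
    [/\ A *m A^T = Sigma, std_gaussian G &
      forall B : set 'cV[R]_p, measurable B ->
        Q B = G [set z | B (mu + A *m z)]].

Definition cvg_in_probability (d : nat -> measure_display)
    (Omega : forall m, measurableType (d m))
    (P : forall m, probability (Omega m) R)
    (Y : forall m, Omega m -> R) (l : R) : Prop :=
  forall eps : R, 0 < eps ->
    P m [set w | eps < `|Y m w - l|] @[m --> \oo] --> 0%E.

(* Error of the classifier delta with equal prior weights, where Q1 and Q2 are
   the laws of an observation from class 1 and class 2. *)
Definition misclassification_rate p (Q1 Q2 : probability 'cV[R]_p R)
    (delta : 'cV[R]_p -> bool) : R :=
  2^-1 * fine (Q1 [set x | delta x = false]) +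
  2^-1 * fine (Q2 [set x | delta x = true]).

End probability_notions.

Section lda.
Context {R : realType}.

Definition is_covariance p (Sigma : 'M[R]_p) : Prop :=
  Sigma^T = Sigma /\ forall v : 'cV[R]_p, 0 <= (v^T *m Sigma *m v) ord0 ord0.

Definition mahalanobis p (Sigma : 'M[R]_p) (mu1 mu2 : 'cV[R]_p) : R :=
  Num.sqrt (((mu1 - mu2)^T *m invmx Sigma *m (mu1 - mu2)) ord0 ord0).

Definition sample_mean p n (x : 'I_n -> 'cV[R]_p) : 'cV[R]_p :=
  n%:R^-1 *: \sum_(j < n) x j.

Definition scatter p n (x : 'I_n -> 'cV[R]_p) : 'M[R]_p :=
  \sum_(j < n) (x j - sample_mean x) *m (x j - sample_mean x)^T.

Definition pooled_cov p n1 n2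
    (x1 : 'I_n1 -> 'cV[R]_p) (x2 : 'I_n2 -> 'cV[R]_p) : 'M[R]_p :=
  ((n1 + n2)%:R - 2)^-1 *: (scatter x1 + scatter x2).

Definition lda_correction (p n1 n2 : nat) : R :=
  ((n1 + n2)%:R - 2) / ((n1 + n2)%:R - p%:R - 3) *
  (p%:R / (2 * n1%:R) - p%:R / (2 * n2%:R)).

Definition lda_c p n1 n2
    (x1 : 'I_n1 -> 'cV[R]_p) (x2 : 'I_n2 -> 'cV[R]_p) (x : 'cV[R]_p) : bool :=
  let m1 := sample_mean x1 in
  let m2 := sample_mean x2 in
  0 < ((x - 2^-1 *: (m1 + m2))^T *m invmx (pooled_cov x1 x2) *m (m1 - m2))
        ord0 ord0 + lda_correction p n1 n2.

Definition pooled_sample T n1 n2 (x1 : 'I_n1 -> T) (x2 : 'I_n2 -> T)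
    (k : 'I_n1 + 'I_n2) : T :=
  match k with inl j => x1 j | inr j => x2 j end.

End lda.

(* Main.v *)
(* After whitening, the pooled sample is a p x n matrix Z of independent standard
   normal entries.  Splitting R^n into the span of the two class indicators and
   its orthogonal complement, with orthonormal basis the rows of L, makes the
   sample means independent of the within-class scatter W = (Z L^T)(Z L^T)^T.
   Given the samples the score of a new observation is Gaussian, so each error
   rate is Phi of a ratio which, by polarization, only involves forms
   xi^T W^-1 xi and xi^T W^-2 xi with xi independent of W.

   By rotation invariance xi may be replaced by |xi| e_0.  There
   (W^-1)_00 = 1 / q, where q is the squared distance from the first row of
   Z L^T to the span of the other ones, a chi-squared variable, and
   (W^-2)_00 = (1 + r) / q^2, where r is a quadratic form in a Gaussian vector
   with conditional mean tr W2^-1 for the Wishart matrix W2 of the other rows.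
   The traces of W2^-1 and W2^-2 are controlled by the same two formulas applied
   to all basis vectors at once, thanks to the exponential chi-squared tails.

   Events need not be measurable: probabilities are bounded through measurable
   supersets. *)

Require Import Defs.
From HB Require Import structures.
From mathcomp Require Import all_boot all_order all_algebra.
From mathcomp Require Import all_classical all_reals all_analysis.
From mathcomp Require Import measurable_realfun ring lra.
Import Order.TTheory GRing.Theory Num.Theory.
Import numFieldNormedType.Exports.

Set Implicit Arguments.
Unset Strict Implicit.
Unset Printing Implicit Defensive.

Local Open Scope classical_set_scope.
Local Open Scope ring_scope.

(** * Random matrices *)

(** The conditional variance of r is 2 tr W2^-2, and r is controlled by Chebyshev only. The obstacle
    is that the pivots 1 / q alone give tr W2^-2 <= (tr W2^-1)^2, which stays of order 1. Hence a
    second round: if r is allowed a tolerance e0 k instead of a fixed one, Chebyshev fails with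
    probability O(1/k^2), so that a union over O(k) basis vectors costs only O(1/k), while each
    (W2^-2)_ii is at most O(1/k^2) + O(e0/k). Summing, tr W2^-2 is asymptotically at most a multiple
    of e0, and e0 is free. The degrees of freedom k = n - 1 - p of the pivot set every scale: k xi^T
    W^-1 xi is close to |xi|^2, and k^2 xi^T W^-2 xi to |xi|^2 (n - 2) / k. The last factor tends to
    1 / (1 - y) and is the source of sqrt(1 - y). The noise of the sample means adds p / n_j to
    |xi|^2: this gives y1 + y2 under the square root of the limit, and a bias (y2 - y1) / 2 of the
    score that the correction removes. *)

Lemma measurable_inv (R : realType) : measurable_fun [set: R] (@GRing.inv R).
Proof.
(* Inversion is not continuous at 0, where its value is 0. Squaring keeps the base of [powR]
   nonnegative, and the outer factor x restores the sign and the value at 0. *)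
rewrite (_ : @GRing.inv R = fun x => x * powR (x ^+ 2) (-1)); last first.
  apply/funext => x; rewrite powR_inv1 ?sqr_ge0//.
  by have [->|x0] := eqVneq x 0; [rewrite invr0 mul0r|rewrite expr2 invfM mulrA divff ?mul1r].
apply: measurable_funM => //.
by apply: (measurableT_comp (measurable_powR (-1))); exact: exprn_measurable.
Qed.

Section measurable_matrices.
Context {d} {T : measurableType d} {R : realType}.

(* Matrices of arbitrary shape carry no sigma-algebra in the library, so
   measurability of a random matrix is stated entrywise. *)
Definition mxmeas a b (M : T -> 'M[R]_(a, b)) :=
  forall i j, measurable_fun setT (fun t => M t i j).

Lemma mxmeas_cst a b (M : 'M[R]_(a, b)) : mxmeas (fun=> M).
Proof. by move=> i j; exact: measurable_cst. Qed.

Lemma mxmeas_mul a b c (M : T -> 'M[R]_(a, b)) (N : T -> 'M[R]_(b, c)) :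
  mxmeas M -> mxmeas N -> mxmeas (fun t => M t *m N t).
Proof.
move=> mM mN i j; under eq_fun do rewrite mxE.
by apply: measurable_sum => k; exact: measurable_funM.
Qed.

Lemma mxmeasD a b (M N : T -> 'M[R]_(a, b)) :
  mxmeas M -> mxmeas N -> mxmeas (fun t => M t + N t).
Proof.
by move=> mM mN i j; under eq_fun do rewrite mxE; exact: measurable_funD.
Qed.

Lemma mxmeasN a b (M : T -> 'M[R]_(a, b)) :
  mxmeas M -> mxmeas (fun t => - M t).
Proof.
by move=> mM i j; under eq_fun do rewrite mxE; exact: measurableT_comp.
Qed.

Lemma mxmeasB a b (M N : T -> 'M[R]_(a, b)) :
  mxmeas M -> mxmeas N -> mxmeas (fun t => M t - N t).
Proof. by move=> mM mN; apply: mxmeasD => //; exact: mxmeasN. Qed.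

Lemma mxmeasZ a b (f : T -> R) (M : T -> 'M[R]_(a, b)) :
  measurable_fun setT f -> mxmeas M -> mxmeas (fun t => f t *: M t).
Proof.
by move=> mf mM i j; under eq_fun do rewrite mxE; exact: measurable_funM.
Qed.

Lemma mxmeas_sum a b (I : Type) (s : seq I) (M : I -> T -> 'M[R]_(a, b)) :
  (forall i, mxmeas (M i)) -> mxmeas (fun t => \sum_(i <- s) M i t).
Proof.
move=> mM i j; under eq_fun do rewrite summxE.
by apply: measurable_sum => k; exact: mM.
Qed.

Lemma mxmeas_tr a b (M : T -> 'M[R]_(a, b)) :
  mxmeas M -> mxmeas (fun t => (M t)^T).
Proof. by move=> mM i j; under eq_fun do rewrite mxE; exact: mM. Qed.

Lemma measurable_det n (M : T -> 'M[R]_n) :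
  mxmeas M -> measurable_fun setT (fun t => \det (M t)).
Proof.
move=> mM; rewrite /determinant; apply: measurable_sum => s.
by apply: measurable_funM => //; apply: measurable_prod => i _; exact: mM.
Qed.

Lemma mxmeas_inv n (M : T -> 'M[R]_n) :
  mxmeas M -> mxmeas (fun t => invmx (M t)).
Proof.
move=> mM i j.
(* Cramer's rule; [invmx] returns a singular matrix unchanged, hence the default branch. *)
rewrite (_ : (fun t => _) = fun t => if \det (M t) == 0 then M t i j else
   (\det (M t))^-1 * \adj (M t) i j); last first.
  apply/funext => t; rewrite /invmx unitmxE unitfE.
  by case: ifPn => [/negbTE->|/negPn ->]//; rewrite mxE.
have mD := measurable_det mM.
apply: measurable_fun_ifT => //; first exact: measurable_fun_eqr.
apply: measurable_funM; first exact: measurableT_comp (@measurable_inv R) _.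
under eq_fun do rewrite mxE; apply: measurable_funM => //.
apply: measurable_det => k l; rewrite /row' /col'.
by under eq_fun do rewrite !mxE; exact: mM.
Qed.

Lemma mxmeas_vec_mx a b (v : T -> 'rV[R]_(a * b)) :
  mxmeas v -> mxmeas (fun t => vec_mx (v t)).
Proof. by move=> mv i j; under eq_fun do rewrite mxE; exact: mv. Qed.

Lemma mxmeas_mxvec a b (M : T -> 'M[R]_(a, b)) :
  mxmeas M -> mxmeas (fun t => mxvec (M t)).
Proof.
move=> mM i j; rewrite ord1; case/mxvec_indexP: j => k l.
by under eq_fun do rewrite mxvecE; exact: mM.
Qed.

Lemma mxmeas_row_mx a b c (M : T -> 'M[R]_(a, b)) (N : T -> 'M[R]_(a, c)) :
  mxmeas M -> mxmeas N -> mxmeas (fun t => row_mx (M t) (N t)).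
Proof.
move=> mM mN i j; under eq_fun do rewrite mxE.
by case: (fintype.split j) => k /=; [exact: mM|exact: mN].
Qed.

Lemma mxmeas_col_mx a b c (M : T -> 'M[R]_(a, c)) (N : T -> 'M[R]_(b, c)) :
  mxmeas M -> mxmeas N -> mxmeas (fun t => col_mx (M t) (N t)).
Proof.
move=> mM mN i j; under eq_fun do rewrite mxE.
by case: (fintype.split i) => k /=; [exact: mM|exact: mN].
Qed.

Lemma mxmeas_usubmx a b c (M : T -> 'M[R]_(a + b, c)) :
  mxmeas M -> mxmeas (fun t => usubmx (M t)).
Proof. by move=> mM i j; under eq_fun do rewrite mxE; exact: mM. Qed.

Lemma mxmeas_dsubmx a b c (M : T -> 'M[R]_(a + b, c)) :
  mxmeas M -> mxmeas (fun t => dsubmx (M t)).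
Proof. by move=> mM i j; under eq_fun do rewrite mxE; exact: mM. Qed.

Lemma mxmeas_lsubmx a b c (M : T -> 'M[R]_(a, b + c)) :
  mxmeas M -> mxmeas (fun t => lsubmx (M t)).
Proof. by move=> mM i j; under eq_fun do rewrite mxE; exact: mM. Qed.

Lemma mxmeas_rsubmx a b c (M : T -> 'M[R]_(a, b + c)) :
  mxmeas M -> mxmeas (fun t => rsubmx (M t)).
Proof. by move=> mM i j; under eq_fun do rewrite mxE; exact: mM. Qed.

Lemma measurable_cvP n (f : T -> 'cV[R]_n) :
  measurable_fun setT f <-> mxmeas f.
Proof.
split=> [mf i j|mf].
  rewrite ord1; move=> _ A mA; rewrite setTI.
  have : measurable ((fun x : 'cV[R]_n => x i ord0) @^-1` A).
    apply: sub_sigma_algebra; rewrite -bigcup_seq/=; exists i => /=.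
      by rewrite mem_index_enum.
    by exists A => //; rewrite setTI.
  by move=> /(mf measurableT); rewrite setTI.
move=> _ A mA; rewrite setTI.
pose C := [set B : set 'cV[R]_n | measurable (f @^-1` B)].
suff : measurable `<=` C by apply.
apply: smallest_sub.
  split => [|B|F mF]; rewrite /C/=.
  - by rewrite preimage_set0.
  - by move=> mB; rewrite setTD; exact: (measurableC mB).
  - by rewrite preimage_bigcup; apply: bigcupT_measurable => k; exact: mF.
rewrite -bigcup_seq => B [i _ [D mD <-]]; rewrite /C /= setTI.
by rewrite -[X in measurable X]setTI; exact: (mf i ord0).
Qed.

End measurable_matrices.

Lemma measurable_finforall d (T : measurableType d) (I : finType)
    (A : I -> set T) :
  (forall i, measurable (A i)) -> measurable [set t | forall i, A i t].
Proof.
move=> mA; rewrite (_ : [set _ | _] = \bigcap_(i in [set: I]) A i).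
  exact: fin_bigcap_measurable.
by apply/seteqP; split => [t h i _|t h i]; exact: h.
Qed.

Lemma measurable_finexists d (T : measurableType d) (I : finType)
    (A : I -> set T) :
  (forall i, measurable (A i)) -> measurable [set t | exists i, A i t].
Proof.
move=> mA; rewrite (_ : [set _ | _] = \bigcup_(i in [set: I]) A i).
  exact: fin_bigcup_measurable.
by apply/seteqP; split => [t [i h]|t [i _ h]]; exists i.
Qed.

Section cvector_measures.
Context {R : realType}.

Lemma mxmeas_id n : mxmeas (@id 'cV[R]_n).
Proof. exact/measurable_cvP. Qed.

Definition cvbox n (B : 'I_n -> set R) : set 'cV[R]_n :=
  [set z | forall i, B i (z i ord0)].

Lemma measurable_cvbox n (B : 'I_n -> set R) :
  (forall i, measurable (B i)) -> measurable (cvbox B).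
Proof.
move=> mB; apply: (@measurable_finforall _ 'cV[R]_n _
  (fun i => [set z | B i (z i ord0)])) => i.
by have := @mxmeas_id n i ord0 measurableT _ (mB i); rewrite setTI.
Qed.

(** Boxes are stable under intersection and generate the sigma-algebra, so finite measures that
    agree on them are equal. *)
Lemma cvector_measure_unique n (m1 m2 : {measure set 'cV[R]_n -> \bar R}) :
  (forall B : 'I_n -> set R, (forall i, measurable (B i)) ->
     m1 (cvbox B) = m2 (cvbox B)) ->
  (m1 setT < +oo)%E -> forall A, measurable A -> m1 A = m2 A.
Proof.
move=> m12 m1oo; pose G := [set A : set 'cV[R]_n |
  exists B, (forall i, measurable (B i)) /\ A = cvbox B].
apply: (measure_unique G (fun=> setT)) => //.
- apply/seteqP; split; last first.
    apply: smallest_sub => [|_ [B [mB ->]]]; last exact: measurable_cvbox.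
    exact: sigma_algebra_measurable.
  apply: sub_smallest2r; first exact: smallest_sigma_algebra.
  move=> A; rewrite -bigcup_seq => -[i _ [D mD <-]].
  exists (fun j => if j == i then D else setT); split.
    by move=> j; case: ifP.
  rewrite setTI; apply/seteqP; split => z /=.
    by move=> Dz j; case: eqP => // ->.
  by move/(_ i); rewrite eqxx.
- move=> _ _ [B [mB ->]] [B' [mB' ->]].
  exists (fun i => B i `&` B' i); split; first by move=> i; exact: measurableI.
  by apply/seteqP; split => z /= => [[h h'] i|h]; [|split=> i; have [] := h i].
- by move=> _; exists (fun=> setT); split => //; apply/seteqP.
- by rewrite bigcup_const.
- by move=> A [B [mB ->]]; exact: m12.
Qed.

End cvector_measures.

(** * Laws of random vectors, product measures and independence *)

Section laws.
Context {d} {T : measurableType d} {R : realType}.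
Variable P : probability T R.

Definition law d' (U : measurableType d') (f : T -> U)
    (mf : measurable_fun setT f) : probability U R :=
  distribution P (mfun_Sub (mem_set mf)).

Lemma lawE d' (U : measurableType d') (f : T -> U)
    (mf : measurable_fun setT f) A : law mf A = P (f @^-1` A).
Proof. by []. Qed.

Lemma law_pair d1 d2 (T1 : measurableType d1) (T2 : measurableType d2)
    (f : T -> T1) (g : T -> T2)
    (mf : measurable_fun setT f) (mg : measurable_fun setT g) :
  (forall A B, measurable A -> measurable B ->
    P [set t | A (f t) /\ B (g t)] =
    (P (f @^-1` A) * P (g @^-1` B))%E) ->
  forall S, measurable S ->
    P [set t | S (f t, g t)] = (law mf \x law mg)%E S.
Proof.
move=> fg S mS.
have mfg : measurable_fun setT (fun t => (f t, g t)) by exact: measurable_fun_pair.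
rewrite -[LHS](lawE mfg); symmetry.
by apply: product_measure_unique => // A B mA mB; rewrite lawE -fg.
Qed.

(** Plays the role of conditioning on f: the pair has a product law, so a bound that is uniform over
    frozen values of f integrates to itself. *)
Lemma law_pair_le d1 d2 (T1 : measurableType d1) (T2 : measurableType d2)
    (f : T -> T1) (g : T -> T2) (S : set (T1 * T2)) (eta : \bar R) :
  measurable_fun setT f -> measurable_fun setT g ->
  (forall A B, measurable A -> measurable B ->
    P [set t | A (f t) /\ B (g t)] =
    (P (f @^-1` A) * P (g @^-1` B))%E) ->
  measurable S ->
  (forall x, P [set t | S (x, g t)] <= eta)%E ->
  (P [set t | S (f t, g t)] <= eta)%E.
Proof.
move=> mf mg fg mS Seta; rewrite (law_pair mf mg)// /product_measure1.
have -> : eta = (\int[law mf]_x cst eta x)%E.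
  by rewrite integral_cst//; have := probability_setT (law mf) => /= ->; rewrite mule1.
apply: ge0_le_integral => //.
- exact: measurable_fun_xsection.
- move=> x _ /=; rewrite lawE; apply: le_trans (Seta x).
  by rewrite /xsection le_eqVlt; apply/orP; left; apply/eqP; congr (P _);
    apply/seteqP; split => t /=; rewrite inE.
Qed.

(** The law of the stacked vector and the image of the product law are two measures on vectors of
    length n + m, and they can be compared on boxes. *)
Lemma indep_of_boxes n m (U : T -> 'cV[R]_n) (V : T -> 'cV[R]_m) :
  measurable_fun setT U -> measurable_fun setT V ->
  (forall B C, (forall i, measurable (B i)) -> (forall i, measurable (C i)) ->
    P [set t | cvbox B (U t) /\ cvbox C (V t)] =
    (P (U @^-1` cvbox B) * P (V @^-1` cvbox C))%E) ->
  forall A B, measurable A -> measurable B ->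
    P [set t | A (U t) /\ B (V t)] = (P (U @^-1` A) * P (V @^-1` B))%E.
Proof.
move=> mU mV UV A B mA mB.
have mc : measurable_fun setT (fun t => col_mx (U t) (V t)).
  by apply/measurable_cvP/mxmeas_col_mx; exact/measurable_cvP.
have mc' : measurable_fun setT (fun z : 'cV[R]_n * 'cV[R]_m => col_mx z.1 z.2).
  by apply/measurable_cvP/mxmeas_col_mx; exact/measurable_cvP.
pose pr : {measure set ('cV[R]_n * 'cV[R]_m) -> \bar R} := (law mU \x law mV)%E.
have prE C D : measurable C -> measurable D ->
    pr (C `*` D) = (P (U @^-1` C) * P (V @^-1` D))%E.
  by move=> mC mD; exact: product_measure1E.
pose m2 := pushforward pr (mfun_Sub (mem_set mc')).
pose S := [set z : 'cV[R]_(n + m) | A (usubmx z) /\ B (dsubmx z)].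
have mS : measurable S.
  have mu : measurable_fun setT (fun z : 'cV[R]_(n + m) => usubmx z).
    by apply/measurable_cvP; exact: mxmeas_usubmx (@mxmeas_id _ _).
  have md : measurable_fun setT (fun z : 'cV[R]_(n + m) => dsubmx z).
    by apply/measurable_cvP; exact: mxmeas_dsubmx (@mxmeas_id _ _).
  rewrite (_ : S = (setT `&` (fun z => usubmx z) @^-1` A) `&`
                   (setT `&` (fun z => dsubmx z) @^-1` B)); last by rewrite !setTI.
  by apply: measurableI; [exact: mu|exact: md].
have : law mc S = m2 S.
  apply: cvector_measure_unique => //; last first.
    exact: (le_lt_trans (probability_le1 (law mc) measurableT) (ltry _)).
  move=> C mC; pose C1 i := C (lshift m i); pose C2 i := C (rshift n i).
  have cC u v : cvbox C (col_mx u v) <-> cvbox C1 u /\ cvbox C2 v.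
    split=> [h|[hu hv] i].
      by split=> i; [have := h (lshift m i)|have := h (rshift n i)];
        rewrite ?col_mxEu ?col_mxEd.
    by rewrite -(splitK i) mxE unsplitK; case: (fintype.split i) => j /=;
      [exact: hu|exact: hv].
  transitivity (P [set t | cvbox C1 (U t) /\ cvbox C2 (V t)]).
    by congr (P _); apply/seteqP; split => t /cC.
  transitivity (pr (cvbox C1 `*` cvbox C2)); last first.
    by congr (pr _); apply/seteqP; split => -[u v] /cC.
  by rewrite prE; [apply: UV => i; exact: mC|apply: measurable_cvbox => i; exact: mC..].
have -> : m2 S = pr (A `*` B).
  by congr (pr _); apply/seteqP; split => -[u v] /=; rewrite /S /= col_mxKu col_mxKd.
rewrite prE// => <-.
by congr (P _); apply/seteqP; split => t /=; rewrite /S /= col_mxKu col_mxKd.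
Qed.

End laws.

(** * Gaussian matrices *)

Section gaussian_matrices.
Context {d} {T : measurableType d} {R : realType}.
Variable P : probability T R.

(** One product formula over all entries encodes both the N(0,1) marginals and mutual independence;
    taking whole lines for some B i j gives the subfamilies. *)
Definition gauss_mx a b (Z : T -> 'M[R]_(a, b)) : Prop :=
  mxmeas Z /\ forall B : 'I_a -> 'I_b -> set R, (forall i j, measurable (B i j)) ->
    P [set t | forall i j, B i j (Z t i j)] =
    (\prod_(i < a) \prod_(j < b) normal_prob 0 1 (B i j))%E.

(** Flattening brings matrices to column vectors, where measurable sets and product laws are
    available. *)
Definition cvec a b (M : 'M[R]_(a, b)) : 'cV[R]_(a * b) := (mxvec M)^T.

Definition indep_mx a b c e (X : T -> 'M[R]_(a, b)) (Y : T -> 'M[R]_(c, e)) :=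
  forall A B, measurable A -> measurable B ->
    P [set t | A (cvec (X t)) /\ B (cvec (Y t))] =
    (P [set t | A (cvec (X t))] * P [set t | B (cvec (Y t))])%E.

Lemma cvecK a b (M : 'M[R]_(a, b)) : vec_mx (cvec M)^T = M.
Proof. by rewrite trmxK mxvecK. Qed.

Lemma mxmeas_uncvec a b :
  mxmeas (fun z : 'cV[R]_(a * b) => (vec_mx z^T : 'M[R]_(a, b))).
Proof. by apply: mxmeas_vec_mx; apply: mxmeas_tr; exact: mxmeas_id. Qed.

Lemma measurable_cvec a b (X : T -> 'M[R]_(a, b)) :
  mxmeas X -> measurable_fun setT (fun t => cvec (X t)).
Proof. by move=> mX; apply/measurable_cvP/mxmeas_tr/mxmeas_mxvec. Qed.

Lemma cvbox_cvec a b (B : 'I_(a * b) -> set R) (M : 'M[R]_(a, b)) :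
  cvbox B (cvec M) <-> forall i j, B (mxvec_index i j) (M i j).
Proof.
split=> [h i j|h k]; first by have := h (mxvec_index i j); rewrite mxE mxvecE.
by case/mxvec_indexP: k => i j; rewrite mxE mxvecE.
Qed.

Lemma indep_mx_sym a b c e (X : T -> 'M[R]_(a, b)) (Y : T -> 'M[R]_(c, e)) :
  indep_mx X Y -> indep_mx Y X.
Proof.
move=> XY A B mA mB; rewrite muleC -XY//; congr (P _).
by apply/seteqP; split=> t [].
Qed.

Lemma indep_mx_le a b c e (X : T -> 'M[R]_(a, b)) (Y : T -> 'M[R]_(c, e))
    (S : 'M[R]_(a, b) -> 'M[R]_(c, e) -> Prop) (eta : \bar R) :
  mxmeas X -> mxmeas Y -> indep_mx X Y ->
  measurable [set z : 'cV[R]_(a * b) * 'cV[R]_(c * e) |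
                S (vec_mx z.1^T) (vec_mx z.2^T)] ->
  (forall M, P [set t | S M (Y t)] <= eta)%E ->
  (P [set t | S (X t) (Y t)] <= eta)%E.
Proof.
move=> mX mY XY mS Seta.
pose S' := [set z : 'cV[R]_(a * b) * 'cV[R]_(c * e) |
                S (vec_mx z.1^T) (vec_mx z.2^T)].
have := @law_pair_le _ _ _ P _ _ _ _ (fun t => cvec (X t)) (fun t => cvec (Y t)) S' eta.
rewrite (_ : [set t | S' (cvec (X t), cvec (Y t))] = [set t | S (X t) (Y t)]); last first.
  by apply/seteqP; split => t; rewrite /S'/= !cvecK.
apply => //; [exact: measurable_cvec..|].
move=> x; apply: le_trans (Seta (vec_mx x^T)); rewrite le_eqVlt; apply/orP; left.
by apply/eqP; congr (P _); apply/seteqP; split => t; rewrite /S'/= cvecK.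
Qed.

Lemma gauss_mx_tr a b (Z : T -> 'M[R]_(a, b)) :
  gauss_mx Z -> gauss_mx (fun t => (Z t)^T).
Proof.
move=> [mZ PZ]; split=> [|B mB]; first exact: mxmeas_tr.
rewrite exchange_big/= -PZ; last by move=> i j; exact: mB.
by congr (P _); apply/seteqP; split => t /= h i j; have := h j i; rewrite mxE.
Qed.

Lemma gauss_mx_eq a b (Z Z' : T -> 'M[R]_(a, b)) :
  Z =1 Z' -> gauss_mx Z -> gauss_mx Z'.
Proof. by move=> /funext ->. Qed.

Lemma normal_prob_setT : normal_prob 0 1 [set: R] = 1%E.
Proof. exact: (probability_setT (normal_prob 0 1)). Qed.

Lemma gauss_mx_lsub a b c (X : T -> 'M[R]_(a, b)) (Y : T -> 'M[R]_(a, c)) :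
  gauss_mx (fun t => row_mx (X t) (Y t)) -> gauss_mx X.
Proof.
move=> [mXY PXY]; split=> [|B mB].
  by have := mxmeas_lsubmx mXY; under eq_fun do rewrite row_mxKl.
(* The entries of the other block are constrained by the whole line, which contributes factors 1. *)
pose B' i (j : 'I_(b + c)) :=
  match fintype.split j with inl k => B i k | inr _ => setT end.
have := PXY B'; rewrite (_ : [set t | _] = [set t | forall i j, B i j (X t i j)]); last first.
  apply/seteqP; split=> t /= h i j.
    by have := h i (lshift c j); rewrite /B' (unsplitK (inl j)) row_mxEl.
  by rewrite /B' mxE; case: (fintype.split j).
move=> ->; last by move=> i j; rewrite /B'; case: (fintype.split j).
apply: eq_bigr => i _; rewrite big_split_ord/= [X in (_ * X)%E]big1 ?mule1.
  by apply: eq_bigr => j _; rewrite /B' (unsplitK (inl j)).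
by move=> j _; rewrite /B' (unsplitK (inr j)) normal_prob_setT.
Qed.

Lemma gauss_mx_rsub a b c (X : T -> 'M[R]_(a, b)) (Y : T -> 'M[R]_(a, c)) :
  gauss_mx (fun t => row_mx (X t) (Y t)) -> gauss_mx Y.
Proof.
move=> [mXY PXY]; split=> [|B mB].
  by have := mxmeas_rsubmx mXY; under eq_fun do rewrite row_mxKr.
pose B' i (j : 'I_(b + c)) :=
  match fintype.split j with inl _ => setT | inr k => B i k end.
have := PXY B'; rewrite (_ : [set t | _] = [set t | forall i j, B i j (Y t i j)]); last first.
  apply/seteqP; split=> t /= h i j.
    by have := h i (rshift b j); rewrite /B' (unsplitK (inr j)) row_mxEr.
  by rewrite /B' mxE; case: (fintype.split j).
move=> ->; last by move=> i j; rewrite /B'; case: (fintype.split j).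
apply: eq_bigr => i _; rewrite big_split_ord/= [X in (X * _)%E]big1 ?mul1e.
  by apply: eq_bigr => j _; rewrite /B' (unsplitK (inr j)).
by move=> j _; rewrite /B' (unsplitK (inl j)) normal_prob_setT.
Qed.

Let PbE a b c (X : T -> 'M[R]_(a, b)) (Y : T -> 'M[R]_(a, c))
    (B : 'I_a -> 'I_(b + c) -> set R) :
  [set t | forall i j, B i j (row_mx (X t) (Y t) i j)] =
  [set t | (forall i j, B i (lshift c j) (X t i j)) /\
           (forall i j, B i (rshift b j) (Y t i j))].
Proof.
apply/seteqP; split => t /=.
  by move=> h; split=> i j; [have := h i (lshift c j)|have := h i (rshift b j)];
     rewrite ?row_mxEl ?row_mxEr.
move=> [hX hY] i j; rewrite -(splitK j) mxE unsplitK.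
by case: (fintype.split j) => k /=; [exact: hX|exact: hY].
Qed.

Lemma gauss_row_indep a b c (X : T -> 'M[R]_(a, b)) (Y : T -> 'M[R]_(a, c)) :
  gauss_mx (fun t => row_mx (X t) (Y t)) -> indep_mx X Y.
Proof.
move=> gXY; have [mX PX] := gauss_mx_lsub gXY; have [mY PY] := gauss_mx_rsub gXY.
apply: indep_of_boxes; [exact: measurable_cvec..|move=> B C mB mC].
pose D i (j : 'I_(b + c)) := match fintype.split j with
  inl k => B (mxvec_index i k) | inr k => C (mxvec_index i k) end.
have [_ /(_ D)] := gXY; rewrite PbE.
rewrite (_ : [set t | _ /\ _] =
  [set t | cvbox B (cvec (X t)) /\ cvbox C (cvec (Y t))]); last first.
  apply/seteqP; split=> t /=; rewrite !cvbox_cvec /D => -[hX hY].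
    split=> i j; first by have := hX i j; rewrite (unsplitK (inl j)).
    by have := hY i j; rewrite (unsplitK (inr j)).
  by split=> i j; rewrite ?(unsplitK (inl j)) ?(unsplitK (inr j)).
move=> ->; last by move=> i j; rewrite /D; case: (fintype.split j).
rewrite [X in (X * _)%E](_ : _ =
  P [set t | forall i j, B (mxvec_index i j) (X t i j)]); last first.
  by congr (P _); apply/seteqP; split => t /cvbox_cvec.
rewrite [X in (_ * X)%E](_ : _ =
  P [set t | forall i j, C (mxvec_index i j) (Y t i j)]); last first.
  by congr (P _); apply/seteqP; split => t /cvbox_cvec.
rewrite (PX (fun i j => B (mxvec_index i j)))// (PY (fun i j => C (mxvec_index i j)))//.
rewrite -big_split/=; apply: eq_bigr => i _; rewrite big_split_ord /D/=.
by congr (_ * _)%E; apply: eq_bigr => j _;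
  rewrite ?(unsplitK (inl j)) ?(unsplitK (inr j)).
Qed.

Lemma gauss_row_mx a b c (X : T -> 'M[R]_(a, b)) (Y : T -> 'M[R]_(a, c)) :
  gauss_mx X -> gauss_mx Y -> indep_mx X Y ->
  gauss_mx (fun t => row_mx (X t) (Y t)).
Proof.
move=> [mX PX] [mY PY] XY; split=> [|B mB]; first exact: mxmeas_row_mx.
rewrite PbE.
(* The flattened index is decoded into its row and column, so that the rectangle becomes a box for
   [cvec]. *)
pose C (k : 'I_(a * b)) := let ij := enum_val (cast_ord (esym (mxvec_cast _ _)) k)
  in B ij.1 (lshift c ij.2).
pose D (k : 'I_(a * c)) := let ij := enum_val (cast_ord (esym (mxvec_cast _ _)) k)
  in B ij.1 (rshift b ij.2).
have CE i j : C (mxvec_index i j) = B i (lshift c j).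
  by rewrite /C /mxvec_index cast_ordK enum_rankK.
have DE i j : D (mxvec_index i j) = B i (rshift b j).
  by rewrite /D /mxvec_index cast_ordK enum_rankK.
have := XY _ _ (measurable_cvbox (B := C) (fun k => mB _ _))
               (measurable_cvbox (B := D) (fun k => mB _ _)).
have CX : [set t | cvbox C (cvec (X t))] =
    [set t | forall i j, B i (lshift c j) (X t i j)].
  by apply/seteqP; split=> t /=; rewrite cvbox_cvec => h i j; have := h i j;
    rewrite CE.
have DY : [set t | cvbox D (cvec (Y t))] =
    [set t | forall i j, B i (rshift b j) (Y t i j)].
  by apply/seteqP; split=> t /=; rewrite cvbox_cvec => h i j; have := h i j;
    rewrite DE.
rewrite (_ : [set t | _ /\ _] = [set t | cvbox C (cvec (X t))] `&`
   [set t | cvbox D (cvec (Y t))])// CX DY => ->.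
rewrite (PX (fun i j => B i (lshift c j)))// (PY (fun i j => B i (rshift b j)))//.
rewrite -big_split/=; apply: eq_bigr => i _.
by rewrite big_split_ord.
Qed.

Lemma gauss_mx_usub a b c (X : T -> 'M[R]_(a, c)) (Y : T -> 'M[R]_(b, c)) :
  gauss_mx (fun t => col_mx (X t) (Y t)) -> gauss_mx X.
Proof.
move=> /gauss_mx_tr; under [X in gauss_mx X]eq_fun do rewrite tr_col_mx.
by move=> /gauss_mx_lsub/gauss_mx_tr; apply: gauss_mx_eq => t; rewrite trmxK.
Qed.

Lemma gauss_mx_dsub a b c (X : T -> 'M[R]_(a, c)) (Y : T -> 'M[R]_(b, c)) :
  gauss_mx (fun t => col_mx (X t) (Y t)) -> gauss_mx Y.
Proof.
move=> /gauss_mx_tr; under [X in gauss_mx X]eq_fun do rewrite tr_col_mx.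
by move=> /gauss_mx_rsub/gauss_mx_tr; apply: gauss_mx_eq => t; rewrite trmxK.
Qed.

Lemma indep_mx_comp a b c e a' b' c' e'
    (X : T -> 'M[R]_(a, b)) (Y : T -> 'M[R]_(c, e))
    (f : 'M[R]_(a, b) -> 'M[R]_(a', b')) (g : 'M[R]_(c, e) -> 'M[R]_(c', e')) :
  mxmeas (fun z : 'cV[R]_(a * b) => f (vec_mx z^T)) ->
  mxmeas (fun z : 'cV[R]_(c * e) => g (vec_mx z^T)) ->
  indep_mx X Y -> indep_mx (fun t => f (X t)) (fun t => g (Y t)).
Proof.
move=> mf mg XY A B mA mB.
have mA' : measurable [set z : 'cV[R]_(a * b) | A (cvec (f (vec_mx z^T)))].
  have : measurable_fun setT (fun z : 'cV[R]_(a * b) => cvec (f (vec_mx z^T))).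
    by apply/measurable_cvP/mxmeas_tr/mxmeas_mxvec.
  by move=> /(_ measurableT A mA); rewrite setTI.
have mB' : measurable [set z : 'cV[R]_(c * e) | B (cvec (g (vec_mx z^T)))].
  have : measurable_fun setT (fun z : 'cV[R]_(c * e) => cvec (g (vec_mx z^T))).
    by apply/measurable_cvP/mxmeas_tr/mxmeas_mxvec.
  by move=> /(_ measurableT B mB); rewrite setTI.
pose F t := f (vec_mx (cvec (X t))^T); pose G t := g (vec_mx (cvec (Y t))^T).
have FE : F = (fun t => f (X t)) by apply/funext => t; rewrite /F cvecK.
have GE : G = (fun t => g (Y t)) by apply/funext => t; rewrite /G cvecK.
have : P [set t | A (cvec (F t)) /\ B (cvec (G t))] = (P [set t | A (cvec (F t))] *
  P [set t | B (cvec (G t))])%E := XY _ _ mA' mB'.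
by rewrite FE GE.
Qed.

Lemma gauss_col_indep a b c (X : T -> 'M[R]_(a, c)) (Y : T -> 'M[R]_(b, c)) :
  gauss_mx (fun t => col_mx (X t) (Y t)) -> indep_mx X Y.
Proof.
move=> /gauss_mx_tr; under [X in gauss_mx X]eq_fun do rewrite tr_col_mx.
move=> /gauss_row_indep /(@indep_mx_comp _ _ _ _ _ _ _ _ _ _ trmx trmx).
under [X in indep_mx X]eq_fun do rewrite trmxK.
under [X in indep_mx _ X]eq_fun do rewrite trmxK.
by apply; exact: mxmeas_tr (@mxmeas_uncvec _ _).
Qed.

Lemma gauss_col_mx a b c (X : T -> 'M[R]_(a, c)) (Y : T -> 'M[R]_(b, c)) :
  gauss_mx X -> gauss_mx Y -> indep_mx X Y ->
  gauss_mx (fun t => col_mx (X t) (Y t)).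
Proof.
move=> gX gY /(@indep_mx_comp _ _ _ _ _ _ _ _ _ _ trmx trmx) XY.
have : gauss_mx (fun t => row_mx (X t)^T (Y t)^T).
  apply: gauss_row_mx; [exact: gauss_mx_tr..|].
  by apply: XY; exact: mxmeas_tr (@mxmeas_uncvec _ _).
move=> /gauss_mx_tr; apply: gauss_mx_eq => t.
by rewrite tr_row_mx !trmxK.
Qed.

End gaussian_matrices.

(** * The standard normal density and invariance under plane rotations *)

Section standard_normal.
Context {R : realType}.
Local Notation leb := (@lebesgue_measure R).
Local Notation phi := (normal_pdf (0 : R) 1).
Local Notation gam := (normal_prob (0 : R) 1).

(** By uniqueness of Lebesgue measure: the image of it under x -> a x + b, scaled by |a|, gives
    half-open intervals their length. *)
Lemma ge0_integral_affine (a b : R) (g : R -> \bar R) : a != 0 ->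
  measurable_fun setT g -> (forall x, (0 <= g x)%E) ->
  (\int[leb]_x g x = `|a|%:E * \int[leb]_x g (a * x + b)%R)%E.
Proof.
move=> a0 mg g0.
have mphi : measurable_fun [set: R] (fun x : R => a * x + b).
  by apply: measurable_funD => //; exact: measurable_funM.
pose ph : R -> measurableTypeR R := fun x => a * x + b.
pose m1 : {measure set (measurableTypeR R) -> \bar R} := pushforward leb ph.
pose m' : {measure set (measurableTypeR R) -> \bar R} :=
  mscale (NngNum (normr_ge0 a)) (m1 mphi).
have lebm' A : measurable A -> leb A = m' A.
  apply: lebesgue_measure_unique => _ [[c e] _ <-] /=.
  rewrite lebesgue_measure_itv /m' /mscale/= /pushforward/=.
  have [a_gt0|a_lt0|a_eq0] := ltgtP 0 a; last by rewrite -a_eq0 eqxx in a0.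
    rewrite (_ : _ @^-1` _ = `](c - b) / a, (e - b) / a]%classic).
      rewrite lebesgue_measure_itv/= !lte_fin ltr_pM2r ?invr_gt0//.
      rewrite ltrD2r; case: ifP => _; last by rewrite mule0.
      by rewrite -!EFinB -EFinM gtr0_norm//; congr EFin; field.
    apply/seteqP; split => x /=; rewrite !in_itv/= /ph => /andP[h1 h2]; apply/andP.
      by rewrite ltr_pdivrMr// ler_pdivlMr//; split; lra.
    by move: h1 h2; rewrite ltr_pdivrMr// ler_pdivlMr//; split; lra.
  (* A negative slope reverses the interval, so the closed end is now on the left. *)
  rewrite (_ : _ @^-1` _ = `[(e - b) / a, (c - b) / a[%classic).
    rewrite lebesgue_measure_itv/= !lte_fin ltr_nM2r ?invr_lt0//.
    rewrite ltrD2r; case: ifP => _; last by rewrite mule0.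
    by rewrite -!EFinB -EFinM ltr0_norm//; congr EFin; field.
  apply/seteqP; split => x /=; rewrite !in_itv/= /ph => /andP[h1 h2]; apply/andP.
    by rewrite ltr_ndivlMr// ler_ndivrMr//; split; lra.
  by move: h1 h2; rewrite ltr_ndivlMr// ler_ndivrMr//; split; lra.
rewrite (eq_measure_integral m'); last by move=> A mA _; exact: lebm'.
rewrite ge0_integral_mscale//; congr (_ * _)%E.
by rewrite ge0_integral_pushforward.
Qed.

Lemma normal_pdf01 (x : R) : phi x = normal_peak 1 * expR (- x ^+ 2 / 2).
Proof.
by rewrite normal_pdfE ?oner_neq0// /normal_fun subr0 expr1n.
Qed.

(** The change of variables uses an abstract Radon-Nikodym derivative, determined only almost
    everywhere; it is identified with the density because both have the same integral over every
    measurable set. *)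
Lemma ge0_integral_normal (f : R -> \bar R) :
  measurable_fun setT f -> (forall x, (0 <= f x)%E) ->
  (\int[gam]_x f x = \int[leb]_x (f x * (phi x)%:E))%E.
Proof.
move=> mf f0; have dom := normal_prob_dominates (0 : R) 1.
rewrite -(Radon_Nikodym_SigmaFinite.change_of_variables dom)//.
have mphi : measurable_fun [set: R] (EFin \o phi).
  by apply/measurable_EFinP; exact: measurable_normal_pdf.
have iRN := Radon_Nikodym_SigmaFinite.f_integrable dom.
apply: ge0_ae_eq_integral => //.
- by apply: emeasurable_funM => //; exact: measurable_int iRN.
- exact: emeasurable_funM.
- by move=> x _; rewrite mule_ge0//; exact: Radon_Nikodym_SigmaFinite.f_ge0.
- by move=> x _; rewrite mule_ge0// lee_fin normal_pdf_ge0.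
apply: ae_eqe_mul2l; apply: integral_ae_eq => // E _ mE.
by rewrite -(Radon_Nikodym_SigmaFinite.f_integral dom).
Qed.

Let mphi2 d (T : measurableType d) (f : T -> R) :
  measurable_fun setT f -> measurable_fun setT (fun t => phi (f t)).
Proof.
by move=> mf; apply: measurableT_comp => //; exact: measurable_normal_pdf.
Qed.

Lemma normal_product_integral (E : set (R * R)) : measurable E ->
  ((gam \x gam) E =
   \int[leb]_x \int[leb]_y (\1_E (x, y) * phi x * phi y)%:E)%E.
Proof.
move=> mE; rewrite /product_measure1 ge0_integral_normal; last 2 first.
- by apply: (measurable_fun_xsection gam).
- by move=> x; exact: measure_ge0.
apply: eq_integral => x _ /=.
have mI : measurable_fun setT (fun y => \1_E (x, y) : R).
  by apply: measurableT_comp; [exact: measurable_indic|exact: measurable_fun_pair].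
rewrite -[xsection E x]setIT -integral_indic//; last exact: measurable_xsection.
rewrite ge0_integral_normal; last 2 first.
- by apply/measurable_EFinP; apply: measurable_indic; exact: measurable_xsection.
- by move=> y; rewrite lee_fin.
rewrite -ge0_integralZr; last 4 first.
- exact: measurableT.
- apply: emeasurable_funM; last by apply/measurable_EFinP; exact: mphi2.
  by apply/measurable_EFinP; apply: measurable_indic; exact: measurable_xsection.
- by move=> y _; rewrite mule_ge0// lee_fin ?normal_pdf_ge0.
- by rewrite lee_fin normal_pdf_ge0.
apply: eq_integral => y _; rewrite -!EFinM mulrAC; congr (_ * _ * _)%:E.
by rewrite !indicE mem_xsection.
Qed.

(** The rotation is performed as two one-variable affine substitutions separated by an exchange of
    the integrals, and phi(x) phi(y) depends on x^2 + y^2 only. The condition s != 0 makes both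
    substitutions invertible. *)
Lemma normal_rotation (c s : R) (S : set (R * R)) : c ^+ 2 + s ^+ 2 = 1 ->
  s != 0 -> measurable S ->
  (gam \x gam)%E [set z | S (c * z.1 + s * z.2, - s * z.1 + c * z.2)] =
  (gam \x gam)%E S.
Proof.
move=> cs s0 mS; set E := [set z | _].
have mrot : measurable_fun [set: R * R]
    (fun z => (c * z.1 + s * z.2, - s * z.1 + c * z.2)).
  by apply: measurable_fun_pair; apply: measurable_funD; apply: measurable_funM.
have mE : measurable E.
  by have := mrot measurableT _ mS; rewrite setTI.
rewrite (normal_product_integral mE) (normal_product_integral mS).
have mI : measurable_fun setT (\1_S : R * R -> R) by exact: measurable_indic.
have mIE : measurable_fun setT (\1_E : R * R -> R) by exact: measurable_indic.
pose K u x : R := `|s^-1| * (\1_S (u, - s * x + c * ((u - c * x) / s)) * phi x *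
                     phi ((u - c * x) / s)).
have K0 u x : 0 <= K u x by rewrite !mulr_ge0// normal_pdf_ge0.
have mK : measurable_fun [set: R * R] (fun z => (K z.1 z.2)%:E).
  have ml : measurable_fun [set: R * R] (fun z => (z.1 - c * z.2) / s).
    apply: measurable_funM => //; apply: measurable_funB => //.
    exact: measurable_funM.
  apply/measurable_EFinP; apply: measurable_funM => //.
  apply: measurable_funM; last exact: mphi2.
  apply: measurable_funM; last exact: mphi2.
  apply: measurableT_comp mI _; apply: measurable_fun_pair => //.
  by apply: measurable_funD; apply: measurable_funM.
transitivity (\int[leb]_x \int[leb]_u (K u x)%:E)%E.
  apply: eq_integral => x _.
  (* The new inner variable is u = c x + s y; [K] is the integrand in the variables u and x. *)
  rewrite (ge0_integral_affine (a := s^-1) (- (c * x) / s)) ?invr_eq0//; last 2 first.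
  - apply/measurable_EFinP; apply: measurable_funM; last exact: mphi2.
    by apply: measurable_funM => //; apply: measurableT_comp => //; exact: measurable_fun_pair.
  - by move=> y; rewrite lee_fin !mulr_ge0// normal_pdf_ge0.
  rewrite -ge0_integralZl; last 4 first.
  - exact: measurableT.
  - apply/measurable_EFinP.
    have ml : measurable_fun [set: R] (fun y => s^-1 * y + - (c * x) / s).
      by apply: measurable_funD => //; exact: measurable_funM.
    apply: measurable_funM; last exact: mphi2.
    apply: measurable_funM => //; apply: measurableT_comp => //.
    exact: measurable_fun_pair.
  - by move=> y _; rewrite lee_fin !mulr_ge0// normal_pdf_ge0.
  - by rewrite lee_fin.
  apply: eq_integral => u _; rewrite -EFinM /K.
  have -> : s^-1 * u + - (c * x) / s = (u - c * x) / s by field.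
  congr (_ * (_ * _ * _))%:E; rewrite !indicE; congr ((nat_of_bool _)%:R).
  have e1 : c * x + s * ((u - c * x) / s) = u by field.
  by apply/idP/idP; rewrite !inE /E /= e1.
transitivity (\int[leb]_u \int[leb]_x (K u x)%:E)%E.
  apply: (fubini_tonelli (m1 := leb) (m2 := leb) (fun z => (K z.2 z.1)%:E)) => [|z].
    exact: measurableT_comp mK (@measurable_swap _ _ R R).
  by rewrite lee_fin.
apply: eq_integral => u _.
have mKu : measurable_fun setT (fun x => (K u x)%:E).
  exact: measurableT_comp mK (measurable_fun_pair (measurable_cst u) (@measurable_id _ _ setT)).
(* For fixed u the second coordinate v of the rotated point satisfies x = - s v + c u; the factor
   |s| cancels the |s^-1| of the first substitution. *)
rewrite (ge0_integral_affine (a := - s) (c * u)) ?oppr_eq0//; last first.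
  by move=> x; rewrite lee_fin.
rewrite -ge0_integralZl; last 4 first.
- exact: measurableT.
- apply: measurableT_comp mKu _.
  by apply: measurable_funD => //; exact: measurable_funM.
- by move=> x _; rewrite lee_fin.
- by rewrite lee_fin.
apply: eq_integral => v _; rewrite -EFinM; congr EFin.
have e1 : (u - c * (- s * v + c * u)) / s = s * u + c * v.
  apply: (mulIf s0); rewrite divfK//.
  by rewrite -[u in u - _]mul1r -cs; ring.
rewrite /K e1 mulrA normrN -normrM divff// normr1 mul1r.
have -> : - s * (- s * v + c * u) + c * (s * u + c * v) = v.
  by rewrite -[RHS]mul1r -cs; ring.
rewrite -!mulrA; congr (_ * _).
rewrite !normal_pdf01 mulrACA [RHS]mulrACA -!expRD; congr (_ * expR _).
have -> : (- s * v + c * u) ^+ 2 = (c ^+ 2 + s ^+ 2) * (u ^+ 2 + v ^+ 2) - (s * u + c * v) ^+ 2.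
  by ring.
by rewrite cs; field.
Qed.

End standard_normal.

(** * Gaussian laws under orthonormal maps, from signs and plane rotations *)

Section orthonormal_images.
Context {R : realType}.
Local Notation gam := (normal_prob (0 : R) 1).

Lemma mx11E (M : 'M[R]_1) i j : M i j = M ord0 ord0.
Proof. by rewrite !ord1. Qed.

Lemma gauss_mx11 d (T : measurableType d) (P : probability T R)
    (x : T -> 'M[R]_1) :
  gauss_mx P x <-> measurable_fun setT (fun t => x t ord0 ord0) /\
    forall B, measurable B -> P [set t | B (x t ord0 ord0)] = gam B.
Proof.
split=> [[mx Px]|[mx Px]]; split=> [|B mB].
- exact: mx.
- have := Px (fun _ _ => B) (fun _ _ => mB); rewrite !big_ord1 => <-.
  by congr (P _); apply/seteqP; split=> t /= h; [move=> i j; rewrite mx11E|exact: h].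
- by move=> i j; under eq_fun do rewrite mx11E.
- rewrite !big_ord1 -Px//; congr (P _); apply/seteqP; split=> t /= h.
    exact: h.
  by move=> i j; rewrite mx11E !ord1.
Qed.

Lemma gauss_pair d (T : measurableType d) (P : probability T R)
    (x y : T -> 'M[R]_1) (S : set (R * R)) :
  gauss_mx P (fun t => col_mx (x t) (y t)) -> measurable S ->
  P [set t | S (x t ord0 ord0, y t ord0 ord0)] = (gam \x gam)%E S.
Proof.
move=> gxy mS.
have /gauss_mx11[mx Px] := gauss_mx_usub gxy.
have /gauss_mx11[my Py] := gauss_mx_dsub gxy.
have mx' : @measurable_fun _ _ T (measurableTypeR R) setT
  (fun t => x t ord0 ord0) by exact: mx.
have my' : @measurable_fun _ _ T (measurableTypeR R) setT
  (fun t => y t ord0 ord0) by exact: my.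
have mxy := measurable_fun_pair mx' my'.
have := @product_measure_unique _ _ _ _ R gam gam (law P mxy).
move=> /(_ _ S mS)/esym; apply => //.
move=> A B mA mB.
transitivity (P [set t | A (x t ord0 ord0)] * P [set t | B (y t ord0 ord0)])%E;
  last by congr (_ * _)%E; [exact: Px|exact: Py].
have m1 C : measurable C -> measurable [set z : 'cV[R]_(1 * 1) | C (z ord0 ord0)].
  by move=> mC; have := @mxmeas_id R (1 * 1) ord0 ord0 measurableT C mC; rewrite setTI.
have cE (M : 'M[R]_1) : cvec M ord0 ord0 = M ord0 ord0.
  rewrite /cvec mxE -[RHS](mxvecE M); congr (mxvec M _ _).
  by apply: val_inj; case: (mxvec_index _ _) => -[].
have := gauss_col_indep gxy (m1 A mA) (m1 B mB); rewrite /=.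
under eq_set do rewrite !cE.
by under [X in _ = (P X * _)%E -> _]eq_set do rewrite cE;
  under [X in _ = (_ * P X)%E -> _]eq_set do rewrite cE.
Qed.

(** A quarter turn sends (x, y) to (y, - x); only the second coordinate is tested. *)
Lemma normal_prob_opp (B : set R) : measurable B -> gam [set x | B (- x)] = gam B.
Proof.
move=> mB.
have mN : measurable [set x : R | B (- x)].
  by have := @oppr_measurable R setT measurableT _ mB; rewrite setTI.
have cs : (0 : R) ^+ 2 + 1 ^+ 2 = 1 by rewrite expr0n expr1n add0r.
have mTB : measurable ([set: R] `*` B) by exact: measurableX.
have := normal_rotation cs (oner_neq0 R) mTB.
rewrite (_ : [set _ | _] = [set x | B (- x)] `*` [set: R]); last first.
  by apply/seteqP; split=> -[x y] /=; rewrite !mul0r addr0 mulN1r => -[].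
have pE C D : measurable C -> measurable D ->
    (gam \x gam)%E (C `*` D) = (gam C * gam D)%E by exact: product_measure1E.
have gT : gam setT = 1%E by exact: normal_prob_setT.
by rewrite (pE _ _ mN measurableT) (pE _ _ measurableT mB) gT mule1 mul1e.
Qed.

(* A matrix with orthonormal rows maps Gaussian vectors to Gaussian vectors;
   this is the closure property through which it is proved. *)
Definition preserving_gauss a b (L : 'M[R]_(a, b)) : Prop :=
  forall d (T : measurableType d) (P : probability T R) (z : T -> 'cV[R]_b),
    gauss_mx P z -> gauss_mx P (fun t => L *m z t).

Lemma preserving_comp a b c (L : 'M[R]_(a, b)) (M : 'M[R]_(b, c)) :
  preserving_gauss L -> preserving_gauss M -> preserving_gauss (L *m M).
Proof.
move=> pL pM d T P z gz; have := pL _ _ _ _ (pM _ _ _ _ gz).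
by apply: gauss_mx_eq => t; rewrite mulmxA.
Qed.

Lemma preserving1 a : preserving_gauss (1%:M : 'M[R]_a).
Proof. by move=> d T P z; apply: gauss_mx_eq => t; rewrite mul1mx. Qed.

Lemma mxmeas_mulmx_uncvec a b c (L : 'M[R]_(c, a)) :
  mxmeas (fun z : 'cV[R]_(a * b) => L *m vec_mx z^T).
Proof. by apply: mxmeas_mul; [exact: mxmeas_cst|exact: mxmeas_uncvec]. Qed.

Lemma preserving_diag a b a' b' (L : 'M[R]_(a, b)) (M : 'M[R]_(a', b')) :
  preserving_gauss L -> preserving_gauss M ->
  preserving_gauss (block_mx L 0 0 M).
Proof.
move=> pL pM d T P z gz.
have gz' : gauss_mx P (fun t => col_mx (usubmx (z t)) (dsubmx (z t))).
  by apply: gauss_mx_eq gz => t; rewrite vsubmxK.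
have : gauss_mx P (fun t => col_mx (L *m usubmx (z t)) (M *m dsubmx (z t))).
  apply: gauss_col_mx.
  - exact/pL/(gauss_mx_usub gz').
  - exact/pM/(gauss_mx_dsub gz').
  - apply: (indep_mx_comp (f := mulmx L) (g := mulmx M)); last exact: gauss_col_indep.
      exact: mxmeas_mulmx_uncvec.
    exact: mxmeas_mulmx_uncvec.
apply: gauss_mx_eq => t.
by rewrite -[in RHS](vsubmxK (z t)) mul_block_col !mul0mx addr0 add0r.
Qed.

Lemma preserving_sign (l : 'M[R]_1) : l^T *m l = 1%:M -> preserving_gauss l.
Proof.
move=> ll d T P z /gauss_mx11[mz Pz]; apply/gauss_mx11.
have zE t : (l *m z t) ord0 ord0 = l ord0 ord0 * z t ord0 ord0.
  by rewrite mxE big_ord1.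
under eq_fun do rewrite zE; split=> [|B mB]; first exact: measurable_funM.
under eq_set do rewrite zE.
have /eqP : l ord0 ord0 ^+ 2 = 1.
  by have := congr1 (fun M : 'M[R]_1 => M ord0 ord0) ll; rewrite !mxE big_ord1 mxE.
rewrite sqrf_eq1 => /orP[]/eqP ->.
  by under eq_set do rewrite mul1r; exact: Pz.
under eq_set do rewrite mulN1r; rewrite -(normal_prob_opp mB) -Pz//.
by have := @oppr_measurable R setT measurableT _ mB; rewrite setTI.
Qed.

Definition rot2 (c s : R) : 'M[R]_(1 + 1) :=
  block_mx c%:M s%:M (- s)%:M c%:M.

Lemma preserving_rot2 (c s : R) : c ^+ 2 + s ^+ 2 = 1 -> preserving_gauss (rot2 c s).
Proof.
(* The case s = 0 is outside the scope of [normal_rotation]; the matrix is then diagonal with c = 1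
   or c = -1. *)
move=> cs; have [s0|s0] := eqVneq s 0.
  rewrite /rot2 s0 oppr0 !raddf0; apply: preserving_diag; apply: preserving_sign;
  by rewrite tr_scalar_mx -scalar_mxM -expr2; congr _%:M; rewrite -cs s0 expr0n addr0.
move=> d T P z gz.
pose x t := usubmx (z t); pose y t := dsubmx (z t).
have gz' : gauss_mx P (fun t => col_mx (x t) (y t)).
  by apply: gauss_mx_eq gz => t; rewrite vsubmxK.
have rE t : rot2 c s *m z t =
    col_mx (c *: x t + s *: y t) (- s *: x t + c *: y t).
  by rewrite -[in LHS](vsubmxK (z t)) mul_block_col !mul_scalar_mx.
have [mz _] := gz; split=> [|B mB].
  by apply: mxmeas_mul => //; exact: mxmeas_cst.
have mS : measurable (B (lshift 1 ord0) ord0 `*` B (rshift 1 ord0) ord0).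
  exact: measurableX.
transitivity (P [set t | (B (lshift 1 ord0) ord0 `*` B (rshift 1 ord0) ord0)
   (c * x t ord0 ord0 + s * y t ord0 ord0, - s * x t ord0 ord0 + c * y t ord0 ord0)]).
  congr (P _); apply/seteqP; split=> t /=.
    move=> h; have := h (lshift 1 ord0) ord0; have := h (rshift 1 ord0) ord0.
    by rewrite rE col_mxEu col_mxEd !mxE.
  rewrite rE => -[h1 h2] i j; rewrite ord1 -(splitK i) mxE unsplitK.
  by case: (fintype.split i) => k; rewrite /= [k]ord1; [move: h1|move: h2]; rewrite !mxE.
rewrite (gauss_pair (S := [set w | (B (lshift 1 ord0) ord0 `*` B (rshift 1 ord0) ord0)
   (c * w.1 + s * w.2, - s * w.1 + c * w.2)]) gz').
  rewrite (normal_rotation cs s0 mS).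
  transitivity (gam (B (lshift 1 ord0) ord0) * gam (B (rshift 1 ord0) ord0))%E.
    by apply: product_measure1E; exact: mB.
  rewrite big_ord_recl !big_ord1.
  by congr (gam (B _ _) * gam (B _ _))%E; apply: val_inj.
have mrot : measurable_fun [set: R * R]
    (fun z => (c * z.1 + s * z.2, - s * z.1 + c * z.2)).
  by apply: measurable_fun_pair; apply: measurable_funD; apply: measurable_funM.
by have := mrot measurableT _ mS; rewrite setTI.
Qed.

Lemma mx11_sqr (l : 'M[R]_1) : l^T *m l = (l ord0 ord0 ^+ 2)%:M.
Proof.
by apply/matrixP => i j; rewrite !ord1 !mxE big_ord1 mxE expr2 mulr1n.
Qed.

Lemma normsq_ge0 n (v : 'cV[R]_n) : 0 <= (v^T *m v) ord0 ord0.
Proof.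
by rewrite mxE sumr_ge0// => i _; rewrite mxE -expr2 sqr_ge0.
Qed.

Lemma normsq_eq0 n (v : 'cV[R]_n) : (v^T *m v) ord0 ord0 = 0 -> v = 0.
Proof.
rewrite mxE => /eqP; rewrite psumr_eq0 => [/allP h|i _]; last first.
  by rewrite mxE -expr2 sqr_ge0.
apply/matrixP => i j; rewrite ord1 mxE; apply/eqP.
by have := h i (mem_index_enum i); rewrite mxE mulf_eq0 orbb.
Qed.

Lemma block_diag_orthonormal a b (A : 'M[R]_a) (B : 'M[R]_b) :
  A^T *m A = 1%:M -> B^T *m B = 1%:M ->
  (block_mx A 0 0 B)^T *m block_mx A 0 0 B = 1%:M.
Proof.
move=> AA BB; rewrite tr_block_mx !trmx0 mulmx_block.
by rewrite !mulmx0 !mul0mx !addr0 !add0r AA BB -scalar_mx_block.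
Qed.

Lemma block_diag_col a b c (A : 'M[R]_a) (B : 'M[R]_b)
    (u : 'M[R]_(a, c)) (v : 'M[R]_(b, c)) :
  block_mx A 0 0 B *m col_mx u v = col_mx (A *m u) (B *m v).
Proof. by rewrite mul_block_col !mul0mx addr0 add0r. Qed.

Lemma rot2_orthonormal (c s : R) : c ^+ 2 + s ^+ 2 = 1 ->
  (rot2 c s)^T *m rot2 c s = 1%:M.
Proof.
move=> cs; rewrite /rot2 tr_block_mx mulmx_block !tr_scalar_mx.
rewrite -!scalar_mxM -!raddfD/= -!expr2 sqrrN cs [in s ^+ 2 + _]addrC cs.
by rewrite mulNr mulrN [s * c]mulrC addrN raddf0 -scalar_mx_block.
Qed.

Lemma rot2_col (c s : R) : c ^+ 2 + s ^+ 2 = 1 ->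
  rot2 c s *m col_mx c%:M s%:M = col_mx 1%:M 0.
Proof.
move=> cs; rewrite /rot2 mul_block_col -!scalar_mxM -!raddfD/= -!expr2 cs.
by rewrite mulNr [s * c]mulrC addNr raddf0.
Qed.

Lemma delta0_col a b : col_mx (delta_mx ord0 ord0 : 'cV[R]_a.+1) (0 : 'cV[R]_b) =
  delta_mx ord0 ord0 :> 'cV[R]_(a.+1 + b).
Proof.
apply/matrixP => i j; rewrite mxE; case: splitP => k ik; rewrite !mxE.
  by rewrite !eqE /= ik.
by rewrite (_ : (i == ord0) = false)//; apply/eqP => i0; move: ik; rewrite i0.
Qed.

(** Induction on the dimension: a map of the tail coordinates moves the tail of l onto one axis, and
    a Givens rotation of the first two coordinates absorbs it. Q is thus assembled from blocks
    already known to preserve Gaussian laws. *)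
Lemma rotate_to_e0 n (l : 'cV[R]_n.+1) : l^T *m l = 1%:M ->
  exists Q : 'M[R]_n.+1,
    [/\ preserving_gauss Q, Q^T *m Q = 1%:M & Q *m l = delta_mx ord0 ord0].
Proof.
elim: n l => [|n IH] l ll.
  exists (l^T : 'M[R]_1); split.
  - apply: preserving_sign; rewrite trmxK.
    by rewrite -[X in X *m _]trmxK mx11_sqr mxE -mx11_sqr.
  - by rewrite mx11_sqr mxE -mx11_sqr.
  - by rewrite ll; apply/matrixP => i j; rewrite !ord1 !mxE.
pose l0 : 'M[R]_1 := @usubmx R 1 n.+1 1 l.
pose l1 : 'cV[R]_n.+1 := @dsubmx R 1 n.+1 1 l.
have lE : l = col_mx l0 l1 by rewrite vsubmxK.
pose s := Num.sqrt ((l1^T *m l1) ord0 ord0).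
have [Q [pQ QQ Ql]] : exists Q : 'M[R]_n.+1,
    [/\ preserving_gauss Q, Q^T *m Q = 1%:M & Q *m l1 = s *: delta_mx ord0 ord0].
  (* A zero tail has no direction to normalize, and the identity already works for it. *)
  have [s0|s0] := eqVneq s 0.
    exists 1%:M; split; [exact: preserving1|by rewrite trmx1 mul1mx|].
    rewrite mul1mx s0 scale0r; apply: normsq_eq0; apply/eqP.
    by rewrite eq_le normsq_ge0 andbT -sqrtr_eq0 -/s s0.
  have [|Q [pQ QQ Ql]] := IH (s^-1 *: l1).
    rewrite -scalemxAr [(_ *: l1)^T]linearZ/= -scalemxAl scalerA.
    apply/matrixP => i j; rewrite !ord1 mxE.
    rewrite -(sqr_sqrtr (normsq_ge0 l1)) -/s -expr2 -exprMn mulVf// !mxE/= expr1n.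
    by [].
  exists Q; split=> //; rewrite -Ql -scalemxAr scalerA divff// scale1r//.
have l0s : l0 ord0 ord0 ^+ 2 + s ^+ 2 = 1.
  rewrite sqr_sqrtr ?normsq_ge0//.
  have : l0^T *m l0 + l1^T *m l1 = 1%:M.
    by rewrite -mul_row_col -(tr_col_mx l0) -lE.
  by move/(congr1 (fun M : 'M[R]_1 => M ord0 ord0)); rewrite mx11_sqr !mxE !mulr1n.
pose G : 'M[R]_n.+2 := block_mx (rot2 (l0 ord0 ord0) s) 0 0 (1%:M : 'M[R]_n).
pose D : 'M[R]_n.+2 := block_mx (1%:M : 'M[R]_1) 0 0 Q.
have I1 k : (1%:M : 'M[R]_k)^T *m 1%:M = 1%:M by rewrite trmx1 mul1mx.
have GG : G^T *m G = 1%:M.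
  exact: (block_diag_orthonormal (rot2_orthonormal l0s) (I1 n)).
have DD : D^T *m D = 1%:M by exact: (block_diag_orthonormal (I1 1) QQ).
exists (G *m D); split.
- apply: preserving_comp.
    exact: (preserving_diag (preserving_rot2 l0s) (@preserving1 n)).
  exact: (preserving_diag (@preserving1 1) pQ).
- by rewrite trmx_mul mulmxA -(mulmxA D^T) GG mulmx1.
have Dl : D *m l = col_mx (col_mx l0 s%:M : 'cV[R]_(1 + 1)) (0 : 'cV[R]_n).
  rewrite [in LHS]lE; rewrite [LHS](block_diag_col (1%:M : 'M[R]_1)) mul1mx Ql.
  have -> : s *: delta_mx ord0 ord0 = col_mx (s%:M : 'M[R]_1) (0 : 'cV[R]_n) :> 'cV[R]_(1 + n).
    apply/matrixP => i j; rewrite ord1 !mxE -[in LHS](splitK i).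
    case: (fintype.split i) => k; last by rewrite !mxE mulr0.
    by rewrite [k]ord1 [j]ord1 mxE !eqE /= mulr1 mulr1n.
  exact: etrans (@col_mxA R 1 1 n 1 l0 s%:M 0) (castmx_id _ _).
rewrite -mulmxA Dl [LHS](block_diag_col (rot2 _ _)) mulmx0.
rewrite {2}[l0]mx11_scalar rot2_col//.
have -> : 1%:M = delta_mx ord0 ord0 :> 'M[R]_1.
  by apply/matrixP => i j; rewrite !ord1 !mxE.
by rewrite (delta0_col 0 1); exact: (delta0_col 1 n).
Qed.

End orthonormal_images.

Section orthonormal_matrices.
Context {R : realType}.

(** Induction on the rows: once the first row is rotated to e_0, orthogonality forces the first
    column of the other rows to vanish, so L is a block-diagonal matrix diag(1, L2) times a
    rotation, with L2 again orthonormal. *)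
Lemma preserving_orthonormal a b (L : 'M[R]_(a, b)) :
  L *m L^T = 1%:M -> preserving_gauss L.
Proof.
elim: a b L => [|a IH] b L LL.
  move=> d T P z [mz _]; split=> [|B mB].
    by apply: mxmeas_mul => //; exact: mxmeas_cst.
  rewrite big_ord0 -(probability_setT P); congr (P _).
  by apply/seteqP; split=> t // _ [].
case: b L LL => [|b] L LL.
  have := congr1 (fun M : 'M[R]_a.+1 => M ord0 ord0) LL.
  by rewrite !mxE big_ord0 => /esym/eqP; rewrite oner_eq0.
pose l : 'rV[R]_b.+1 := @usubmx R 1 a b.+1 L.
pose L' : 'M[R]_(a, b.+1) := @dsubmx R 1 a b.+1 L.
have LE : L = @col_mx R 1 a b.+1 l L' by rewrite vsubmxK.
have : block_mx (l *m l^T) (l *m L'^T) (L' *m l^T) (L' *m L'^T) =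
    block_mx 1%:M 0 0 1%:M :> 'M[R]_(1 + a).
  by rewrite -mul_col_row -tr_col_mx -LE -scalar_mx_block.
move=> /eq_block_mx[ll lL' L'l L'L'].
have [|Q [pQ QQ Ql]] := @rotate_to_e0 R b l^T; first by rewrite trmxK.
have QQ' : Q *m Q^T = 1%:M by apply: mulmx1C.
pose M : 'M[R]_(a, 1 + b) := L' *m Q^T.
have Me0 : lsubmx M = 0.
  have -> : lsubmx M = M *m delta_mx ord0 ord0.
    rewrite -colE; apply/matrixP => i j; rewrite [LHS]mxE [RHS]mxE; congr (M i _).
    by apply: val_inj; rewrite [j]ord1.
  by rewrite -Ql /M -mulmxA (mulmxA Q^T) QQ mul1mx.
pose L2 := rsubmx M.
have ME : M = row_mx 0 L2 by rewrite -[LHS]hsubmxK Me0.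
have L2L2 : L2 *m L2^T = 1%:M.
  have : M *m M^T = 1%:M.
    by rewrite /M trmx_mul trmxK -mulmxA (mulmxA Q^T) QQ mul1mx.
  by rewrite ME tr_row_mx mul_row_col mul0mx add0r.
have -> : L = (block_mx (1%:M : 'M[R]_1) 0 0 L2 : 'M[R]_(1 + a, 1 + b)) *m Q.
  rewrite -[LHS]mulmx1 -QQ mulmxA; congr (_ *m Q).
  rewrite LE (mul_col_mx l) -/M ME /block_mx; apply: (congr2 (@col_mx R 1 a (1 + b))) => //.
  rewrite -[l]trmxK -trmx_mul Ql.
  transitivity ((col_mx (delta_mx ord0 ord0 : 'cV[R]_1) (0 : 'cV[R]_b))^T).
    by congr (_^T); exact/esym/(delta0_col 0 b).
  rewrite tr_col_mx trmx0 trmx_delta; congr row_mx.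
  by apply/matrixP => i j; rewrite !ord1 !mxE.
apply: preserving_comp => //.
by apply: (preserving_diag (@preserving1 _ 1)); exact: IH.
Qed.

Context {d} {T : measurableType d}.
Variable P : probability T R.

(** Column by column: the columns of a Gaussian matrix are independent and remain so after L is
    applied to each. *)
Lemma gauss_mull a b n (L : 'M[R]_(a, b)) (Z : T -> 'M[R]_(b, n)) :
  L *m L^T = 1%:M -> gauss_mx P Z -> gauss_mx P (fun t => L *m Z t).
Proof.
move=> LL; elim: n Z => [|n IH] Z gZ.
  have [mZ _] := gZ; split=> [|B mB].
    by apply: mxmeas_mul => //; exact: mxmeas_cst.
  rewrite big1 => [|i _]; last by rewrite big_ord0.
  rewrite -(probability_setT P); congr (P _).
  by apply/seteqP; split=> t // _ i [].
pose x t : 'cV[R]_b := @lsubmx R b 1 n (Z t); pose y t := @rsubmx R b 1 n (Z t).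
have gZ' : gauss_mx P (fun t => row_mx (x t) (y t)).
  by apply: gauss_mx_eq gZ => t; rewrite hsubmxK.
have : gauss_mx P (fun t => row_mx (L *m x t) (L *m y t)).
  apply: gauss_row_mx.
  - exact/preserving_orthonormal/(gauss_mx_lsub gZ').
  - exact/IH/(gauss_mx_rsub gZ').
  - apply: (indep_mx_comp (f := mulmx L) (g := mulmx L)); last exact: gauss_row_indep.
      exact: mxmeas_mulmx_uncvec.
    exact: mxmeas_mulmx_uncvec.
by apply: gauss_mx_eq => t; rewrite -mul_mx_row hsubmxK.
Qed.

Lemma gauss_mulr a b n (L : 'M[R]_(b, n)) (Z : T -> 'M[R]_(a, b)) :
  L^T *m L = 1%:M -> gauss_mx P Z -> gauss_mx P (fun t => Z t *m L).
Proof.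
move=> LL /gauss_mx_tr gZ.
have := @gauss_mull _ _ _ L^T _ _ gZ; rewrite trmxK => /(_ LL)/gauss_mx_tr.
by apply: gauss_mx_eq => t; rewrite trmx_mul !trmxK.
Qed.

End orthonormal_matrices.

(** * Orthogonal complements and Schur complements *)

Section orthogonal_complement.
Context {R : rcfType}.

(** Each step finds a nonzero vector orthogonal to the rows of B by counting dimensions, normalizes
    it, and adds it to the constraints B for the next one. *)
Lemma orthonormal_complement b a n (B : 'M[R]_(a, n)) : (a + b <= n)%N ->
  exists L : 'M[R]_(b, n), L *m L^T = 1%:M /\ B *m L^T = 0.
Proof.
elim: b a B => [|b IH] a B abn.
  exists 0; split; first by apply/matrixP => -[].
  by rewrite trmx0 mulmx0.
have ker0 : kermx B^T != 0.
  rewrite -mxrank_eq0 mxrank_ker subn_eq0 -ltnNge.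
  apply: leq_ltn_trans (rank_leq_col _) _.
  by rewrite (leq_trans _ abn)// addnS ltnS leq_addr.
pose v := nz_row (kermx B^T).
have vB : v *m B^T = 0 by apply/sub_kermxP; exact: nz_row_sub.
have v0 : v != 0 by rewrite nz_row_eq0.
have vv : 0 < (v *m v^T) ord0 ord0.
  rewrite lt_neqAle eq_sym mxE sumr_ge0 ?andbT; last first.
    by move=> i _; rewrite mxE -expr2 sqr_ge0.
  apply: contra v0; rewrite psumr_eq0 => [/allP h|i _]; last first.
    by rewrite mxE -expr2 sqr_ge0.
  apply/eqP/matrixP => i j; rewrite ord1 mxE; apply/eqP.
  by have := h j (mem_index_enum j); rewrite mxE mulf_eq0 orbb.
pose s := Num.sqrt ((v *m v^T) ord0 ord0).
have s0 : s != 0 by rewrite gt_eqF// sqrtr_gt0.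
pose l := s^-1 *: v.
have ll : l *m l^T = 1%:M.
  rewrite /l -scalemxAl [(_ *: v)^T]linearZ/= -scalemxAr scalerA.
  apply/matrixP => i j; rewrite !ord1 mxE -(sqr_sqrtr (ltW vv)) -/s.
  by rewrite -expr2 -exprMn mulVf// expr1n !mxE.
have lB : B *m l^T = 0.
  by rewrite -[B]trmxK -trmx_mul /l -scalemxAl vB scaler0 trmx0.
have [|L [LL BL]] := IH _ (col_mx B l); first by rewrite addn1 addSnnS.
move: BL; rewrite mul_col_mx => /eqP; rewrite col_mx_eq0 => /andP[/eqP BL /eqP lL].
have Ll : L *m l^T = 0 by rewrite -[LHS]trmxK trmx_mul trmxK lL trmx0.
have LL0 : col_mx l L *m (col_mx l L)^T = 1%:M.
  by rewrite tr_col_mx mul_col_row ll lL LL Ll -scalar_mx_block.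
have BL0 : B *m (col_mx l L)^T = 0.
  by rewrite tr_col_mx mul_mx_row BL lB row_mx0.
by exists (col_mx l L).
Qed.

(** The row of blocks [B^T (B B^T)^-1, L^T] is a right inverse of the square matrix made of B and L,
    hence also a left inverse. *)
Lemma projection_complement a b n (B : 'M[R]_(a, n)) (L : 'M[R]_(b, n)) :
  n = (a + b)%N -> B *m B^T \in unitmx -> L *m L^T = 1%:M -> B *m L^T = 0 ->
  B^T *m invmx (B *m B^T) *m B + L^T *m L = 1%:M.
Proof.
move=> nE; move: nE B L => -> B L BB LL BL.
have LB : L *m B^T = 0 by rewrite -[LHS]trmxK trmx_mul trmxK BL trmx0.
rewrite -mul_row_col; apply: mulmx1C; rewrite mul_col_row.
by rewrite !mulmxA mulmxV// LB mul0mx BL LL -scalar_mx_block.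
Qed.

Lemma gram_tr m n (Z : 'M[R]_(m, n)) : (Z *m Z^T)^T = Z *m Z^T.
Proof. by rewrite trmx_mul trmxK. Qed.

Lemma row_normsq_ge0 m n (Z : 'M[R]_(m, n)) i : 0 <= (Z *m Z^T) i i.
Proof.
by rewrite mxE sumr_ge0// => j _; rewrite mxE -expr2 sqr_ge0.
Qed.

Lemma mulmx_tr_eq0 m n (Z : 'M[R]_(m, n)) : Z *m Z^T = 0 -> Z = 0.
Proof.
move=> ZZ; apply/matrixP => i j; rewrite mxE; apply/eqP.
have /eqP := congr1 (fun M : 'M[R]_m => M i i) ZZ.
rewrite mxE [X in _ == X]mxE psumr_eq0 => [/allP h|k _]; last first.
  by rewrite mxE -expr2 sqr_ge0.
by have := h j (mem_index_enum j); rewrite mxE mulf_eq0 orbb.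
Qed.

Lemma unitmx_ker0 n (M : 'M[R]_n) :
  (forall v : 'rV[R]_n, v *m M = 0 -> v = 0) -> M \in unitmx.
Proof.
move=> h; rewrite -row_free_unit -kermx_eq0; apply/eqP/row_matrixP => i.
by rewrite row0; apply: h; rewrite -row_mul mulmx_ker row0.
Qed.

(* The Schur complement of Z2 Z2^T in Z Z^T is the squared distance
   |L z^T|^2 of the first row of Z to the row space of Z2; here [q] is that
   distance and [x] is the first column of (Z Z^T)^-1. *)
Lemma gram_inverse_col0 m k n (z : 'rV[R]_n) (Z2 : 'M[R]_(m, n))
    (L : 'M[R]_(k, n)) (Z := col_mx z Z2) (W2 := Z2 *m Z2^T)
    (w := invmx W2 *m Z2 *m z^T) (q := ((L *m z^T)^T *m (L *m z^T)) ord0 ord0) :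
  n = (m + k)%N -> W2 \in unitmx -> L *m L^T = 1%:M -> Z2 *m L^T = 0 -> q != 0 ->
  [/\ Z *m Z^T \in unitmx,
      invmx (Z *m Z^T) ord0 ord0 = q^-1 &
      (invmx (Z *m Z^T) *m invmx (Z *m Z^T)) ord0 ord0 =
        (1 + (w^T *m w) ord0 ord0) / q ^+ 2].
Proof.
move=> nE uW2 LL Z2L q0.
have proj := projection_complement nE uW2 LL Z2L.
have qE : (L *m z^T)^T *m (L *m z^T) = q%:M by rewrite -mx11_scalar.
have LZ2 : L *m Z2^T = 0 by rewrite -[LHS]trmxK trmx_mul trmxK Z2L trmx0.
(* Pythagoras for the first row: its part orthogonal to the rows of Z2 has squared length q, and the
   rest is the projection onto their span. *)
have zz : z *m z^T = q%:M + z *m Z2^T *m w.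
  transitivity (z *m (Z2^T *m invmx W2 *m Z2 + L^T *m L) *m z^T).
    by rewrite proj mulmx1.
  by rewrite mulmxDr mulmxDl addrC -qE trmx_mul trmxK /w !mulmxA.
have uW : Z *m Z^T \in unitmx.
  (* A relation v Z = 0 tested against L^T loses the rows of Z2, so q != 0 kills the first
     coefficient; invertibility of W2 then kills the others. *)
  apply: unitmx_ker0 => v vW.
  have vZ : v *m Z = 0.
    apply: mulmx_tr_eq0; rewrite trmx_mul mulmxA -(mulmxA v) vW mul0mx//.
  have vE : v = @row_mx R 1 1 m (lsubmx v) (rsubmx v) by rewrite hsubmxK.
  move: vZ; rewrite vE mul_row_col => vZ.
  have l0 : lsubmx v = 0.
    have : lsubmx v *m (z *m L^T) = 0.
      by rewrite mulmxA -[lsubmx v *m z](addrK (rsubmx v *m Z2)) vZ sub0r mulNmx -mulmxA Z2L mulmx0 oppr0.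
    move=> h; have : lsubmx v *m ((z *m L^T) *m (z *m L^T)^T) = 0.
      by rewrite mulmxA h mul0mx.
    rewrite (_ : _ *m _^T = q%:M); last by rewrite -qE !trmx_mul !trmxK.
    rewrite mul_mx_scalar => /eqP; rewrite scaler_eq0 (negbTE q0)/= => /eqP//.
  move: vZ; rewrite l0 mul0mx add0r => r0.
  have -> : rsubmx v = 0.
    have : rsubmx v *m Z2 *m Z2^T = 0 by rewrite r0 mul0mx.
    rewrite -mulmxA -/W2 => /(congr1 (mulmx^~ (invmx W2))).
    by rewrite mul0mx -mulmxA mulmxV// mulmx1.
  by rewrite row_mx0.
pose x : 'cV[R]_(1 + m) := q^-1 *: col_mx 1%:M (- w).
have Wx : (Z *m Z^T) *m x = delta_mx ord0 ord0.
  rewrite /x -scalemxAr /Z tr_col_mx mul_col_row mul_block_col !mulmx1 !mulmxN.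
  rewrite zz addrK /w !mulmxA mulmxV// mul1mx addrN.
  rewrite scale_col_mx scaler0 scale_scalar_mx mulVf//.
  have -> : 1%:M = delta_mx ord0 ord0 :> 'M[R]_1.
    by apply/matrixP => i j; rewrite !ord1 !mxE.
  apply/matrixP => i j; rewrite ord1 mxE; case: splitP => l il; rewrite !mxE.
    by rewrite !eqE /= il.
  by rewrite (_ : (i == ord0) = false)//; apply/eqP => i0; move: il; rewrite i0.
have xE : x = invmx (Z *m Z^T) *m delta_mx ord0 ord0 by rewrite -Wx mulKmx.
have invT : (invmx (Z *m Z^T))^T = invmx (Z *m Z^T) by rewrite trmx_inv gram_tr.
have colE0 (M : 'M[R]_(1 + m)) i : (M *m delta_mx ord0 ord0 : 'cV[R]_(1 + m)) i ord0 = M i ord0.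
  by rewrite -colE mxE.
split=> //.
  rewrite -colE0 -xE /x mxE (_ : col_mx _ _ _ _ = 1) ?mulr1// mxE.
  by case: splitP => // l _; rewrite [l]ord1 mxE.
have -> : (invmx (Z *m Z^T) *m invmx (Z *m Z^T)) ord0 ord0 = (x^T *m x) ord0 ord0.
  rewrite xE trmx_mul invT -mulmxA (mulmxA (invmx _)) trmx_delta.
  by rewrite mulmxA -colE -rowE !mxE.
rewrite /x -scalemxAr [(_ *: col_mx _ _)^T]linearZ/= -scalemxAl scalerA.
rewrite tr_col_mx mul_row_col.
rewrite trmx1 mul1mx [(- w)^T]linearN/= mulNmx mulmxN opprK.
rewrite mxE [X in _ * X]mxE [1%:M _ _]mxE mulr1n.
by rewrite mulrC expr2 invfM.
Qed.

End orthogonal_complement.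

Lemma measurable_ltr_set d (T : measurableType d) (R : realType) (f g : T -> R) :
  measurable_fun setT f -> measurable_fun setT g -> measurable [set t | f t < g t].
Proof.
move=> mf mg; have mtrue : measurable [set true] by [].
by have := measurable_fun_ltr mf mg measurableT mtrue; rewrite setTI.
Qed.

Lemma measurable_eqr_set d (T : measurableType d) (R : realType) (f g : T -> R) :
  measurable_fun setT f -> measurable_fun setT g -> measurable [set t | f t = g t].
Proof.
move=> mf mg; have mtrue : measurable [set true] by [].
have := measurable_fun_eqr mf mg measurableT mtrue; rewrite setTI.
rewrite (_ : _ @^-1` _ = [set t | f t = g t])//.
by apply/seteqP; split => t /eqP.
Qed.

Lemma expR_ge_quadratic (R : realType) (u : R) :
  0 <= u -> 1 + u + u ^+ 2 / 2 <= expR u.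
Proof.
move=> u0; have := @nondecreasing_cvgn_le R (series (exp_coeff u)) _
  (is_cvg_series_exp_coeff u) 3%N.
rewrite /series/= !big_nat_recr//= big_nil /exp_coeff/= add0r expr0 expr1 !divr1.
apply=> m n mn; rewrite /series/= [leRHS](@big_cat_nat _ _ _ m)//= lerDl.
by rewrite sumr_ge0// => i _; rewrite divr_ge0// exprn_ge0.
Qed.

(** The product (1 - u + u^2/2) (1 + u + u^2/2) equals 1 + u^4/4, so the lower bound for exp u
    inverts into this upper bound. *)
Lemma expRN_le_quadratic (R : realType) (u : R) :
  0 <= u -> expR (- u) <= 1 - u + u ^+ 2 / 2.
Proof.
move=> u0; have h := expR_ge_quadratic u0.
have h1 : 0 < 1 + u + u ^+ 2 / 2 by nra.
rewrite expRN -[leRHS](mulfK (lt0r_neq0 h1)) -[leLHS]mul1r ler_pM//.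
- have -> : (1 - u + u ^+ 2 / 2) * (1 + u + u ^+ 2 / 2) = 1 + u ^+ 4 / 4 by field.
  by rewrite lerDl divr_ge0// exprn_ge0.
- by rewrite lef_pV2// posrE expR_gt0.
Qed.

(** * Moments of Gaussian forms *)

Section expectations.
Context {d} {T : measurableType d} {R : realType}.
Variable P : probability T R.
Implicit Types f g : T -> R.

Lemma exp_le f g : measurable_fun setT f -> measurable_fun setT g ->
  (forall x, 0 <= f x) -> (forall x, f x <= g x) ->
  (\int[P]_x (f x)%:E <= \int[P]_x (g x)%:E)%E.
Proof.
move=> mf mg f0 fg; apply: ge0_le_integral.
- exact: measurableT.
- by move=> x _; rewrite lee_fin.
- exact/measurable_EFinP.
- exact/measurable_EFinP.
- by move=> x _; rewrite lee_fin.
Qed.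

Lemma expD f g : measurable_fun setT f -> measurable_fun setT g ->
  (forall x, 0 <= f x) -> (forall x, 0 <= g x) ->
  (\int[P]_x (f x + g x)%:E = \int[P]_x (f x)%:E + \int[P]_x (g x)%:E)%E.
Proof.
move=> mf mg f0 g0; under eq_integral do rewrite EFinD.
apply: ge0_integralD.
- exact: measurableT.
- by move=> x _; rewrite lee_fin.
- exact/measurable_EFinP.
- by move=> x _; rewrite lee_fin.
- exact/measurable_EFinP.
Qed.

Lemma expZ c f : measurable_fun setT f -> (forall x, 0 <= f x) -> 0 <= c ->
  (\int[P]_x (c * f x)%:E = c%:E * \int[P]_x (f x)%:E)%E.
Proof.
move=> mf f0 c0; under eq_integral do rewrite EFinM.
apply: ge0_integralZl.
- exact: measurableT.
- exact/measurable_EFinP.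
- by move=> x _; rewrite lee_fin.
- by rewrite lee_fin.
Qed.

Lemma exp_cst c : (\int[P]_x c%:E = c%:E)%E.
Proof.
rewrite (integral_cst P measurableT c%:E).
by have := probability_setT P => /= ->; rewrite mule1.
Qed.

Lemma exp_sum (I : Type) (s : seq I) (F : I -> T -> R) :
  (forall i, measurable_fun setT (F i)) -> (forall i x, 0 <= F i x) ->
  (\int[P]_x (\sum_(i <- s) F i x)%:E = \sum_(i <- s) \int[P]_x (F i x)%:E)%E.
Proof.
move=> mF F0; under eq_integral do rewrite -sumEFin.
apply: ge0_integral_sum.
- exact: measurableT.
- by move=> i; exact/measurable_EFinP.
- by move=> i x _; rewrite lee_fin.
Qed.

Lemma exp_markov c f : 0 < c -> measurable_fun setT f -> (forall x, 0 <= f x) ->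
  (P [set x | (c < f x)%R] <= c^-1%:E * \int[P]_x (f x)%:E)%E.
Proof.
move=> c0 mf f0; pose A := [set x | c < f x].
have mA : measurable A.
  exact: measurable_ltr_set.
have := @integral_indic _ T R P setT measurableT A mA; rewrite setIT => <-.
rewrite -expZ//; last by rewrite invr_ge0 ltW.
apply: exp_le => [|||x].
- exact: measurable_indic.
- exact: measurable_funM.
- by [].
- rewrite indicE; have [/set_mem/= cf|_] := boolP (x \in A).
    by rewrite ler_pdivlMl// mulr1 ltW.
  by rewrite mulr_ge0// invr_ge0 ltW.
Qed.

End expectations.

(** * Second and fourth moments of the standard normal law *)

Section normal_moments.
Context {R : realType}.
Local Notation gam := (normal_prob (0 : R) 1).

(** The tilted density is s times the density of N(0, s^2) with s^2 = 1 / (1 - 2 t). *)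
Lemma normal_mgf_sqr (t : R) : t < 2^-1 ->
  (\int[gam]_x (expR (t * x ^+ 2))%:E = ((Num.sqrt (1 - 2 * t))^-1)%:E)%E.
Proof.
move=> t2; have t0 : 0 < 1 - 2 * t by lra.
pose s := (Num.sqrt (1 - 2 * t))^-1.
have s0 : 0 < s by rewrite invr_gt0 sqrtr_gt0.
have s2 : s ^+ 2 = (1 - 2 * t)^-1 by rewrite exprVn sqr_sqrtr ?ltW.
have me : measurable_fun [set: R] (fun x => expR (t * x ^+ 2)).
  apply: measurableT_comp => //; apply: measurable_funM => //.
rewrite ge0_integral_normal; last 2 first.
- exact/measurable_EFinP.
- by move=> x; rewrite lee_fin expR_ge0.
transitivity (\int[lebesgue_measure]_x (s%:E * (normal_pdf 0 s x)%:E))%E.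
  apply: eq_integral => x _; rewrite -!EFinM; congr EFin.
  rewrite normal_pdf01 normal_pdfE ?gt_eqF// /normal_fun subr0 s2.
  have -> : normal_peak s = normal_peak 1 / s.
    rewrite /normal_peak -!mulrnAr sqrtrM ?sqr_ge0// sqrtr_sqr gtr0_norm//.
    by rewrite invfM mulrC expr1n mul1r.
  rewrite mulrCA -expRD [s * _]mulrA [s * _]mulrC divfK ?gt_eqF//.
  congr (_ * expR _); rewrite -mulr_natr; field.
  by rewrite gt_eqF.
rewrite ge0_integralZl.
- by rewrite integral_normal_pdf mule1.
- exact: measurableT.
- by apply/measurable_EFinP; exact: measurable_normal_pdf.
- by move=> x _; rewrite lee_fin normal_pdf_ge0.
- by rewrite lee_fin ltW.
Qed.

Lemma invsqrt_le (s u : R) : 0 < s -> 0 < u -> 1 <= u ^+ 2 * s ->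
  (Num.sqrt s)^-1 <= u.
Proof.
move=> s0 u0 h; have r0 : 0 < Num.sqrt s by rewrite sqrtr_gt0.
rewrite -[leLHS]mul1r ler_pdivrMr//.
have -> : u * Num.sqrt s = Num.sqrt (u ^+ 2 * s).
  by rewrite sqrtrM ?sqr_ge0// sqrtr_sqr gtr0_norm.
by rewrite -[leLHS]sqrtr1 ler_wsqrtr.
Qed.

Lemma invsqrt_ge (s u : R) : 0 < s -> 0 < u -> u ^+ 2 * s <= 1 ->
  u <= (Num.sqrt s)^-1.
Proof.
move=> s0 u0 h; have r0 : 0 < Num.sqrt s by rewrite sqrtr_gt0.
rewrite -[leRHS]mul1r ler_pdivlMr//.
have -> : u * Num.sqrt s = Num.sqrt (u ^+ 2 * s).
  by rewrite sqrtrM ?sqr_ge0// sqrtr_sqr gtr0_norm.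
by rewrite -[leRHS]sqrtr1 ler_wsqrtr.
Qed.

(* Taylor bounds for (1 - 2t)^(-1/2), the moment generating function of x^2. *)
Lemma invsqrt_taylor (t : R) : 0 < t -> t <= 8^-1 ->
  [/\ (Num.sqrt (1 - 2 * t))^-1 <= 1 + t + 3 / 2 * t ^+ 2 + 4 * t ^+ 3,
      (Num.sqrt (1 - 2 * - t))^-1 <= 1 - t + 3 / 2 * t ^+ 2 &
      1 - t + 3 / 2 * t ^+ 2 - 5 / 2 * t ^+ 3 <= (Num.sqrt (1 - 2 * - t))^-1].
Proof.
move=> t0 t8; have t2 : 0 < t ^+ 2 by rewrite exprn_gt0.
have t3 : 0 < t ^+ 3 by rewrite exprn_gt0.
have t4 : 0 < t ^+ 4 by rewrite exprn_gt0.
have t32 : t ^+ 3 <= t ^+ 2 by rewrite (exprS _ 2); apply: ler_piMl; lra.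
(* After squaring, each bound is a polynomial inequality in t; since every further power loses a
   factor 8, its lowest nonconstant term decides the sign. *)
have tS k : t ^+ k.+1 <= t ^+ k / 8.
  by rewrite exprS mulrC; apply: ler_wpM2l => //; exact/exprn_ge0/ltW.
have t5 : 0 < t ^+ 5 by rewrite exprn_gt0.
have t6 : 0 < t ^+ 6 by rewrite exprn_gt0.
have t7 : 0 < t ^+ 7 by rewrite exprn_gt0.
have := tS 3%N; have := tS 4%N; have := tS 5%N; have := tS 6%N => h6 h5 h4 h3.
split.
- apply: invsqrt_le; [lra|lra|].
  rewrite (_ : _ * _ = 1 + 3 * t ^+ 3 - 47 / 4 * t ^+ 4 - 17 / 2 * t ^+ 5
     - 8 * t ^+ 6 - 32 * t ^+ 7); first lra.
  by field.
- apply: invsqrt_le; [lra|lra|].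
  rewrite (_ : _ * _ = 1 + 5 * t ^+ 3 - 15 / 4 * t ^+ 4 + 9 / 2 * t ^+ 5); first lra.
  by field.
- apply: invsqrt_ge; [lra|have := tS 1%N; rewrite expr1; lra|].
  rewrite (_ : _ * _ = 1 - 35 / 4 * t ^+ 4 + 7 * t ^+ 5 - 35 / 4 * t ^+ 6
     + 25 / 2 * t ^+ 7); first lra.
  by field.
Qed.

Let T0 := measurableTypeR R.

Let mexp t : measurable_fun [set: T0] (fun x => expR (t * x ^+ 2)).
Proof. by apply: measurableT_comp => //; exact: measurable_funM. Qed.

Let m1 : measurable_fun [set: T0] (fun=> 1 : R).
Proof. exact: measurable_cst. Qed.

Let mtx t n : measurable_fun [set: T0] (fun x => t * x ^+ n).
Proof. exact: measurable_funM. Qed.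

Let ex0 t (x : R) : 0 <= expR (t * x ^+ 2).
Proof. exact: expR_ge0. Qed.

Let tx0 t (x : R) : 0 <= t -> 0 <= t * x ^+ 2.
Proof. by move=> t0; rewrite mulr_ge0 ?sqr_ge0. Qed.

(** The constant 8 is what the cubic remainder 4 t^3 of [invsqrt_taylor] becomes after division by
    t^2 / 2 in the fourth moment. *)
Let small_eq (a b : R) :
  (forall t, 0 < t -> t <= 8^-1 -> `|a - b| <= 8 * t) -> a = b.
Proof.
move=> h; apply/eqP; rewrite -subr_eq0 -normr_le0; apply/ler_addgt0Pl => e e0.
rewrite addr0; have [e1|e1] := leP (e / 8) 8^-1.
  by have := h (e / 8) _ e1; rewrite divr_gt0// mulrC divfK// => /(_ isT).
by have := h 8^-1 _ (lexx _); rewrite invr_gt0 ltr0n => /(_ isT) h1; lra.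
Qed.

(** The moment is squeezed out of the moment generating function of x^2: integrate 1 + t x^2 <= exp
    (t x^2) and 1 - t x^2 <= exp (- t x^2), divide by t and let t tend to 0. *)
Lemma normal_moment2 : (\int[gam]_x (x ^+ 2)%:E = 1%:E :> \bar R)%E.
Proof.
pose G : probability (measurableTypeR R) R := gam.
have t8 : (8^-1 : R) < 2^-1 by lra.
set m := (LHS).
have m0 : (0 <= m)%E by apply: integral_ge0 => x _; rewrite lee_fin sqr_ge0.
have lo t : 0 < t -> t <= 8^-1 ->
    (1%:E + t%:E * m <= ((Num.sqrt (1 - 2 * t))^-1)%:E)%E.
  move=> t0 tle; rewrite -normal_mgf_sqr; last lra.
  rewrite -(exp_cst G) -(@expZ _ _ _ G t) ?(ltW t0)//; last by move=> x; exact: sqr_ge0.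
  rewrite -(expD G m1 (mtx t 2) (fun=> ler01) (fun x => tx0 x (ltW t0))).
  apply: (exp_le G (measurable_funD m1 (mtx t 2)) (mexp t)) => x.
  - by rewrite addr_ge0// tx0// ltW.
  - exact: expR_ge1Dx.
have up t : 0 < t -> t <= 8^-1 ->
    (1%:E <= ((Num.sqrt (1 - 2 * - t))^-1)%:E + t%:E * m)%E.
  move=> t0 tle; rewrite -normal_mgf_sqr; last lra.
  rewrite -(@expZ _ _ _ G t) ?(ltW t0)//; last by move=> x; exact: sqr_ge0.
  rewrite -(expD G (mexp (- t)) (mtx t 2) (ex0 (- t)) (fun x => tx0 x (ltW t0))).
  rewrite -(exp_cst G).
  apply: (exp_le G m1 (measurable_funD (mexp (- t)) (mtx t 2))) => x //.
  - by have := expR_ge1Dx (- t * x ^+ 2); rewrite /=; lra.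
(* An infinite moment would contradict the bound [lo] at t = 1/8. *)
have mfin : m \is a fin_num.
  rewrite ge0_fin_numE//; have := lo 8^-1 _ (lexx _).
  rewrite invr_gt0 ltr0n => /(_ isT); case: m m0 {lo up} => [r|_|]//=; first by rewrite ltry.
  by rewrite mulry gtr0_sg ?invr_gt0// mul1e addey.
rewrite -(fineK mfin); congr EFin; apply: small_eq => t t0 tle.
have [h1 h2 h3] := invsqrt_taylor t0 tle.
have := lo t t0 tle; have := up t t0 tle; rewrite -(fineK mfin) -EFinM -!EFinD !lee_fin.
move=> hu hl; have t20 : 0 < t ^+ 2 by rewrite exprn_gt0.
have t3 : t ^+ 3 <= t ^+ 2 / 8 by rewrite exprS mulrC ler_wpM2l// ltW.
have tle1 : t * `|fine m - 1| <= t * (8 * t).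
  by rewrite -[X in X * _](gtr0_norm t0) -normrM ler_norml; apply/andP; split; lra.
by rewrite -(ler_pM2l t0).
Qed.

(** The same squeeze one order higher, with the quadratic bounds on exp u and exp (- u), and
    division by t^2 / 2. The limit 3 is twice the Taylor coefficient 3/2. *)
Lemma normal_moment4 : (\int[gam]_x (x ^+ 4)%:E = 3%:E :> \bar R)%E.
Proof.
pose G : probability (measurableTypeR R) R := gam.
have x40 (x : R) : 0 <= x ^+ 4 by rewrite exprn_even_ge0.
set m := (LHS).
have m0 : (0 <= m)%E by apply: integral_ge0 => x _; rewrite lee_fin.
have c2 (t : R) : 0 < t -> 0 <= t ^+ 2 / 2 by move=> _; rewrite divr_ge0 ?sqr_ge0 ?ler0n.
have lo t : 0 < t -> t <= 8^-1 ->
    (1%:E + t%:E + (t ^+ 2 / 2)%:E * m <= ((Num.sqrt (1 - 2 * t))^-1)%:E)%E.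
  move=> t0 tle; rewrite -normal_mgf_sqr; last lra.
  have -> : (1%:E + t%:E = \int[G]_x (1 + t * x ^+ 2)%:E)%E.
    rewrite (expD G m1 (mtx t 2) (fun=> ler01) (fun x => tx0 x (ltW t0))).
    by rewrite (exp_cst G) (expZ G _ _ (ltW t0))// ?normal_moment2 ?mule1// => x; exact: sqr_ge0.
  rewrite -(@expZ _ _ _ G (t ^+ 2 / 2)) ?c2//.
  have m1t := measurable_funD m1 (mtx t 2).
  have p1t (x : R) : 0 <= 1 + t * x ^+ 2 by rewrite addr_ge0// tx0// ltW.
  have p4 (x : R) : 0 <= t ^+ 2 / 2 * x ^+ 4 by rewrite mulr_ge0// c2.
  rewrite -(expD G m1t (mtx _ 4) p1t p4).
  apply: (exp_le G (measurable_funD m1t (mtx _ 4)) (mexp t)) => x.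
  - exact: addr_ge0 (p1t x) (p4 x).
  - apply: le_trans (expR_ge_quadratic _); last by rewrite mulr_ge0 ?sqr_ge0// ltW.
    by rewrite /= le_eqVlt; apply/orP; left; apply/eqP; field.
have up t : 0 < t -> t <= 8^-1 ->
    (((Num.sqrt (1 - 2 * - t))^-1)%:E + t%:E <= 1%:E + (t ^+ 2 / 2)%:E * m)%E.
  move=> t0 tle; rewrite -normal_mgf_sqr; last lra.
  have -> : (t%:E = \int[G]_x (t * x ^+ 2)%:E)%E.
    by rewrite (expZ G _ _ (ltW t0))// ?normal_moment2 ?mule1// => x; exact: sqr_ge0.
  rewrite -(expD G (mexp (- t)) (mtx t 2) (ex0 (- t)) (fun x => tx0 x (ltW t0))).
  rewrite -(@expZ _ _ _ G (t ^+ 2 / 2)) ?c2// -[1%:E](exp_cst G).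
  have p4 (x : R) : 0 <= t ^+ 2 / 2 * x ^+ 4 by rewrite mulr_ge0// c2.
  rewrite -(expD G m1 (mtx _ 4) (fun=> ler01) p4).
  apply: (exp_le G (measurable_funD (mexp (- t)) (mtx t 2))
    (measurable_funD m1 (mtx _ 4))) => x.
  - exact: addr_ge0 (ex0 _ x) (tx0 x (ltW t0)).
  - have txp : 0 <= t * x ^+ 2 by rewrite mulr_ge0 ?sqr_ge0// ltW.
    rewrite /= mulNr.
    have := expRN_le_quadratic txp; rewrite exprMn -exprM; lra.
have mfin : m \is a fin_num.
  rewrite ge0_fin_numE//; have := lo 8^-1 _ (lexx _).
  rewrite invr_gt0 ltr0n => /(_ isT); case: m m0 {lo up} => [r|_|]//=; first by rewrite ltry.
  by rewrite mulry gtr0_sg ?divr_gt0 ?exprn_gt0 ?invr_gt0// mul1e addey.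
rewrite -(fineK mfin); congr EFin; apply: small_eq => t t0 tle.
have [h1 h2 h3] := invsqrt_taylor t0 tle.
have := lo t t0 tle; have := up t t0 tle; rewrite -(fineK mfin) -EFinM -!EFinD !lee_fin.
move=> hu hl; have t20 : 0 < t ^+ 2 / 2 by rewrite divr_gt0// exprn_gt0.
have tle1 : t ^+ 2 / 2 * `|fine m - 3| <= t ^+ 2 / 2 * (8 * t).
  rewrite -[X in X * _](gtr0_norm t20) -normrM ler_norml.
  have -> : t ^+ 2 / 2 * (8 * t) = 4 * t ^+ 3 by field.
  by apply/andP; split; lra.
by rewrite -(ler_pM2l t20).
Qed.

End normal_moments.

Definition normsq (R : realType) n (v : 'cV[R]_n) : R := (v^T *m v) ord0 ord0.

Section normsq_theory.
Context {R : realType}.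

Lemma normsqE n (v : 'cV[R]_n) : normsq v = \sum_(i < n) v i ord0 ^+ 2.
Proof. by rewrite /normsq mxE; apply: eq_bigr => i _; rewrite mxE expr2. Qed.

Lemma normsq_nneg n (v : 'cV[R]_n) : 0 <= normsq v.
Proof. exact: normsq_ge0. Qed.

Lemma normsq_col_mx m n (u : 'cV[R]_m) (v : 'cV[R]_n) :
  normsq (col_mx u v) = normsq u + normsq v.
Proof. by rewrite /normsq tr_col_mx mul_row_col mxE. Qed.

Lemma normsqZ n c (v : 'cV[R]_n) : normsq (c *: v) = c ^+ 2 * normsq v.
Proof.
by rewrite !normsqE mulr_sumr; apply: eq_bigr => i _; rewrite mxE exprMn.
Qed.

Lemma measurable_normsq d (T : measurableType d) n (v : T -> 'cV[R]_n) :
  mxmeas v -> measurable_fun setT (fun t => normsq (v t)).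
Proof. by move=> mv; apply: mxmeas_mul => //; exact: mxmeas_tr. Qed.

Lemma gram_sum m n (M : 'M[R]_(m, n)) (v : 'cV[R]_n) :
  normsq (M *m v) = \sum_(i < m) (row i M *m v) ord0 ord0 ^+ 2.
Proof.
by rewrite normsqE; apply: eq_bigr => i _; rewrite -row_mul [row _ _ _ _]mxE.
Qed.

Lemma gramE m n (M : 'M[R]_(m, n)) i j :
  (M *m M^T) i j = (row i M *m (row j M)^T) ord0 ord0.
Proof. by rewrite !mxE; apply: eq_bigr => k _; rewrite !mxE. Qed.

Lemma gram_CS m n (M : 'M[R]_(m, n)) i j :
  (M *m M^T) i j ^+ 2 <= (M *m M^T) i i * (M *m M^T) j j.
Proof.
pose s := \sum_k M i k * M j k; pose a := \sum_k M i k ^+ 2.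
pose b := \sum_k M j k ^+ 2.
have e1 : (M *m M^T) i j = s by rewrite mxE; apply: eq_bigr => k _; rewrite mxE.
have e2 l : (M *m M^T) l l = \sum_k M l k ^+ 2.
  by rewrite mxE; apply: eq_bigr => k _; rewrite mxE expr2.
rewrite e1 !e2 -/a -/b.
have b0 : 0 <= b by rewrite sumr_ge0// => k _; rewrite sqr_ge0.
have : 0 <= \sum_k (b * M i k - s * M j k) ^+ 2.
  by rewrite sumr_ge0// => k _; exact: sqr_ge0.
rewrite (eq_bigr (fun k => b ^+ 2 * M i k ^+ 2 - 2 * b * s * (M i k * M j k)
   + s ^+ 2 * M j k ^+ 2)); last by move=> k _; ring.
rewrite !big_split/= sumrN -!mulr_sumr -/a -/b -/s => h.
have [b0'|b_gt0] := leP b 0; last first.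
  by rewrite -(ler_pM2l b_gt0); nra.
have bE : b = 0 by apply/eqP; rewrite eq_le b0' b0.
have Mj0 k : M j k = 0.
  apply/eqP; rewrite -sqrf_eq0; move/eqP: bE.
  rewrite psumr_eq0 => [/allP/(_ k (mem_index_enum k))//|l _].
  exact: sqr_ge0.
by rewrite /s big1 => [|k _]; rewrite ?Mj0 ?mulr0// expr0n bE mulr0.
Qed.

End normsq_theory.

(** * Moments of linear and quadratic forms in a Gaussian vector *)

Section gaussian_forms.
Context {d} {T : measurableType d} {R : realType}.
Variable P : probability T R.
Local Notation gam := (normal_prob (0 : R) 1).

Lemma exp_gauss11 (x : T -> 'M[R]_1) (f : R -> R) : gauss_mx P x ->
  measurable_fun setT f -> (forall y, 0 <= f y) ->
  (\int[P]_t (f (x t ord0 ord0))%:E = \int[gam]_y (f y)%:E)%E.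
Proof.
move=> /gauss_mx11[mx Px] mf f0.
have mx' : @measurable_fun _ _ T (measurableTypeR R) setT
  (fun t => x t ord0 ord0) by exact: mx.
have mf' : measurable_fun [set: measurableTypeR R] (EFin \o f).
  exact/measurable_EFinP.
rewrite (eq_measure_integral (law P mx')); last first.
  by move=> A mA _; exact/esym/Px.
have := @ge0_integral_pushforward _ _ T (measurableTypeR R) R
  (fun t => x t ord0 ord0) mx' P setT (EFin \o f) measurableT mf'.
rewrite preimage_setT => <-//.
by move=> y _; rewrite lee_fin.
Qed.

(** A normalized u is a one-row orthonormal matrix, so the form is |u| times a single standard
    normal variable. *)
Lemma exp_linear_form K (z : T -> 'cV[R]_K) (u : 'rV[R]_K) : gauss_mx P z ->
  (\int[P]_t ((u *m z t) ord0 ord0 ^+ 2)%:E = ((u *m u^T) ord0 ord0)%:E /\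
   \int[P]_t ((u *m z t) ord0 ord0 ^+ 4)%:E =
     (3 * (u *m u^T) ord0 ord0 ^+ 2)%:E)%E.
Proof.
move=> gz; have [u0|u0] := eqVneq ((u *m u^T) ord0 ord0) 0.
  have -> : u = 0 by apply: mulmx_tr_eq0; rewrite [LHS]mx11_scalar u0 raddf0.
  split; under eq_integral do rewrite mul0mx mxE expr0n.
    by rewrite exp_cst mul0mx mxE.
  by rewrite exp_cst mul0mx mxE expr0n mulr0.
have uu : 0 < (u *m u^T) ord0 ord0.
  by rewrite lt_neqAle eq_sym u0 row_normsq_ge0.
pose s := Num.sqrt ((u *m u^T) ord0 ord0).
have s0 : s != 0 by rewrite gt_eqF// sqrtr_gt0.
have s2 : s ^+ 2 = (u *m u^T) ord0 ord0 by rewrite sqr_sqrtr// ltW.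
have gl : gauss_mx P (fun t => (s^-1 *: u) *m z t).
  apply: gauss_mull gz; rewrite -scalemxAl [(_ *: u)^T]linearZ/= -scalemxAr scalerA.
  apply/matrixP => i j; rewrite !ord1 mxE -s2.
  by rewrite -expr2 -exprMn mulVf// expr1n !mxE.
have uE t : (u *m z t) ord0 ord0 = s * ((s^-1 *: u) *m z t) ord0 ord0.
  by rewrite -scalemxAl [X in _ = _ * X]mxE mulrA divff// mul1r.
have mp n c : measurable_fun setT (fun y : R => c * y ^+ n).
  exact: measurable_funM.
split; under eq_integral do rewrite uE exprMn.
  rewrite (exp_gauss11 (f := fun y => s ^+ 2 * y ^+ 2) gl) ?mp//; last first.
    by move=> y; rewrite mulr_ge0 ?sqr_ge0.
  pose G : probability (measurableTypeR R) R := gam.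
  rewrite (@expZ _ _ _ G)//; [|by move=> y; rewrite sqr_ge0|by rewrite sqr_ge0].
  by rewrite normal_moment2 mule1 s2.
rewrite (exp_gauss11 (f := fun y => s ^+ 4 * y ^+ 4) gl) ?mp//; last first.
  by move=> y; rewrite mulr_ge0 ?exprn_even_ge0.
pose G : probability (measurableTypeR R) R := gam.
rewrite (@expZ _ _ _ G)//; [|by move=> y; rewrite exprn_even_ge0|by rewrite exprn_even_ge0].
by rewrite normal_moment4 -EFinM (exprM s 2 2) s2 mulrC.
Qed.

Lemma ereal_addr_inj (X : \bar R) (a b : R) :
  (X + a%:E = b%:E)%E -> X = (b - a)%:E.
Proof.
case: X => [r||]// /eqP; rewrite -EFinD eqe => /eqP <-.
by rewrite addrK.
Qed.

(** Isserlis' formula by polarization: 12 a^2 b^2 + 2 (a^4 + b^4) = (a + b)^4 + (a - b)^4 reduces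
    the mixed moment to fourth moments of single linear forms. The identity is arranged with
    nonnegative terms on both sides, so that the integrals add in the extended reals. *)
Lemma exp_linear_form_pair K (z : T -> 'cV[R]_K) (u v : 'rV[R]_K) :
  gauss_mx P z ->
  (\int[P]_t ((u *m z t) ord0 ord0 ^+ 2 * (v *m z t) ord0 ord0 ^+ 2)%:E =
   ((u *m u^T) ord0 ord0 * (v *m v^T) ord0 ord0 +
    2 * (u *m v^T) ord0 ord0 ^+ 2)%:E)%E.
Proof.
move=> gz; have [mz _] := gz.
pose a t := (u *m z t) ord0 ord0; pose b t := (v *m z t) ord0 ord0.
have ml (w : 'rV[R]_K) : measurable_fun setT (fun t => (w *m z t) ord0 ord0).
  by apply: mxmeas_mul => //; exact: mxmeas_cst.
have ma : measurable_fun setT a by exact: ml.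
have mb : measurable_fun setT b by exact: ml.
have mp (f : T -> R) n : measurable_fun setT f -> measurable_fun setT (fun t => f t ^+ n).
  by move=> mf; exact: measurable_funX.
have p40 (x : R) : 0 <= x ^+ 4 by rewrite exprn_even_ge0.
have [_ Ea] := exp_linear_form u gz; have [_ Eb] := exp_linear_form v gz.
have [_ Ep] := exp_linear_form (u + v) gz; have [_ Em] := exp_linear_form (u - v) gz.
set s := (u *m u^T) ord0 ord0; set r := (v *m v^T) ord0 ord0.
set c := (u *m v^T) ord0 ord0.
have cT : (v *m u^T) ord0 ord0 = c.
  by rewrite /c -[v *m u^T]trmxK mxE trmx_mul trmxK.
have EX : (\int[P]_t (12 * (a t ^+ 2 * b t ^+ 2) + 2 * (a t ^+ 4 + b t ^+ 4))%:E =
   \int[P]_t ((a t + b t) ^+ 4 + (a t - b t) ^+ 4)%:E)%E.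
  by apply: eq_integral => t _; congr EFin; ring.
have mab : measurable_fun setT (fun t => a t ^+ 2 * b t ^+ 2).
  by apply: measurable_funM; exact: mp.
have ab0 t : 0 <= a t ^+ 2 * b t ^+ 2 by rewrite mulr_ge0 ?sqr_ge0.
have ma4b4 : measurable_fun setT (fun t => a t ^+ 4 + b t ^+ 4).
  by apply: measurable_funD; exact: mp.
have a4b40 t : 0 <= a t ^+ 4 + b t ^+ 4 by rewrite addr_ge0.
move: EX; rewrite (expD P (f := fun t => 12 * (a t ^+ 2 * b t ^+ 2))
    (g := fun t => 2 * (a t ^+ 4 + b t ^+ 4))); last 4 first.
- exact: measurable_funM.
- exact: measurable_funM.
- by move=> t; rewrite mulr_ge0.
- by move=> t; rewrite mulr_ge0.
rewrite (expZ P mab ab0)// (expZ P ma4b4 a4b40)//.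
rewrite (expD P (mp a 4 ma) (mp b 4 mb) (fun t => p40 _) (fun t => p40 _)).
rewrite (expD P (f := fun t => (a t + b t) ^+ 4) (g := fun t => (a t - b t) ^+ 4))//; last 2 first.
- by apply: mp; exact: measurable_funD.
- by apply: mp; exact: measurable_funB.
rewrite Ea Eb -/s -/r.
have -> : (\int[P]_x ((a x + b x) ^+ 4)%:E = (3 * (s + r + 2 * c) ^+ 2)%:E)%E.
  rewrite (_ : s + r + 2 * c = ((u + v) *m (u + v)^T) ord0 ord0).
    by rewrite -Ep; apply: eq_integral => t _; congr (_ ^+ 4)%:E; rewrite mulmxDl [RHS]mxE.
  rewrite linearD/= mulmxDl !mulmxDr !mxE.
  by move: cT; rewrite /s /r /c !mxE => ->; ring.
have -> : (\int[P]_x ((a x - b x) ^+ 4)%:E = (3 * (s + r - 2 * c) ^+ 2)%:E)%E.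
  rewrite (_ : s + r - 2 * c = ((u - v) *m (u - v)^T) ord0 ord0).
    rewrite -Em; apply: eq_integral => t _; congr (_ ^+ 4)%:E.
    by rewrite mulmxBl [RHS]mxE [X in _ = _ + X]mxE.
  rewrite linearB/= mulmxBl !mulmxBr !mxE.
  by move: cT; rewrite /s /r /c !mxE => ->; ring.
rewrite -!EFinD -EFinM => /ereal_addr_inj h.
have : (12^-1%:E * (12%:E * \int[P]_x (a x ^+ 2 * b x ^+ 2)%:E) =
   12^-1%:E * (3 * (s + r + 2 * c) ^+ 2 + 3 * (s + r - 2 * c) ^+ 2 -
        2 * (3 * s ^+ 2 + 3 * r ^+ 2))%:E)%E by rewrite h.
rewrite muleA -EFinM mulVf ?pnatr_eq0// mul1e => ->.
by rewrite -EFinM; congr EFin; field.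
Qed.

End gaussian_forms.

Section quadratic_forms.
Context {d} {T : measurableType d} {R : realType}.
Variable P : probability T R.

(** The squared Frobenius norm of M M^T; twice this number is the variance of |M z|^2. *)
Definition frob2 m n (M : 'M[R]_(m, n)) : R :=
  \sum_(i < m) \sum_(j < m) (M *m M^T) i j ^+ 2.

Lemma frob2_le m n (M : 'M[R]_(m, n)) : frob2 M <= \tr (M *m M^T) ^+ 2.
Proof.
rewrite /frob2 /mxtrace expr2 mulr_suml; apply: ler_sum => i _.
by rewrite mulr_sumr; apply: ler_sum => j _; exact: gram_CS.
Qed.

Lemma tr_gram_ge0 m n (M : 'M[R]_(m, n)) : 0 <= \tr (M *m M^T).
Proof. by apply: sumr_ge0 => i _; exact: row_normsq_ge0. Qed.

Lemma quad_moments K m (z : T -> 'cV[R]_K) (M : 'M[R]_(m, K)) :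
  gauss_mx P z ->
  (\int[P]_t (normsq (M *m z t))%:E = (\tr (M *m M^T))%:E /\
   \int[P]_t (normsq (M *m z t) ^+ 2)%:E =
     (\tr (M *m M^T) ^+ 2 + 2 * frob2 M)%:E)%E.
Proof.
move=> gz; have [mz _] := gz.
pose a i t := (row i M *m z t) ord0 ord0.
have ma i : measurable_fun setT (a i).
  by apply: mxmeas_mul => //; exact: mxmeas_cst.
have mp (f : T -> R) n : measurable_fun setT f -> measurable_fun setT (fun t => f t ^+ n).
  by move=> mf; exact: measurable_funX.
have nE t : normsq (M *m z t) = \sum_(i < m) a i t ^+ 2 by rewrite gram_sum.
split.
  under eq_integral do rewrite nE.
  rewrite (@exp_sum _ _ _ P _ _ (fun i t => a i t ^+ 2)).
  - rewrite /mxtrace -sumEFin; apply: eq_bigr => i _.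
    by rewrite gramE; exact: (exp_linear_form (row i M) gz).1.
  - by move=> i; exact: mp.
  - by move=> i t; exact: sqr_ge0.
have nE2 t : normsq (M *m z t) ^+ 2 =
    \sum_(i < m) \sum_(j < m) a i t ^+ 2 * a j t ^+ 2.
  rewrite nE expr2 mulr_suml; apply: eq_bigr => i _.
  by rewrite mulr_sumr.
have maa i j : measurable_fun setT (fun t => a i t ^+ 2 * a j t ^+ 2).
  by apply: measurable_funM; exact: mp.
have aa0 i j t : 0 <= a i t ^+ 2 * a j t ^+ 2 by rewrite mulr_ge0 ?sqr_ge0.
under eq_integral do rewrite nE2.
rewrite (@exp_sum _ _ _ P _ _ (fun i t => \sum_(j < m) a i t ^+ 2 * a j t ^+ 2)); last 2 first.
- by move=> i; apply: measurable_sum => j; exact: maa.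
- by move=> i t; apply: sumr_ge0 => j _; exact: aa0.
rewrite /frob2 /mxtrace expr2 mulr_suml mulr_sumr -big_split -sumEFin/=.
apply: eq_bigr => i _.
rewrite (@exp_sum _ _ _ P _ _ (fun j t => a i t ^+ 2 * a j t ^+ 2)) => [|j|j t]; last 2 first.
- exact: maa.
- exact: aa0.
rewrite !mulr_sumr -big_split -sumEFin/=; apply: eq_bigr => j _.
by have := exp_linear_form_pair (row i M) (row j M) gz; rewrite -!(gramE M).
Qed.

Let mn K m (z : T -> 'cV[R]_K) (M : 'M[R]_(m, K)) : gauss_mx P z ->
  measurable_fun setT (fun t => normsq (M *m z t)).
Proof.
move=> [mz _]; apply: measurable_normsq.
by apply: mxmeas_mul => //; exact: mxmeas_cst.
Qed.

Lemma quad_dev K m (z : T -> 'cV[R]_K) (M : 'M[R]_(m, K)) (eps : R) :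
  gauss_mx P z -> 0 < eps ->
  (P [set t | (eps < `|normsq (M *m z t) - \tr (M *m M^T)|)%R] <=
   (2 * frob2 M / eps ^+ 2)%:E)%E.
Proof.
move=> gz e0; have [E1 E2] := quad_moments M gz; have mnz := mn M gz.
set tau := \tr _ in E1 E2 *; have tau0 : 0 <= tau by exact: tr_gram_ge0.
pose f t := (normsq (M *m z t) - tau) ^+ 2.
have mf : measurable_fun setT f.
  by apply: measurable_funX; exact: measurable_funB.
have f0 t : 0 <= f t by exact: sqr_ge0.
have mn2 : measurable_fun setT (fun t => normsq (M *m z t) ^+ 2).
  exact: measurable_funX.
have Ef : (\int[P]_t (f t)%:E = (2 * frob2 M)%:E)%E.
  (* The cross term of the square is moved to the left so that both sides are integrals of sums of
     nonnegative functions. *)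
  have : (\int[P]_t (f t + 2 * tau * normsq (M *m z t))%:E =
          \int[P]_t (normsq (M *m z t) ^+ 2 + tau ^+ 2)%:E)%E.
    by apply: eq_integral => t _; congr EFin; rewrite /f; ring.
  have t20 : 0 <= 2 * tau by rewrite mulr_ge0.
  rewrite (expD P (g := fun t => 2 * tau * normsq (M *m z t)) mf _ f0); last 2 first.
  - exact: measurable_funM.
  - by move=> t; rewrite mulr_ge0 ?normsq_nneg.
  rewrite (expD P (f := fun t => normsq (M *m z t) ^+ 2) (g := fun=> tau ^+ 2)
     mn2 (measurable_cst _) _ (fun=> sqr_ge0 _)); last by move=> t; exact: sqr_ge0.
  rewrite (expZ P mnz (fun t => normsq_nneg _) t20) E1 E2 exp_cst.
  rewrite -EFinM -EFinD => /ereal_addr_inj ->; congr EFin; ring.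
rewrite mulrC EFinM -Ef; have e20 : 0 < eps ^+ 2 by rewrite exprn_gt0.
have := exp_markov P e20 mf f0.
rewrite (_ : [set x | eps ^+ 2 < f x] =
  [set t | eps < `|normsq (M *m z t) - tau|])//.
apply/seteqP; split=> t /=; rewrite /f -[(_ - _) ^+ 2]real_normK ?num_real//.
  by rewrite ltr_sqr ?nnegrE// ltW.
by rewrite ltr_sqr ?nnegrE// ltW.
Qed.

Lemma linear_dev K (z : T -> 'cV[R]_K) (u : 'rV[R]_K) (eps : R) :
  gauss_mx P z -> 0 < eps ->
  (P [set t | (eps < `|(u *m z t) ord0 ord0|)%R] <=
   ((u *m u^T) ord0 ord0 / eps ^+ 2)%:E)%E.
Proof.
move=> gz e0; have [mz _] := gz; have [E1 _] := exp_linear_form u gz.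
have mf : measurable_fun setT (fun t => (u *m z t) ord0 ord0 ^+ 2).
  apply: measurable_funX.
  by apply: mxmeas_mul => //; exact: mxmeas_cst.
have e20 : 0 < eps ^+ 2 by rewrite exprn_gt0.
have := exp_markov P e20 mf (fun t => sqr_ge0 _); rewrite E1 -EFinM mulrC => h.
apply: le_trans h.
rewrite le_eqVlt; apply/orP; left; apply/eqP; congr (P _).
apply/seteqP; split=> t /=; rewrite -[((u *m z t) _ _) ^+ 2]real_normK ?num_real//;
  by rewrite ltr_sqr ?nnegrE// ltW.
Qed.

Lemma exp_mul_indep a b c e (X : T -> 'M[R]_(a, b)) (Y : T -> 'M[R]_(c, e))
    (f : 'M[R]_(a, b) -> R) (g : 'M[R]_(c, e) -> R) :
  mxmeas X -> mxmeas Y -> indep_mx P X Y ->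
  measurable_fun setT (fun z : 'cV[R]_(a * b) => f (vec_mx z^T)) ->
  measurable_fun setT (fun z : 'cV[R]_(c * e) => g (vec_mx z^T)) ->
  (forall M, 0 <= f M) -> (forall M, 0 <= g M) ->
  (\int[P]_t (f (X t) * g (Y t))%:E =
   \int[P]_t (f (X t))%:E * \int[P]_t (g (Y t))%:E)%E.
Proof.
move=> mX mY XY mf mg f0 g0.
have mU := measurable_cvec mX; have mV := measurable_cvec mY.
have mUV := measurable_fun_pair mU mV.
set U := fun t => cvec (X t) in mU mUV; set V := fun t => cvec (Y t) in mV mUV.
pose F (z : 'cV[R]_(a * b)) := (f (vec_mx z^T))%:E.
pose G (z : 'cV[R]_(c * e)) := (g (vec_mx z^T))%:E.
have mF : measurable_fun setT F by exact/measurable_EFinP.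
have mG : measurable_fun setT G by exact/measurable_EFinP.
have F0 z : (0 <= F z)%E by rewrite lee_fin.
have G0 z : (0 <= G z)%E by rewrite lee_fin.
have EU : (\int[P]_t (f (X t))%:E = \int[law P mU]_z F z)%E.
  rewrite (ge0_integral_pushforward mU P measurableT mF)//.
  by apply: eq_integral => t _; rewrite /F /= /U cvecK.
have EV : (\int[P]_t (g (Y t))%:E = \int[law P mV]_z G z)%E.
  rewrite (ge0_integral_pushforward mV P measurableT mG)//.
  by apply: eq_integral => t _; rewrite /G /= /V cvecK.
have mFG : measurable_fun setT (fun z => F z.1 * G z.2)%E.
  by apply: emeasurable_funM; exact: measurableT_comp.
transitivity (\int[law P mUV]_z (F z.1 * G z.2))%E.
  rewrite (ge0_integral_pushforward mUV P measurableT mFG)//; last first.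
    by move=> z _; rewrite mule_ge0.
  by apply: eq_integral => t _; rewrite /F /G /= /U /V !cvecK EFinM.
rewrite (eq_measure_integral (law P mU \x law P mV)%E); last first.
  by move=> A mA _; exact: (law_pair mU mV XY mA).
rewrite (fubini_tonelli1 _ mFG); last by move=> z; rewrite mule_ge0.
rewrite EU EV -ge0_integralZr; last 4 first.
- exact: measurableT.
- exact: mF.
- by move=> z _; exact: F0.
- by apply: integral_ge0 => z _; exact: G0.
apply: eq_integral => z _; rewrite /fubini_F /= -ge0_integralZl//.
Qed.

Lemma chi2_mgf k (z : T -> 'cV[R]_k) (t : R) : gauss_mx P z -> t < 2^-1 ->
  (\int[P]_w (expR (t * normsq (z w)))%:E = ((Num.sqrt (1 - 2 * t))^-1 ^+ k)%:E)%E.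
Proof.
move=> + t2; elim: k z => [|k IH] z gz.
  under eq_integral do rewrite normsqE big_ord0 mulr0 expR0.
  by rewrite exp_cst expr0.
pose x w : 'M[R]_1 := @usubmx R 1 k 1 (z w).
pose y w : 'cV[R]_k := @dsubmx R 1 k 1 (z w).
have gz' : gauss_mx P (fun w => col_mx (x w) (y w)).
  by apply: gauss_mx_eq gz => w; rewrite vsubmxK.
have gx := gauss_mx_usub gz'; have gy := gauss_mx_dsub gz'.
have mexp n m : measurable_fun setT (fun w : 'cV[R]_(n * m) =>
    expR (t * \sum_i \sum_j (vec_mx w^T : 'M[R]_(n, m)) i j ^+ 2)).
  apply: measurableT_comp => //; apply: measurable_funM => //.
  apply: measurable_sum => i; apply: measurable_sum => j.
  by apply: measurable_funX; exact: mxmeas_uncvec.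
pose h n m (M : 'M[R]_(n, m)) := expR (t * \sum_i \sum_j M i j ^+ 2).
have hE n (v : 'cV[R]_n) : expR (t * normsq v) = h _ _ v.
  by rewrite normsqE /h; under [in RHS]eq_bigr do rewrite big_ord1.
have zE w : normsq (z w) = normsq (x w) + normsq (y w).
  by rewrite -normsq_col_mx vsubmxK.
transitivity (\int[P]_w (h _ _ (x w) * h _ _ (y w))%:E)%E.
  by apply: eq_integral => w _; rewrite zE mulrDr expRD !hE.
rewrite (exp_mul_indep gx.1 gy.1 (gauss_col_indep gz'))//; last 2 first.
- by move=> M; exact: expR_ge0.
- by move=> M; exact: expR_ge0.
rewrite exprS EFinM; congr (_ * _)%E; last first.
  by rewrite -(IH _ gy); apply: eq_integral => w _; rewrite hE.
rewrite -normal_mgf_sqr// -(exp_gauss11 (f := fun v => expR (t * v ^+ 2)) gx).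
- by apply: eq_integral => w _; rewrite /h !big_ord1.
- by apply: measurableT_comp => //; exact: measurable_funM.
- by move=> v; exact: expR_ge0.
Qed.

End quadratic_forms.

(** * Concentration of Wishart matrices *)

Section outer_bounds.
Context {d} {T : measurableType d} {R : realType}.
Variable P : probability T R.
Implicit Types (A B : set T) (a b eta : R).

(* An upper bound on the outer probability of a possibly nonmeasurable event. *)
Definition pbound A eta : Prop :=
  exists E, [/\ measurable E, A `<=` E & (P E <= eta%:E)%E].

Lemma pbound_measurable A eta : measurable A -> (P A <= eta%:E)%E -> pbound A eta.
Proof. by move=> mA PA; exists A; split=> // t. Qed.

Lemma pboundP A eta : measurable A -> pbound A eta -> (P A <= eta%:E)%E.
Proof.
move=> mA [E [mE AE PE]]; apply: le_trans PE.
by apply: le_measure => //; exact: mem_set.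
Qed.

Lemma pbound_sub A B a b : A `<=` B -> a <= b -> pbound B a -> pbound A b.
Proof.
move=> AB ab [E [mE BE PE]]; exists E; split=> //; first exact: subset_trans BE.
by apply: le_trans PE _; rewrite lee_fin.
Qed.

Lemma pbound_set0 eta : 0 <= eta -> pbound set0 eta.
Proof. by move=> e0; exists set0; split=> //; rewrite measure0 lee_fin. Qed.

Lemma pboundU A B a b : pbound A a -> pbound B b -> pbound (A `|` B) (a + b).
Proof.
move=> [E [mE AE PE]] [F [mF BF PF]]; exists (E `|` F); split.
- exact: measurableU.
- by apply: setUSS.
- rewrite EFinD; apply: le_trans (leeD PE PF).
  by rewrite measureU2.
Qed.

Lemma pbound_exists n (A : 'I_n -> set T) eta : 0 <= eta ->
  (forall i, pbound (A i) eta) -> pbound [set t | exists i, A i t] (n%:R * eta).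
Proof.
elim: n A => [|n IH] A e0 Ae.
  rewrite mul0r; apply: pbound_sub (pbound_set0 (lexx 0)) => // t [[]] //.
apply: (@pbound_sub _ (A ord0 `|` [set t | exists i, A (lift ord0 i) t])
  (eta + n%:R * eta)).
- move=> t [i At]; case: (unliftP ord0 i) At => [j|] -> At; [right|left] => //.
  by exists j.
- by rewrite -[X in X + _]mul1r -mulrDl -natr1 addrC.
- by apply: pboundU => //; apply: IH => // i; exact: Ae.
Qed.

(** Conditioning on X for outer bounds. Measurability of S is asked for arbitrary random arguments
    because S is used on the original space, on the product space and with a frozen first
    argument. *)
Lemma pbound_indep (a b c e : nat) (X : T -> 'M[R]_(a, b)) (Y : T -> 'M[R]_(c, e))
    (S : 'M[R]_(a, b) -> 'M[R]_(c, e) -> Prop) (eta : R) :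
  mxmeas X -> mxmeas Y -> indep_mx P X Y ->
  (forall d' (T' : measurableType d') (M : T' -> 'M[R]_(a, b)) (N : T' -> 'M[R]_(c, e)),
    mxmeas M -> mxmeas N -> measurable [set t | S (M t) (N t)]) ->
  (forall M, pbound [set t | S M (Y t)] eta) ->
  pbound [set t | S (X t) (Y t)] eta.
Proof.
move=> mX mY XY mS Seta; apply: pbound_measurable; first exact: mS.
apply: indep_mx_le => //.
  apply: mS.
    apply: mxmeas_vec_mx; apply: mxmeas_tr => i j.
    exact: measurableT_comp (@mxmeas_id R _ i j) measurable_fst.
  apply: mxmeas_vec_mx; apply: mxmeas_tr => i j.
  exact: measurableT_comp (@mxmeas_id R _ i j) measurable_snd.
move=> M; apply: pboundP => //; apply: mS => //; exact: mxmeas_cst.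
Qed.

End outer_bounds.

(** * Exponential tails of chi-squared variables *)

Section chi2_tails.
Context {R : realType}.

(** Chernoff's bound for both tails at once: t > 0 gives the upper one and t < 0 the lower one. The
    hypothesis says that (1 - 2 t) (1 + 2 t (1 + e)) > 1, which makes the rate per degree of freedom
    smaller than 1. *)
Lemma chi2_chernoff (t e : R) : t < 2^-1 -> 0 < 2 * t * e - 4 * t ^+ 2 * (1 + e) ->
  exists2 rho : R, 0 < rho < 1 &
    forall d (T : measurableType d) (P : probability T R) k (z : T -> 'cV[R]_k),
    gauss_mx P z ->
    pbound P [set w | t * ((1 + e) * k%:R) < t * normsq (z w)] (rho ^+ k).
Proof.
move=> t2 te; have s0 : 0 < 1 - 2 * t by lra.
have r0 : 0 < Num.sqrt (1 - 2 * t) by rewrite sqrtr_gt0.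
exists (expR (- (t * (1 + e))) / Num.sqrt (1 - 2 * t)).
  rewrite divr_gt0 ?expR_gt0//= ltr_pdivrMr// mul1r.
  rewrite -(@ltr_sqr R) ?nnegrE ?expR_ge0 ?sqrtr_ge0// sqr_sqrtr ?(ltW s0)//.
  have -> : expR (- (t * (1 + e))) ^+ 2 = (expR (2 * (t * (1 + e))))^-1.
    by rewrite expr2 -expRD -expRN; congr expR; ring.
  rewrite -[ltLHS]mul1r ltr_pdivrMr ?expR_gt0//.
  apply: (@lt_le_trans _ _ ((1 - 2 * t) * (1 + 2 * (t * (1 + e))))); first by nra.
  by rewrite ler_pM2l// expR_ge1Dx.
move=> d T P k z gz; have mz := measurable_normsq gz.1.
have mt : measurable_fun setT (fun w => t * normsq (z w)) by exact: measurable_funM.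
apply: pbound_measurable; first exact: measurable_ltr_set.
pose c := expR (t * ((1 + e) * k%:R)).
have c0 : 0 < c by exact: expR_gt0.
have me : measurable_fun setT (fun w => expR (t * normsq (z w))).
  exact: measurableT_comp.
have := exp_markov P c0 me (fun w => expR_ge0 _).
rewrite (chi2_mgf gz t2) -EFinM (_ : [set x | c < _] =
  [set w | t * ((1 + e) * k%:R) < t * normsq (z w)]); last first.
  by apply/seteqP; split=> w /=; rewrite /c ltr_expR.
move=> h; apply: le_trans h _; rewrite lee_fin expr_div_n exprVn.
rewrite le_eqVlt; apply/orP; left; apply/eqP; congr (_ * _).
by rewrite -expRM_natl -expRN; congr expR; ring.
Qed.

Lemma chi2_tail (eps : R) : 0 < eps -> eps < 1 ->
  exists2 rho : R, 0 < rho < 1 &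
    forall d (T : measurableType d) (P : probability T R) k (z : T -> 'cV[R]_k),
    gauss_mx P z ->
    pbound P [set w | eps * k%:R < `|normsq (z w) - k%:R|] (2 * rho ^+ k).
Proof.
move=> e0 e1.
(* For the upper tail this t maximizes 2 t e - 4 t^2 (1 + e) at e = eps; for the lower tail the
   simpler value - eps / 4 is sufficient. *)
have t1_lt : eps / (4 * (1 + eps)) < 2^-1 by rewrite ltr_pdivrMr; lra.
have [||r1 /andP[r10 r11] h1] := @chi2_chernoff (eps / (4 * (1 + eps))) eps => //.
  have -> : 2 * (eps / (4 * (1 + eps))) * eps -
      4 * (eps / (4 * (1 + eps))) ^+ 2 * (1 + eps) = eps ^+ 2 / (4 * (1 + eps)).
    by field; rewrite gt_eqF//; lra.
  by rewrite divr_gt0 ?exprn_gt0//; lra.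
have [||r2 /andP[r20 r21] h2] := @chi2_chernoff (- (eps / 4)) (- eps); [lra| |].
  by nra.
exists (Num.max r1 r2); first by rewrite lt_max r10 gt_max r11.
move=> d T P k z gz.
apply: pbound_sub (pboundU (h1 _ _ _ _ _ gz) (h2 _ _ _ _ _ gz)).
  move=> w /=; have t1 : 0 < eps / (4 * (1 + eps)) by rewrite divr_gt0//; lra.
  rewrite (ltr_pM2l t1) ltr_nM2l; last by rewrite oppr_lt0 divr_gt0.
  rewrite lter_normr => /orP[h|h]; [left|right]; lra.
rewrite mulr_natl mulr2n lerD// lerXn2r ?nnegrE ?le_max ?lexx ?orbT ?(ltW r10) ?(ltW r20)//.
Qed.

(** Pays for the union bounds: each union over basis vectors costs a power of the dimension. The
    exponential is compared with its term of degree n + 1. *)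
Lemma poly_geometric_small (rho : R) n (eps : R) : 0 < rho < 1 -> 0 < eps ->
  \forall k \near \oo, k%:R ^+ n * rho ^+ k <= eps.
Proof.
move=> /andP[r0 r1] e0; pose l := - ln rho.
have l0 : 0 < l by rewrite oppr_gt0 ln_lt0// r0.
have rE k : rho ^+ k = (expR (l * k%:R))^-1.
  by rewrite -expRN mulrC -mulrN /l opprK mulrC expRM_natr lnK// posrE.
pose c := l ^+ n.+1 / n.+1`!%:R.
have c0 : 0 < c by rewrite divr_gt0 ?exprn_gt0// ltr0n fact_gt0.
near=> k; have k0 : 0 < k%:R :> R by rewrite ltr0n; near: k; exists 1%N.
rewrite rE ler_pdivrMr ?expR_gt0//.
apply: (@le_trans _ _ (eps * (c * k%:R ^+ n.+1))); last first.
  rewrite ler_pM2l//; apply: le_trans (expR_ge1Dxn n _); last by rewrite mulr_ge0// ltW.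
  by rewrite exprMn mulrAC lerDr.
have -> : eps * (c * k%:R ^+ n.+1) = eps * c * k%:R * k%:R ^+ n by rewrite exprS; ring.
apply: ler_peMl; first by rewrite exprn_ge0 ?ltW.
have ec0 : 0 < eps * c by exact: mulr_gt0.
have : (eps * c)^-1 <= k%:R by near: k; exact: nbhs_infty_ger.
by rewrite -[leLHS]mulr1 ler_pdivrMl.
Unshelve. all: by end_near. Qed.

End chi2_tails.

(** * Quadratic forms in the inverse of a Gram matrix *)

Section gram_quadratic.
Context {R : realType}.

Definition q1 n (W : 'M[R]_n) (v : 'cV[R]_n) : R :=
  (v^T *m invmx W *m v) ord0 ord0.

Definition q2 n (W : 'M[R]_n) (v : 'cV[R]_n) : R :=
  (v^T *m (invmx W *m invmx W) *m v) ord0 ord0.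

Definition gram m n (Z : 'M[R]_(m, n)) : 'M[R]_m := Z *m Z^T.

Definition bvec n (i : 'I_n) : 'cV[R]_n := delta_mx i ord0.

Lemma bvec_quad n (M : 'M[R]_n) i : ((bvec i)^T *m M *m bvec i) ord0 ord0 = M i i.
Proof. by rewrite /bvec trmx_delta -rowE -colE !mxE. Qed.

Lemma q1_bvec n (W : 'M[R]_n) i : q1 W (bvec i) = invmx W i i.
Proof. exact: bvec_quad. Qed.

Lemma q2_bvec n (W : 'M[R]_n) i : q2 W (bvec i) = (invmx W *m invmx W) i i.
Proof. exact: bvec_quad. Qed.

Lemma bvec_unit n (i : 'I_n) : (bvec i)^T *m bvec i = 1%:M.
Proof.
by rewrite [LHS]mx11_scalar -[X in X *m _]mulmx1 bvec_quad mxE eqxx.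
Qed.

Lemma invmx_conj n (Q W : 'M[R]_n) : Q *m Q^T = 1%:M ->
  invmx (Q *m W *m Q^T) = Q *m invmx W *m Q^T.
Proof.
move=> QQ; have QQ' : Q^T *m Q = 1%:M by exact: mulmx1C.
have [uQ uQT] := mulmx1_unit QQ.
have uE : (Q *m W *m Q^T \in unitmx) = (W \in unitmx).
  by rewrite !unitmx_mul uQ uQT andbT.
(* If W is singular then so is its conjugate, and [invmx] leaves both unchanged. *)
have [uW|uW] := boolP (W \in unitmx); last first.
  by rewrite /invmx uE (negbTE uW).
apply: (@can_inj _ _ (mulmx (Q *m W *m Q^T)) (mulmx (invmx (Q *m W *m Q^T)))).
  by move=> X; rewrite mulKmx// uE.
rewrite mulmxV ?uE// !mulmxA -(mulmxA (Q *m W)) QQ' mulmx1.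
by rewrite -(mulmxA Q) mulmxV// mulmx1 QQ.
Qed.

Lemma measurable_q1 d (T : measurableType d) n (W : T -> 'M[R]_n) (v : T -> 'cV[R]_n) :
  mxmeas W -> mxmeas v -> measurable_fun setT (fun t => q1 (W t) (v t)).
Proof.
move=> mW mv; apply: mxmeas_mul => //; apply: mxmeas_mul; first exact: mxmeas_tr.
exact: mxmeas_inv.
Qed.

Lemma measurable_q2 d (T : measurableType d) n (W : T -> 'M[R]_n) (v : T -> 'cV[R]_n) :
  mxmeas W -> mxmeas v -> measurable_fun setT (fun t => q2 (W t) (v t)).
Proof.
move=> mW mv; apply: mxmeas_mul => //; apply: mxmeas_mul; first exact: mxmeas_tr.
by apply: mxmeas_mul; exact: mxmeas_inv.
Qed.

Lemma mxmeas_gram d (T : measurableType d) m n (Z : T -> 'M[R]_(m, n)) :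
  mxmeas Z -> mxmeas (fun t => gram (Z t)).
Proof. by move=> mZ; apply: mxmeas_mul => //; exact: mxmeas_tr. Qed.

Lemma measurable_mxtrace d (T : measurableType d) n (W : T -> 'M[R]_n) :
  mxmeas W -> measurable_fun setT (fun t => \tr (W t)).
Proof. by move=> mW; apply: measurable_sum => i; exact: mW. Qed.

(* Left multiplication of Z by an orthogonal matrix with first row v^T turns
   the quadratic forms at v into those at the first basis vector. *)
Lemma rotate_event m N (S : R -> R -> R -> Prop) (eta : R) :
  (forall d (T : measurableType d) (P : probability T R) (Z : T -> 'M[R]_(m.+1, N)),
    gauss_mx P Z -> pbound P [set t | S (\det (gram (Z t)))
      (q1 (gram (Z t)) (bvec ord0)) (q2 (gram (Z t)) (bvec ord0))] eta) ->
  forall d (T : measurableType d) (P : probability T R) (Z : T -> 'M[R]_(m.+1, N))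
    (v : 'cV[R]_m.+1),
    gauss_mx P Z -> v^T *m v = 1%:M -> pbound P [set t | S (\det (gram (Z t)))
      (q1 (gram (Z t)) v) (q2 (gram (Z t)) v)] eta.
Proof.
move=> H d T P Z v gZ vv.
have [|L [LL vL]] := @orthonormal_complement R m 1 m.+1 v^T; first by rewrite add1n.
pose Q : 'M[R]_(1 + m) := col_mx v^T L.
have QQ : Q *m Q^T = 1%:M.
  rewrite /Q tr_col_mx mul_col_row trmxK vv vL LL.
  by rewrite -[L *m v]trmxK trmx_mul vL trmx0 -scalar_mx_block.
have Qe : Q^T *m bvec ord0 = v.
  rewrite /bvec -colE; apply/matrixP => i j; rewrite ord1 !mxE.
  by case: splitP => // l _; rewrite mxE [l]ord1.
have eQ : (bvec ord0)^T *m Q = v^T by rewrite -Qe trmx_mul trmxK.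
have gE t : gram (Q *m Z t) = Q *m gram (Z t) *m Q^T.
  by rewrite /gram trmx_mul !mulmxA.
have QQ' : Q^T *m Q = 1%:M by exact: mulmx1C.
have dE W : \det (Q *m W *m Q^T) = \det W.
  by rewrite !det_mulmx mulrAC -det_mulmx QQ det1 mul1r.
have q1E W : q1 (Q *m W *m Q^T) (bvec ord0) = q1 W v.
  by rewrite /q1 invmx_conj// !mulmxA eQ -mulmxA Qe.
have q2E W : q2 (Q *m W *m Q^T) (bvec ord0) = q2 W v.
  rewrite /q2 invmx_conj// !mulmxA eQ -(mulmxA _ Q^T Q) QQ' mulmx1.
  by rewrite -(mulmxA _ Q^T (bvec ord0)) Qe.
have := H d T P (fun t => Q *m Z t) (gauss_mull QQ gZ).
rewrite (_ : [set t | S (\det (gram (Q *m Z t))) _ _] =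
  [set t | S (\det (gram (Z t))) (q1 (gram (Z t)) v) (q2 (gram (Z t)) v)])//.
by apply/seteqP; split=> t; rewrite /= gE dE q1E q2E.
Qed.

Lemma gram_unit_sym m n (Z : 'M[R]_(m, n)) : (invmx (gram Z))^T = invmx (gram Z).
Proof. by rewrite trmx_inv gram_tr. Qed.

(** The quadratic form r of the first row is |M z|^2 for this M, so its conditional mean is tr W2^-1
    and its conditional variance 2 tr W2^-2. *)
Lemma frob2_first_row m n (Z2 : 'M[R]_(m, n)) : gram Z2 \in unitmx ->
  let M := invmx (gram Z2) *m Z2 in
  M *m M^T = invmx (gram Z2) /\
  frob2 M = \tr (invmx (gram Z2) *m invmx (gram Z2)).
Proof.
move=> uW M; have MM : M *m M^T = invmx (gram Z2).
  by rewrite /M trmx_mul gram_unit_sym mulmxA -(mulmxA _ Z2) mulVmx// mul1mx.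
split=> //; rewrite /frob2 MM /mxtrace; apply: eq_bigr => i _.
rewrite mxE; apply: eq_bigr => j _.
by rewrite expr2; congr (_ * _); rewrite -[in RHS]gram_unit_sym mxE.
Qed.

Lemma tr_inv2_le m n (Z2 : 'M[R]_(m, n)) : gram Z2 \in unitmx ->
  \tr (invmx (gram Z2) *m invmx (gram Z2)) <= \tr (invmx (gram Z2)) ^+ 2.
Proof.
by move=> uW; have [MM <-] := frob2_first_row uW; rewrite -[in leRHS]MM frob2_le.
Qed.

Lemma tr_inv_ge0 m n (Z2 : 'M[R]_(m, n)) : gram Z2 \in unitmx ->
  0 <= \tr (invmx (gram Z2)).
Proof.
by move=> uW; have [MM _] := frob2_first_row uW; rewrite -MM tr_gram_ge0.
Qed.

Lemma first_row_formulas m k (z : 'rV[R]_(m + k)) (Z2 : 'M[R]_(m, m + k)) (L : 'M[R]_(k, m + k))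
    (W := gram (col_mx z Z2)) (q := normsq (L *m z^T))
    (r := normsq ((invmx (gram Z2) *m Z2) *m z^T)) :
  gram Z2 \in unitmx -> L *m L^T = 1%:M -> Z2 *m L^T = 0 -> q != 0 ->
  [/\ \det W != 0, q1 W (bvec ord0) = q^-1 & q2 W (bvec ord0) = (1 + r) / q ^+ 2].
Proof.
move=> uW LL ZL q0.
have [uW' h1 h2] := gram_inverse_col0 erefl uW LL ZL q0.
split; first by rewrite -unitfE -unitmxE.
  by rewrite q1_bvec.
by rewrite q2_bvec h2.
Qed.

End gram_quadratic.

(** * Deviation events for pivots, traces and q2 of a Wishart matrix *)

Section wishart_events.
Context {R : realType}.
Variables (delta rho : R).
Hypotheses (delta_lt1 : delta < 1) (rho_gt0 : 0 < rho) (rho_lt1 : rho < 1).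
Hypothesis tail : forall d (T : measurableType d) (P : probability T R) k
  (z : T -> 'cV[R]_k), gauss_mx P z ->
  pbound P [set w | delta * k%:R < `|normsq (z w) - k%:R|] (2 * rho ^+ k).

(* For unit v and W Wishart of size n with n + k - 1 degrees of freedom,
   1 / q1 W v is chi-squared with k degrees of freedom. *)
Definition pivot_dev k n (W : 'M[R]_n) (v : 'cV[R]_n) : Prop :=
  \det W = 0 \/ delta * k%:R < `|(q1 W v)^-1 - k%:R|.

(* q2 W v / q1 W v ^ 2 - 1 is a quadratic form in a Gaussian vector whose mean
   is the trace of the inverse of a Wishart matrix of size n - 1. *)
Definition ratio_dev (eps tau : R) n (W : 'M[R]_n) (v : 'cV[R]_n) : Prop :=
  eps < `|q2 W v / q1 W v ^+ 2 - 1 - tau|.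

Lemma measurable_pivot_dev d (T : measurableType d) k n (W : T -> 'M[R]_n) (v : T -> 'cV[R]_n) :
  mxmeas W -> mxmeas v -> measurable [set t | pivot_dev k (W t) (v t)].
Proof.
move=> mW mv; apply: measurableU.
  by apply: measurable_eqr_set => //; exact: measurable_det.
apply: measurable_ltr_set => //; apply: measurableT_comp => //.
apply: measurable_funB => //.
exact: measurableT_comp (@measurable_inv R) (measurable_q1 mW mv).
Qed.

Lemma measurable_ratio_dev d (T : measurableType d) eps (tau : T -> R) n
    (W : T -> 'M[R]_n) (v : T -> 'cV[R]_n) :
  mxmeas W -> mxmeas v -> measurable_fun setT tau ->
  measurable [set t | ratio_dev eps (tau t) (W t) (v t)].
Proof.
move=> mW mv mt; apply: measurable_ltr_set => //; apply: measurableT_comp => //.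
apply: measurable_funB => //; apply: measurable_funB => //.
apply: measurable_funM; first exact: measurable_q2.
apply: measurableT_comp (@measurable_inv R) _.
by apply: measurable_funX; exact: measurable_q1.
Qed.

(** With the other rows frozen, L z^T is a standard Gaussian vector of length k, so q is chi-squared
    and the tail hypothesis applies; r is handled by Chebyshev. *)
Lemma first_row_fixed d (T : measurableType d) (P : probability T R) m k
    (z : T -> 'rV[R]_(m + k)) (Z2 : 'M[R]_(m, m + k)) :
  gauss_mx P z -> (0 < k)%N -> gram Z2 \in unitmx ->
  pbound P [set t | pivot_dev k (gram (col_mx (z t) Z2)) (bvec ord0)] (2 * rho ^+ k) /\
  forall eps, 0 < eps ->
  pbound P [set t | pivot_dev k (gram (col_mx (z t) Z2)) (bvec ord0) \/
     ratio_dev eps (\tr (invmx (gram Z2))) (gram (col_mx (z t) Z2)) (bvec ord0)]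
    (2 * rho ^+ k + 2 * \tr (invmx (gram Z2) *m invmx (gram Z2)) / eps ^+ 2).
Proof.
move=> gz k0 uW; have k0' : 0 < k%:R :> R by rewrite ltr0n.
have [//|L [LL ZL]] := @orthonormal_complement R k m (m + k) Z2.
have gq := gauss_mull LL (gauss_mx_tr gz).
(* As delta < 1, the value q = 0 is itself a deviation, so singularity is absorbed in the tail event
   of q. *)
have sub1 t : ~ delta * k%:R < `|normsq (L *m (z t)^T) - k%:R| ->
    normsq (L *m (z t)^T) != 0.
  move=> /negP; rewrite -leNgt; apply: contraTneq => ->.
  by rewrite sub0r normrN gtr0_norm// -ltNge gtr_pMl.
have sub2 t : pivot_dev k (gram (col_mx (z t) Z2)) (bvec ord0) ->
    delta * k%:R < `|normsq (L *m (z t)^T) - k%:R|.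
  move=> b; apply: contrapT => nb; have q0 := sub1 t nb.
  have [d0 h1 _] := first_row_formulas uW LL ZL q0.
  by case: b => [/eqP|]; [rewrite (negbTE d0)|rewrite h1 invrK].
split; first exact: pbound_sub (lexx _) (tail gq).
move=> eps e0; have [MM fM] := frob2_first_row uW.
have := quad_dev (invmx (gram Z2) *m Z2) (gauss_mx_tr gz) e0.
rewrite MM fM => h.
have mr : measurable [set t | eps < `|normsq (invmx (gram Z2) *m Z2 *m (z t)^T) -
    \tr (invmx (gram Z2))|].
  apply: measurable_ltr_set => //; apply: measurableT_comp => //.
  apply: measurable_funB => //; apply: measurable_normsq.
  by apply: mxmeas_mul; [exact: mxmeas_cst|exact: (gauss_mx_tr gz).1].
apply: pbound_sub (lexx _) (pboundU (tail gq) (pbound_measurable mr h)) => t.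
have [|/negP nb] := boolP (delta * k%:R < `|normsq (L *m (z t)^T) - k%:R|); first by left.
have q0 := sub1 t nb; have [d0 h1 h2] := first_row_formulas uW LL ZL q0.
move=> [/sub2 //|]; rewrite /ratio_dev h1 h2 => b; right => /=; move: b.
rewrite (_ : _ / _ - 1 = normsq (invmx (gram Z2) *m Z2 *m (z t)^T))//.
by field.
Qed.

Let tau k : R := 2 * rho ^+ k.

Let tau_ge0 k : 0 <= tau k.
Proof. by rewrite mulr_ge0// exprn_ge0// ltW. Qed.

Let tauS k : tau k.+1 <= tau k.
Proof. by rewrite ler_pM2l// exprS ler_piMl ?exprn_ge0 ?ltW. Qed.

Let split_first_row d (T : measurableType d) (P : probability T R) m k
    (Z : T -> 'M[R]_(m.+1, m + k)) : gauss_mx P Z ->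
  exists (z : T -> 'rV[R]_(m + k)) (Z2 : T -> 'M[R]_(m, m + k)),
  [/\ forall t, Z t = col_mx (z t) (Z2 t), gauss_mx P z, gauss_mx P Z2 &
      indep_mx P Z2 z].
Proof.
move=> gZ; exists (fun t => @usubmx R 1 m _ (Z t)), (fun t => @dsubmx R 1 m _ (Z t)).
have gZ' : gauss_mx P (fun t => col_mx (@usubmx R 1 m _ (Z t)) (@dsubmx R 1 m _ (Z t))).
  by apply: gauss_mx_eq gZ => t; rewrite vsubmxK.
split; first by move=> t; rewrite vsubmxK.
- exact: gauss_mx_usub gZ'.
- exact: gauss_mx_dsub gZ'.
- exact/indep_mx_sym/(gauss_col_indep gZ').
Qed.

(** Removing a row raises the parameter by one: m rows in m + k columns have parameter k + 1. The
    singularity bound is a hypothesis here because it is proved in turn by induction through this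
    step. *)
Let reg_step m : (forall k N, (0 < k)%N -> N.+1 = (m + k)%N ->
    forall d (T : measurableType d) (P : probability T R) (Z : T -> 'M[R]_(m, N)),
    gauss_mx P Z -> pbound P [set t | \det (gram (Z t)) = 0] (m%:R * tau k)) ->
  forall k, (0 < k)%N ->
    forall d (T : measurableType d) (P : probability T R)
      (Z : T -> 'M[R]_(m.+1, m + k)),
    gauss_mx P Z ->
    pbound P [set t | pivot_dev k (gram (Z t)) (bvec ord0)] (m.+1%:R * tau k).
Proof.
move=> IH k k0 d T P Z gZ; have [z [Z2 [ZE gz gZ2 iZ]]] := split_first_row gZ.
have h1 : pbound P [set t | \det (gram (Z2 t)) = 0] (m%:R * tau k.+1).
  by apply: IH gZ2 => //; rewrite addnS.
pose S (M2 : 'M[R]_(m, m + k)) (M1 : 'rV[R]_(m + k)) :=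
  gram M2 \in unitmx /\ pivot_dev k (gram (col_mx M1 M2)) (bvec ord0).
have h2 : pbound P [set t | S (Z2 t) (z t)] (tau k).
  apply: (pbound_indep gZ2.1 gz.1 iZ) => [d' T' M N mM mN|M].
    apply: measurableI.
      have -> : (fun t => gram (M t) \in unitmx : Prop) = ~` [set t | \det (gram (M t)) = 0].
        apply/seteqP; split=> t /=; rewrite unitmxE unitfE; first by move/eqP.
        by move=> h; apply/eqP.
      apply: measurableC; apply: measurable_eqr_set => //.
      exact/measurable_det/mxmeas_gram.
    apply: measurable_pivot_dev; last exact: mxmeas_cst.
    by apply: mxmeas_gram; exact: mxmeas_col_mx.
  have [uM|uM] := boolP (gram M \in unitmx); last first.
    by apply: pbound_sub (tau_ge0 k) (pbound_set0 _ (lexx 0)) => t; rewrite /S /= => -[]; rewrite ?(negbTE uM).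
  have [h _] := first_row_fixed gz k0 uM.
  by apply: pbound_sub (lexx _) h => t; rewrite /S /= => -[].
apply: pbound_sub (pboundU h1 h2).
  move=> t; rewrite /= ZE => b.
  have [/eqP d0|d0] := boolP (\det (gram (Z2 t)) == 0); first by left.
  by right; split=> //; rewrite unitmxE unitfE.
rewrite -natr1 mulrDl mul1r lerD2r; apply: ler_wpM2l => //; exact: tauS.
Qed.

(** Since [pivot_dev] contains singularity, [reg_step] carries the induction, at the cost of one
    chi-squared tail per row. The equation N.+1 = m + k states N = m + k - 1 without truncated
    subtraction. *)
Lemma wishart_singular m : forall k N, (0 < k)%N -> N.+1 = (m + k)%N ->
  forall d (T : measurableType d) (P : probability T R) (Z : T -> 'M[R]_(m, N)),
  gauss_mx P Z -> pbound P [set t | \det (gram (Z t)) = 0] (m%:R * tau k).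
Proof.
elim: m => [|m IH] k N k0 NE d T P Z gZ.
  rewrite mul0r; apply: pbound_sub (lexx 0) (pbound_set0 _ (lexx 0)) => t /=.
  by rewrite det_mx00 => /eqP; rewrite oner_eq0.
move: NE; rewrite addSn => -[NE]; move: NE Z gZ => -> Z gZ.
apply: pbound_sub (lexx _) (reg_step IH k0 gZ) => t; by left.
Qed.

Lemma wishart_pivot_dev m k : (0 < k)%N ->
  forall d (T : measurableType d) (P : probability T R) (Z : T -> 'M[R]_(m.+1, m + k))
    (v : 'cV[R]_m.+1), gauss_mx P Z -> v^T *m v = 1%:M ->
  pbound P [set t | pivot_dev k (gram (Z t)) v] (m.+1%:R * tau k).
Proof.
move=> k0 d T P Z v gZ vv.
apply: (rotate_event (S := fun a b _ => a = 0 \/ delta * k%:R < `|b^-1 - k%:R|)) gZ vv.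
move=> {}d {}T {}P {}Z gZ; exact: (reg_step (@wishart_singular m) k0 gZ).
Qed.

Definition some_pivot_dev k n (W : 'M[R]_n) : Prop :=
  \det W = 0 \/ exists i, pivot_dev k W (bvec i).

Lemma wishart_some_pivot_dev m k N : (0 < k)%N -> N.+1 = (m + k)%N ->
  forall d (T : measurableType d) (P : probability T R) (Z : T -> 'M[R]_(m, N)),
  gauss_mx P Z -> pbound P [set t | some_pivot_dev k (gram (Z t))] (m%:R * (m%:R * tau k)).
Proof.
case: m => [|m] k0 NE d T P Z gZ.
  rewrite mul0r; apply: pbound_sub (lexx 0) (pbound_set0 _ (lexx 0)) => t /=.
  by case=> [|[[]]//]; rewrite det_mx00 => /eqP; rewrite oner_eq0.
move: NE; rewrite addSn => -[NE]; move: NE Z gZ => -> Z gZ.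
have : pbound P [set t | exists i, pivot_dev k (gram (Z t)) (bvec i)]
    (m.+1%:R * (m.+1%:R * tau k)).
  apply: (pbound_exists (A := fun i => [set t | pivot_dev k (gram (Z t)) (bvec i)])).
    by rewrite mulr_ge0.
  by move=> i; apply: wishart_pivot_dev => //; exact: bvec_unit.
apply: pbound_sub (lexx _) => t [d0|//]; exists ord0; by left.
Qed.

Lemma pivot_devN k n (W : 'M[R]_n) v : (0 < k)%N -> ~ pivot_dev k W v ->
  [/\ \det W != 0, 0 < q1 W v, (1 - delta) * k%:R <= (q1 W v)^-1 &
      (q1 W v)^-1 <= (1 + delta) * k%:R].
Proof.
move=> k0 /not_orP[d0 /negP]; rewrite -leNgt ler_norml => /andP[h1 h2].
have kp : 0 < k%:R :> R by rewrite ltr0n.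
have lo : (1 - delta) * k%:R <= (q1 W v)^-1 by lra.
split => //; first by apply/eqP.
  rewrite -invr_gt0; apply: lt_le_trans lo.
  by rewrite mulr_gt0// subr_gt0.
by lra.
Qed.

(** The trace of W^-1 is the sum of q1 over the basis vectors, and outside the event each 1 / q1 is
    k up to a factor between 1 - delta and 1 + delta. *)
Lemma some_pivot_devN k n (W : 'M[R]_n) : 0 < delta -> (0 < k)%N -> ~ some_pivot_dev k W ->
  [/\ W \in unitmx, n%:R / ((1 + delta) * k%:R) <= \tr (invmx W) &
      \tr (invmx W) <= n%:R / ((1 - delta) * k%:R)].
Proof.
move=> de0 k0 /not_orP[d0 /forallNP h].
have kp : 0 < k%:R :> R by rewrite ltr0n.
split; first by rewrite unitmxE unitfE; apply/eqP.
  rewrite mulr_natl -[n in _ *+ n]card_ord -sumr_const; apply: ler_sum => i _.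
  have [_ q0 _ h2] := pivot_devN k0 (h i); rewrite -q1_bvec.
  rewrite -[leRHS]invrK lef_pV2// posrE ?invr_gt0// mulr_gt0//; lra.
rewrite mulr_natl -[n in _ *+ n]card_ord -sumr_const; apply: ler_sum => i _.
have [_ q0 h2 _] := pivot_devN k0 (h i); rewrite -q1_bvec.
by rewrite -[leLHS]invrK lef_pV2// posrE ?invr_gt0// mulr_gt0// subr_gt0.
Qed.

Lemma measurable_some_pivot_dev d (T : measurableType d) k n (W : T -> 'M[R]_n) :
  mxmeas W -> measurable [set t | some_pivot_dev k (W t)].
Proof.
move=> mW; apply: measurableU.
  by apply: measurable_eqr_set => //; exact: measurable_det.
apply: (@measurable_finexists _ _ _ (fun i => [set t | pivot_dev k (W t) (bvec i)])) => i.
by apply: measurable_pivot_dev => //; exact: mxmeas_cst.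
Qed.

Hypothesis delta_gt0 : 0 < delta.

Definition trmax m k : R := m%:R / ((1 - delta) * k%:R).

(** Bounds q2 = (1 + r) q1^2 when r exceeds the trace by at most eps, the trace is at most [trmax],
    and 1 / q1 is at least (1 - delta) k. *)
Definition q2max (eps : R) m k : R :=
  (1 + eps + trmax m k) / ((1 - delta) * k%:R) ^+ 2.

Lemma trmaxS m k : (0 < k)%N -> trmax m k.+1 <= trmax m k.
Proof.
move=> k0; rewrite ler_wpM2l//.
have d1 : 0 < 1 - delta by rewrite subr_gt0.
rewrite lef_pV2 ?posrE ?mulr_gt0 ?ltr0n//.
by rewrite ler_pM2l// ler_nat.
Qed.

Lemma trmax_ge0 m k : 0 <= trmax m k.
Proof. by rewrite divr_ge0// mulr_ge0// subr_ge0 ltW. Qed.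

Lemma trmax_mono m n k : (m <= n)%N -> trmax m k <= trmax n k.
Proof.
move=> mn; rewrite ler_wpM2r ?invr_ge0 ?ler_nat//.
by rewrite mulr_ge0// subr_ge0 ltW.
Qed.

(** G is a good event for the other rows, on which Chebyshev for r costs at most kappa. It is left
    abstract because it is used twice: with the pivots controlled, then with q2 controlled as
    well. *)
Lemma first_row_random m k (eps : R) (G : 'M[R]_m -> Prop) (kappa : R) :
  (0 < k)%N -> 0 < eps -> 0 <= kappa ->
  (forall d (T : measurableType d) (W : T -> 'M[R]_m), mxmeas W ->
     measurable [set t | G (W t)]) ->
  (forall n (Z : 'M[R]_(m, n)), G (gram Z) -> gram Z \in unitmx /\
     2 * \tr (invmx (gram Z) *m invmx (gram Z)) / eps ^+ 2 <= kappa) ->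
  forall d (T : measurableType d) (P : probability T R)
    (z : T -> 'rV[R]_(m + k)) (Z2 : T -> 'M[R]_(m, m + k)),
  gauss_mx P z -> gauss_mx P Z2 -> indep_mx P Z2 z ->
  pbound P [set t | G (gram (Z2 t)) /\
     (pivot_dev k (gram (col_mx (z t) (Z2 t))) (bvec ord0) \/
      ratio_dev eps (\tr (invmx (gram (Z2 t)))) (gram (col_mx (z t) (Z2 t))) (bvec ord0))]
    (tau k + kappa).
Proof.
move=> k0 e0 ka0 mG hG d T P z Z2 gz gZ2 iZ.
pose S (M2 : 'M[R]_(m, m + k)) (M1 : 'rV[R]_(m + k)) := G (gram M2) /\
  (pivot_dev k (gram (col_mx M1 M2)) (bvec ord0) \/
   ratio_dev eps (\tr (invmx (gram M2))) (gram (col_mx M1 M2)) (bvec ord0)).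
apply: (pbound_indep (S := S) gZ2.1 gz.1 iZ) => [d' T' M N mM mN|M].
  have mW : mxmeas (fun t => gram (col_mx (N t) (M t))).
    by apply: mxmeas_gram; exact: mxmeas_col_mx.
  apply: measurableI; first exact/mG/mxmeas_gram.
  apply: measurableU; first by apply: measurable_pivot_dev => //; exact: mxmeas_cst.
  have mt : measurable_fun setT (fun t => \tr (invmx (gram (M t)))).
    exact/measurable_mxtrace/mxmeas_inv/mxmeas_gram.
  exact: (measurable_ratio_dev _ mW (mxmeas_cst (bvec ord0)) mt).
have [gM|gM] := pselect (G (gram M)); last first.
  by apply: pbound_sub (addr_ge0 (tau_ge0 k) ka0) (pbound_set0 _ (lexx 0)) => t; rewrite /S /= => -[].
have [uM hM] := hG _ _ gM.
have [_ /(_ eps e0) h] := first_row_fixed gz k0 uM.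
apply: pbound_sub h => [t []//|].
by rewrite lerD2l.
Qed.

Lemma q2_le_max (eps tr' : R) m k n (W : 'M[R]_n) v : (0 < k)%N -> 0 <= eps ->
  tr' <= trmax m k -> ~ pivot_dev k W v -> ~ ratio_dev eps tr' W v -> q2 W v <= q2max eps m k.
Proof.
move=> k0 e0 htr b1 /negP; rewrite -leNgt ler_norml => /andP[_ h].
have [_ q0 lo _] := pivot_devN k0 b1.
have kp : 0 < k%:R :> R by rewrite ltr0n.
have d1 : 0 < 1 - delta by rewrite subr_gt0.
have -> : q2 W v = (q2 W v / q1 W v ^+ 2) * (q1 W v) ^+ 2.
  by rewrite divfK// sqrf_eq0 gt_eqF.
have t0 := trmax_ge0 m k.
apply: (@le_trans _ _ ((1 + eps + trmax m k) * (q1 W v) ^+ 2)).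
  by rewrite ler_wpM2r ?sqr_ge0//; lra.
rewrite ler_wpM2l//; first by lra.
rewrite -[q1 W v]invrK exprVn lef_pV2 ?posrE ?exprn_gt0 ?invr_gt0 ?mulr_gt0//.
by rewrite ler_sqr// nnegrE ltW// ?mulr_gt0// invr_gt0.
Qed.

(** The crude round: the variance of r is bounded through tr W2^-2 <= (tr W2^-1)^2 only, so the
    estimate is useful for large eps, which will be of order k. *)
Lemma wishart_q2_large m k (eps : R) : (0 < k)%N -> 0 < eps ->
  forall d (T : measurableType d) (P : probability T R) (Z : T -> 'M[R]_(m.+1, m + k))
    (v : 'cV[R]_m.+1), gauss_mx P Z -> v^T *m v = 1%:M ->
  pbound P [set t | pivot_dev k (gram (Z t)) v \/ q2max eps m k < q2 (gram (Z t)) v]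
    (m%:R * (m%:R * tau k) + (tau k + 2 * trmax m k ^+ 2 / eps ^+ 2)).
Proof.
move=> k0 e0 d T P Z v gZ vv.
apply: (rotate_event (S := fun a b c => (a = 0 \/ delta * k%:R < `|b^-1 - k%:R|) \/
  q2max eps m k < c)) gZ vv.
move=> {}d {}T {}P {}Z gZ; have [z [Z2 [ZE gz gZ2 iZ]]] := split_first_row gZ.
have h1 := wishart_some_pivot_dev (ltn0Sn k) (esym (addnS m k)) gZ2.
have h2 : pbound P [set t | ~ some_pivot_dev k.+1 (gram (Z2 t)) /\
     (pivot_dev k (gram (col_mx (z t) (Z2 t))) (bvec ord0) \/
      ratio_dev eps (\tr (invmx (gram (Z2 t)))) (gram (col_mx (z t) (Z2 t))) (bvec ord0))]
    (tau k + 2 * trmax m k ^+ 2 / eps ^+ 2).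
  apply: (first_row_random (G := fun W => ~ some_pivot_dev k.+1 W)) => //.
  - apply: divr_ge0 (sqr_ge0 _); apply: mulr_ge0 => //; exact: sqr_ge0.
  - by move=> d' T' W mW; exact: measurableC (measurable_some_pivot_dev _ mW).
  - move=> n Z' /(some_pivot_devN delta_gt0 (ltn0Sn k))[uW _ htr]; split=> //.
    rewrite ler_wpM2r ?invr_ge0 ?sqr_ge0// ler_pM2l//.
    apply: le_trans (tr_inv2_le uW) _.
    rewrite ler_sqr ?nnegrE ?trmax_ge0 ?tr_inv_ge0//.
    exact: le_trans htr (trmaxS m k0).
apply: pbound_sub (pboundU h1 h2).
  move=> t; rewrite /= ZE => b.
  have [bC|bC] := pselect (some_pivot_dev k.+1 (gram (Z2 t))); [by left|right; split=> //].
  have [_ _ htr] := some_pivot_devN delta_gt0 (ltn0Sn k) bC.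
  have htr' := le_trans htr (trmaxS m k0).
  apply: contrapT => /not_orP[b1 br].
  case: b => // b; have := q2_le_max k0 (ltW e0) htr' b1 br.
  by rewrite leNgt b.
rewrite lerD2r; apply: ler_wpM2l => //; apply: ler_wpM2l => //; exact: tauS.
Qed.

Definition some_q2_large (eps : R) k n (W : 'M[R]_n) : Prop :=
  \det W = 0 \/ exists i, pivot_dev k W (bvec i) \/ q2max eps n k < q2 W (bvec i).

Lemma wishart_some_q2_large m k N (eps : R) : (0 < k)%N -> 0 < eps -> N.+1 = (m + k)%N ->
  forall d (T : measurableType d) (P : probability T R) (Z : T -> 'M[R]_(m, N)),
  gauss_mx P Z -> pbound P [set t | some_q2_large eps k (gram (Z t))]
    (m%:R * (m%:R * (m%:R * tau k) + (tau k + 2 * trmax m k ^+ 2 / eps ^+ 2))).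
Proof.
case: m => [|m] k0 e0 NE d T P Z gZ.
  rewrite mul0r; apply: pbound_sub (lexx 0) (pbound_set0 _ (lexx 0)) => t /=.
  by case=> [|[[]]//]; rewrite det_mx00 => /eqP; rewrite oner_eq0.
move: NE; rewrite addSn => -[NE]; move: NE Z gZ => -> Z gZ.
have k0' : 0 < k%:R :> R by rewrite ltr0n.
have d1 : 0 < 1 - delta by rewrite subr_gt0.
(* The trace concerns the other rows, of which there are m; its bound is enlarged to the size m + 1
   of the full matrix so that the statement depends on one size only. *)
have tm := trmax_mono k (leqnSn m).
have e20 : 0 <= (eps ^+ 2)^-1 by rewrite invr_ge0 sqr_ge0.
have : pbound P [set t | exists i, pivot_dev k (gram (Z t)) (bvec i) \/
      q2max eps m k < q2 (gram (Z t)) (bvec i)]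
    (m.+1%:R * (m%:R * (m%:R * tau k) + (tau k + 2 * trmax m k ^+ 2 / eps ^+ 2))).
  apply: (pbound_exists (A := fun i => [set t | pivot_dev k (gram (Z t)) (bvec i) \/
      q2max eps m k < q2 (gram (Z t)) (bvec i)])).
    apply: addr_ge0; first by apply: mulr_ge0 => //; exact: mulr_ge0.
    apply: addr_ge0 => //; apply: divr_ge0 (sqr_ge0 _).
    by apply: mulr_ge0 => //; exact: sqr_ge0.
  by move=> i; apply: wishart_q2_large => //; exact: bvec_unit.
apply: pbound_sub => [t [d0|[i b]]|]; first by exists ord0; left; left.
  exists i; case: b => b; [by left|right]; apply: le_lt_trans b.
  rewrite ler_wpM2r ?invr_ge0 ?sqr_ge0//; lra.
rewrite ler_wpM2l// lerD//.
  apply: ler_pM => //; [by rewrite mulr_ge0|by rewrite ler_nat|].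
  by rewrite ler_wpM2r// ler_nat.
rewrite lerD2l ler_wpM2r// ler_pM2l// ler_sqr ?nnegrE ?trmax_ge0//.
Qed.

Lemma some_q2_largeN (eps : R) k n (W : 'M[R]_n) : (0 < k)%N -> ~ some_q2_large eps k W ->
  ~ some_pivot_dev k W /\ \tr (invmx W *m invmx W) <= n%:R * q2max eps n k.
Proof.
move=> k0 /not_orP[d0 /forallNP h]; split.
  by move=> [//|[i b]]; apply: (h i); left.
rewrite mulr_natl -[n in _ *+ n]card_ord -sumr_const; apply: ler_sum => i _.
by have /not_orP[_ /negP] := h i; rewrite -leNgt q2_bvec.
Qed.

Lemma measurable_some_q2_large d (T : measurableType d) eps k n (W : T -> 'M[R]_n) :
  mxmeas W -> measurable [set t | some_q2_large eps k (W t)].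
Proof.
move=> mW; apply: measurableU.
  by apply: measurable_eqr_set => //; exact: measurable_det.
apply: (@measurable_finexists _ _ _ (fun i => [set t | pivot_dev k (W t) (bvec i) \/
  q2max eps n k < q2 (W t) (bvec i)])) => i.
apply: measurableU; first by apply: measurable_pivot_dev => //; exact: mxmeas_cst.
apply: measurable_ltr_set => //; apply: measurable_q2 => //; exact: mxmeas_cst.
Qed.

(* Bootstrap: the pivots of the basis vectors bound tr W^-1, hence q2 crudely;
   this crude bound on q2 bounds tr W^-2, the variance of q2 / q1^2. *)
Lemma wishart_ratio_dev m k (eps1 eps2 s : R) : (0 < k)%N -> 0 < eps1 -> 0 < eps2 ->
  m%:R / ((1 - delta) * k.+1%:R) - m%:R / k%:R <= s ->
  m%:R / k%:R - m%:R / ((1 + delta) * k.+1%:R) <= s ->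
  forall d (T : measurableType d) (P : probability T R) (Z : T -> 'M[R]_(m.+1, m + k))
    (v : 'cV[R]_m.+1), gauss_mx P Z -> v^T *m v = 1%:M ->
  pbound P [set t | pivot_dev k (gram (Z t)) v \/
                    ratio_dev (eps2 + s) (m%:R / k%:R) (gram (Z t)) v]
    (m%:R * (m%:R * (m%:R * tau k.+1) + (tau k.+1 + 2 * trmax m k.+1 ^+ 2 / eps1 ^+ 2)) +
     (tau k + 2 * (m%:R * q2max eps1 m k.+1) / eps2 ^+ 2)).
Proof.
move=> k0 e10 e20 s1 s2 d T P Z v gZ vv.
apply: (rotate_event (S := fun a b c => (a = 0 \/ delta * k%:R < `|b^-1 - k%:R|) \/
  eps2 + s < `|c / b ^+ 2 - 1 - m%:R / k%:R|)) gZ vv.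
move=> {}d {}T {}P {}Z gZ; have [z [Z2 [ZE gz gZ2 iZ]]] := split_first_row gZ.
have h1 := wishart_some_q2_large (ltn0Sn k) e10 (esym (addnS m k)) gZ2.
have q0 : 0 <= q2max eps1 m k.+1.
  by rewrite divr_ge0 ?sqr_ge0// addr_ge0 ?trmax_ge0// addr_ge0// ltW.
have h2 : pbound P [set t | ~ some_q2_large eps1 k.+1 (gram (Z2 t)) /\
     (pivot_dev k (gram (col_mx (z t) (Z2 t))) (bvec ord0) \/
      ratio_dev eps2 (\tr (invmx (gram (Z2 t)))) (gram (col_mx (z t) (Z2 t))) (bvec ord0))]
    (tau k + 2 * (m%:R * q2max eps1 m k.+1) / eps2 ^+ 2).
  apply: (first_row_random (G := fun W => ~ some_q2_large eps1 k.+1 W)) => //.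
  - apply: divr_ge0 (sqr_ge0 _); apply: mulr_ge0 => //; exact: mulr_ge0.
  - by move=> d' T' W mW; exact: measurableC (measurable_some_q2_large _ _ mW).
  - move=> n Z' /(some_q2_largeN (ltn0Sn k))[/(some_pivot_devN delta_gt0 (ltn0Sn k))[uW _ _] htr].
    split=> //; rewrite ler_wpM2r ?invr_ge0 ?sqr_ge0// ler_pM2l//.
apply: pbound_sub (pboundU h1 h2) => //.
move=> t; rewrite /= ZE => b.
have [bE|bE] := pselect (some_q2_large eps1 k.+1 (gram (Z2 t))); [by left|right; split=> //].
have [bC _] := some_q2_largeN (ltn0Sn k) bE.
have [_ lo hi] := some_pivot_devN delta_gt0 (ltn0Sn k) bC.
apply: contrapT => /not_orP[b1 /negP]; rewrite -leNgt => br.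
case: b => // /lt_geF/negP; apply.
(* The random trace is inserted as intermediate point: r is within eps2 of it, and the pivots put it
   within s of m / k. *)
rewrite -[X in `|X|](subrKA (\tr (invmx (gram (Z2 t))))).
apply: le_trans (ler_normD _ _) _; apply: lerD => //.
rewrite ler_norml lerNl opprB; apply/andP; split.
  by apply: le_trans s2; exact: lerB.
by apply: le_trans s1; exact: lerB.
Qed.

End wishart_events.

(** The crude tolerance is e0 k: its failures, O(1/k^2) for each vector, survive the union over m =
    O(k) vectors, while m times [q2max] stays of order e0. *)
Lemma wishart_tail_small (R : realType) (C rho e eta : R) : 0 < C -> 0 < rho -> rho < 1 ->
  0 < e -> e <= 1 / 2 -> 0 < eta ->
  exists2 e0 : R, 0 < e0 & \forall k \near \oo, forall m, m%:R <= C * k%:R ->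
    m%:R * (m%:R * (m%:R * (2 * rho ^+ k.+1)) +
       (2 * rho ^+ k.+1 + 2 * trmax e m k.+1 ^+ 2 / (e0 * k%:R) ^+ 2)) +
    (2 * rho ^+ k + 2 * (m%:R * q2max e (e0 * k%:R) m k.+1) / e ^+ 2) <= eta.
Proof.
move=> C0 rho0 rho1 e0 e2 eta0.
(* Chosen so that 8 C e1 / e^2, the part of the Chebyshev term that does not decay in k, equals eta
   / 4. *)
pose e1 := eta * e ^+ 2 / (32 * C).
have e10 : 0 < e1 by rewrite divr_gt0 ?mulr_gt0 ?exprn_gt0.
have c0 : 0 < 2 * (C ^+ 3 + C + 1).
  by apply: mulr_gt0 => //; apply: addr_gt0 => //; apply: addr_gt0 => //; exact: exprn_gt0.
exists e1 => //.
near=> k => m mC.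
have k1 : 1 <= k%:R :> R by near: k; exact: nbhs_infty_ger.
have k0 : 0 < k%:R :> R by exact: lt_le_trans k1.
have kS : (1 - e) * k.+1%:R >= k%:R / 2 :> R.
  have h : k%:R / 2 <= 1 / 2 * (k%:R + 1) :> R by move: k0; set x := k%:R; lra.
  rewrite -[k.+1%:R]natr1; apply: le_trans h _; apply: ler_wpM2r; last by lra.
  by rewrite addr_ge0.
have kSp : 0 < (1 - e) * k.+1%:R :> R by apply: lt_le_trans kS; lra.
have inv_le : ((1 - e) * k.+1%:R)^-1 <= 2 / k%:R :> R.
  by rewrite -[2 / k%:R]invf_div lef_pV2// posrE divr_gt0.
have m0 : 0 <= m%:R :> R by [].
have t2 : trmax e m k.+1 <= 2 * C.
  rewrite /trmax; apply: (@le_trans _ _ (C * k%:R * (2 / k%:R))).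
    by apply: ler_pM => //; rewrite invr_ge0 ltW.
  by rewrite le_eqVlt; apply/orP; left; apply/eqP; field; rewrite gt_eqF.
have t0 : 0 <= trmax e m k.+1 by rewrite divr_ge0// ltW.
have rS : rho ^+ k.+1 <= rho ^+ k by rewrite exprS ler_piMl ?exprn_ge0 ?(ltW rho0) ?(ltW rho1).
have rk0 : 0 <= rho ^+ k by rewrite exprn_ge0 ?(ltW rho0).
have rk1 : 0 <= rho ^+ k.+1 by rewrite exprn_ge0 ?(ltW rho0).
have q2b : q2max e (e1 * k%:R) m k.+1 <= (1 + e1 * k%:R + 2 * C) * (2 / k%:R) ^+ 2.
  rewrite /q2max; apply: ler_pM.
  - by rewrite !addr_ge0// mulr_ge0// ltW.
  - by rewrite invr_ge0 sqr_ge0.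
  - by rewrite lerD2l.
  - by rewrite -exprVn ler_sqr// nnegrE; [rewrite invr_ge0 ltW|rewrite divr_ge0].
(* The budget eta is split in four: one quarter for the geometric terms, one for the failures of the
   crude round, and two for the decaying and constant parts of the last Chebyshev term. *)
have a1 : 2 * (C ^+ 3 + C + 1) * (k%:R ^+ 3 * rho ^+ k) <= eta / 4.
  rewrite mulrC -ler_pdivlMr//; near: k; apply: poly_geometric_small => //.
    by rewrite rho0.
  apply: divr_gt0 c0; exact: divr_gt0.
have a2 : 8 * C ^+ 3 / e1 ^+ 2 <= eta / 4 * k%:R.
  rewrite -ler_pdivrMl ?divr_gt0//.
  by near: k; exact: nbhs_infty_ger.
have a3 : 8 * C * (1 + 2 * C) / e ^+ 2 <= eta / 4 * k%:R.
  rewrite -ler_pdivrMl ?divr_gt0//.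
  by near: k; exact: nbhs_infty_ger.
set x := rho ^+ k in a1 rS rk0 *; set x' := rho ^+ k.+1 in rS rk1 *.
have b1 : m%:R * (m%:R * (m%:R * (2 * x'))) <= 2 * C ^+ 3 * (k%:R ^+ 3 * x).
  have -> : m%:R * (m%:R * (m%:R * (2 * x'))) = 2 * (m%:R ^+ 3 * x') by ring.
  have -> : 2 * C ^+ 3 * (k%:R ^+ 3 * x) = 2 * ((C * k%:R) ^+ 3 * x) by ring.
  apply: ler_wpM2l => //; apply: ler_pM => //.
  by rewrite lerXn2r// nnegrE// mulr_ge0// ltW.
have kk3 : k%:R <= k%:R ^+ 3 :> R by rewrite -{1}[k%:R]expr1 ler_weXn2l.
have b2 : m%:R * (2 * x') <= 2 * C * (k%:R ^+ 3 * x).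
  have -> : 2 * C * (k%:R ^+ 3 * x) = (C * k%:R ^+ 3) * (2 * x) by ring.
  apply: ler_pM => //; first by rewrite mulr_ge0.
    by apply: le_trans mC _; apply: ler_wpM2l => //; exact: ltW.
  by apply: ler_wpM2l.
have b3 : 2 * x <= 2 * (k%:R ^+ 3 * x).
  apply: ler_wpM2l => //; rewrite ler_peMl//; exact: le_trans kk3.
have b4 : m%:R * (2 * trmax e m k.+1 ^+ 2 / (e1 * k%:R) ^+ 2) <= eta / 4.
  apply: (@le_trans _ _ (C * k%:R * (2 * (2 * C) ^+ 2 / (e1 * k%:R) ^+ 2))).
    apply: ler_pM => //; first by rewrite divr_ge0 ?sqr_ge0// mulr_ge0 ?sqr_ge0.
    apply: ler_wpM2r; first by rewrite invr_ge0 sqr_ge0.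
    have c2 : 0 <= 2 * C by rewrite mulr_ge0// ltW.
    by apply: ler_wpM2l => //; rewrite ler_sqr ?nnegrE.
  have -> : C * k%:R * (2 * (2 * C) ^+ 2 / (e1 * k%:R) ^+ 2) =
     (8 * C ^+ 3 / e1 ^+ 2) / k%:R by field; rewrite !gt_eqF.
  by rewrite ler_pdivrMr.
have b5 : 2 * (m%:R * q2max e (e1 * k%:R) m k.+1) / e ^+ 2 <= eta / 4 + eta / 4.
  apply: (@le_trans _ _ (2 * (C * k%:R * ((1 + e1 * k%:R + 2 * C) * (2 / k%:R) ^+ 2)) / e ^+ 2)).
    apply: ler_wpM2r; first by rewrite invr_ge0 sqr_ge0.
    apply: ler_wpM2l => //; apply: ler_pM => //.
    rewrite divr_ge0 ?sqr_ge0// !addr_ge0// mulr_ge0// ltW//.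
  have -> : 2 * (C * k%:R * ((1 + e1 * k%:R + 2 * C) * (2 / k%:R) ^+ 2)) / e ^+ 2 =
    (8 * C * (1 + 2 * C) / e ^+ 2) / k%:R + eta / 4 by rewrite /e1; field; rewrite !gt_eqF.
  by rewrite lerD2r ler_pdivrMr.
have -> : m%:R * (m%:R * (m%:R * (2 * x')) +
       (2 * x' + 2 * trmax e m k.+1 ^+ 2 / (e1 * k%:R) ^+ 2)) +
    (2 * x + 2 * (m%:R * q2max e (e1 * k%:R) m k.+1) / e ^+ 2) =
   m%:R * (m%:R * (m%:R * (2 * x'))) + m%:R * (2 * x') + 2 * x +
   m%:R * (2 * trmax e m k.+1 ^+ 2 / (e1 * k%:R) ^+ 2) +
   2 * (m%:R * q2max e (e1 * k%:R) m k.+1) / e ^+ 2 by ring.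
have -> : eta = eta / 4 + eta / 4 + (eta / 4 + eta / 4) by field.
apply: lerD b5; apply: lerD b4; apply: le_trans a1.
have -> : 2 * (C ^+ 3 + C + 1) * (k%:R ^+ 3 * x) = 2 * C ^+ 3 * (k%:R ^+ 3 * x) +
  2 * C * (k%:R ^+ 3 * x) + 2 * (k%:R ^+ 3 * x) by ring.
by apply: lerD b3; exact: lerD b1 b2.
Unshelve. all: by end_near. Qed.

Lemma wishart_unit_direction (R : realType) (C delta eta : R) : 0 < C -> 0 < delta -> 0 < eta ->
  \forall k \near \oo, forall m, m%:R <= C * k%:R ->
  forall d (T : measurableType d) (P : probability T R) (Z : T -> 'M[R]_(m.+1, m + k))
    (v : 'cV[R]_m.+1), gauss_mx P Z -> v^T *m v = 1%:M ->
  pbound P [set t | \det (gram (Z t)) = 0 \/ delta < `|k%:R * q1 (gram (Z t)) v - 1| \/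
     delta < `|k%:R ^+ 2 * q2 (gram (Z t)) v - (1 + m%:R / k%:R)|] eta.
Proof.
move=> C0 de0 eta0.
(* The final error on k^2 q2 is 4 (e + 2 C e) + 6 e (1 + C) = (10 + 14 C) e: the deviation of the
   ratio times (k q1)^2 <= 4, plus the deviation of (k q1)^2 times 1 + m / k. *)
pose e := Num.min (1 / 2) (delta / (10 + 14 * C)).
have dC : 0 < delta / (10 + 14 * C) by rewrite divr_gt0// addr_gt0// mulr_gt0.
have e0 : 0 < e by rewrite lt_min dC andbT; lra.
have e2 : e <= 1 / 2 by rewrite ge_min lexx.
have e3 : e * (10 + 14 * C) <= delta.
  rewrite -ler_pdivlMr; last by rewrite addr_gt0// mulr_gt0.
  by rewrite ge_min lexx orbT.
have e1 : e < 1 by lra.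
have [rho /andP[rho0 rho1] tail] := chi2_tail e0 e1.
have [e4 e40 small] := wishart_tail_small C0 rho0 rho1 e0 e2 eta0.
near=> k => m mC d T P Z v gZ vv.
have k1 : 1 <= k%:R :> R by near: k; exact: nbhs_infty_ger.
have k0 : 0 < k%:R :> R by exact: lt_le_trans k1.
have kn0 : (0 < k)%N by rewrite -(ltr0n R).
(* The other rows have parameter k + 1, whereas the limits are expressed in k; this makes the
   relative difference at most e. *)
have ke : 1 <= e * k.+1%:R.
  rewrite -[k.+1%:R]natr1; apply: (@le_trans _ _ (e * k%:R)); last by lra.
  by rewrite -ler_pdivrMl//; near: k; exact: nbhs_infty_ger.
have km : m%:R / k%:R <= C by rewrite ler_pdivrMr.
have mk0 : 0 <= m%:R / k%:R :> R by rewrite divr_ge0.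
have kS0 : 0 < k.+1%:R :> R by [].
have s1 : m%:R / ((1 - e) * k.+1%:R) - m%:R / k%:R <= 2 * C * e.
  have i1 : (1 - e)^-1 <= 1 + 2 * e.
    have e1' : 0 < 1 - e by lra.
    by rewrite -[leLHS]mul1r ler_pdivrMr//; nra.
  have i2 : k.+1%:R^-1 <= k%:R^-1 :> R by rewrite lef_pV2// ler_nat.
  rewrite lerBlDr invfM mulrCA.
  apply: (@le_trans _ _ ((1 + 2 * e) * (m%:R / k%:R))); last by nra.
  have i3 : 0 <= (1 - e)^-1 by rewrite invr_ge0; lra.
  apply: ler_pM => //; by apply: ler_wpM2l.
have s2 : m%:R / k%:R - m%:R / ((1 + e) * k.+1%:R) <= 2 * C * e.
  have i1 : k%:R * (1 - 2 * e) <= k%:R ^+ 2 / ((1 + e) * k.+1%:R).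
    rewrite ler_pdivlMr; last by rewrite mulr_gt0// addr_gt0.
    rewrite expr2 -!mulrA; apply: ler_wpM2l => //.
    move: ke; rewrite -![k.+1%:R]natr1; nra.
  have -> : m%:R / ((1 + e) * k.+1%:R) = m%:R / k%:R * ((k%:R ^+ 2 / ((1 + e) * k.+1%:R)) / k%:R).
    have D0 : 0 < (1 + e) * k.+1%:R by rewrite mulr_gt0// addr_gt0.
    by move: D0; set D := (1 + e) * _ => D0; field; rewrite !gt_eqF.
  have i2 : 1 - 2 * e <= (k%:R ^+ 2 / ((1 + e) * k.+1%:R)) / k%:R.
    by rewrite ler_pdivlMr// mulrC.
  set y := _ / _ / k%:R in i2 *; nra.
apply: pbound_sub (wishart_ratio_dev e1 rho0 rho1 tail e0 kn0 (mulr_gt0 e40 k0) e0 s1 s2 gZ vv); last first.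
  exact: (near small k) mC.
move=> t /= bad; apply: contrapT => /not_orP[b1 br]; move: bad.
have [d0 q0 lo hi] := pivot_devN e1 kn0 b1.
move: br => /negP; rewrite -leNgt.
have a1 : 1 - e <= k%:R * q1 (gram (Z t)) v.
  have : 1 <= q1 (gram (Z t)) v * ((1 + e) * k%:R) by rewrite -ler_pdivrMl// mulr1.
  nra.
have a2 : k%:R * q1 (gram (Z t)) v <= 1 + 2 * e.
  have : q1 (gram (Z t)) v * ((1 - e) * k%:R) <= 1 by rewrite -ler_pdivlMl// mulr1.
  nra.
have -> : k%:R ^+ 2 * q2 (gram (Z t)) v =
  (q2 (gram (Z t)) v / q1 (gram (Z t)) v ^+ 2) * (k%:R * q1 (gram (Z t)) v) ^+ 2.
  by field; rewrite gt_eqF.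
set r := _ / _ ^+ 2; set x := k%:R * _ in a1 a2 *; set c := m%:R / k%:R in km mk0 *.
rewrite ler_norml => /andP[r1 r2].
case=> [d1|[]]; first by rewrite d1 eqxx in d0.
  by apply/negP; rewrite -leNgt ler_norml; apply/andP; split; nra.
apply/negP; rewrite -leNgt.
have x1 : `|x ^+ 2 - 1| <= 6 * e by rewrite ler_norml; apply/andP; split; nra.
have x2 : x ^+ 2 <= 4 by nra.
have -> : r * x ^+ 2 - (1 + c) = (r - 1 - c) * x ^+ 2 + (1 + c) * (x ^+ 2 - 1) by ring.
apply: le_trans (ler_normD _ _) _; rewrite (normrM (r - 1 - c)) (normrM (1 + c)).
apply: (@le_trans _ _ ((e + 2 * C * e) * 4 + (1 + C) * (6 * e))); last by nra.
apply: lerD; apply: ler_pM => //.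
- by rewrite ler_norml; apply/andP; split; lra.
- by rewrite ger0_norm ?sqr_ge0.
- by rewrite ger0_norm; lra.
Unshelve. all: by end_near. Qed.

Section random_direction.
Context {R : realType}.

Lemma q1Z n (W : 'M[R]_n) (c : R) (v : 'cV[R]_n) : q1 W (c *: v) = c ^+ 2 * q1 W v.
Proof.
have E : (c *: v)^T = c *: v^T by apply/matrixP => i j; rewrite !mxE.
by rewrite /q1 E -scalemxAr -!scalemxAl scalerA -expr2 [LHS]mxE.
Qed.

Lemma q2Z n (W : 'M[R]_n) (c : R) (v : 'cV[R]_n) : q2 W (c *: v) = c ^+ 2 * q2 W v.
Proof.
have E : (c *: v)^T = c *: v^T by apply/matrixP => i j; rewrite !mxE.
by rewrite /q2 E -scalemxAr -!scalemxAl scalerA -expr2 [LHS]mxE.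
Qed.

(** The errors are relative to |xi|^2, so by homogeneity the bound for unit vectors is uniform over
    frozen values of xi, whatever its law. *)
Lemma wishart_random_direction (C delta eta : R) : 0 < C -> 0 < delta -> 0 < eta ->
  \forall k \near \oo, forall p N, N.+1 = (p + k)%N -> p%:R <= C * k%:R ->
  forall d (T : measurableType d) (P : probability T R) (Z : T -> 'M[R]_(p, N))
    (xi : T -> 'cV[R]_p), gauss_mx P Z -> mxmeas xi -> indep_mx P xi Z ->
  pbound P [set t | \det (gram (Z t)) = 0 \/
     delta * normsq (xi t) < `|k%:R * q1 (gram (Z t)) (xi t) - normsq (xi t)| \/
     delta * normsq (xi t) < `|k%:R ^+ 2 * q2 (gram (Z t)) (xi t) - N%:R / k%:R * normsq (xi t)|]
   eta.
Proof.
move=> C0 de0 eta0; have unit := wishart_unit_direction C0 de0 eta0.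
near=> k => p N NE pC d T P Z xi gZ mxi iZ.
have kn0 : (0 < k)%N by near: k; exact: nbhs_infty_gt.
have k0 : 0 < k%:R :> R by rewrite ltr0n.
(* An empty matrix has determinant 1 and its forms vanish, so the event is empty. *)
case: p Z xi NE pC gZ mxi iZ => [|m] Z xi NE pC gZ mxi iZ.
  apply: pbound_sub (ltW eta0) (pbound_set0 _ (lexx 0)) => t /=.
  rewrite det_mx00 /q1 /q2 /normsq !mxE !big_ord0 !mulr0 subr0 normr0 ltxx.
  by case=> [/eqP|[]//]; rewrite oner_eq0.
move: NE; rewrite addSn => -[NE]; move: NE Z gZ iZ => -> Z gZ iZ.
have mC : m%:R <= C * k%:R by apply: le_trans pC; rewrite ler_nat.
pose S (x : 'cV[R]_m.+1) (M : 'M[R]_(m.+1, m + k)) := \det (gram M) = 0 \/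
     delta * normsq x < `|k%:R * q1 (gram M) x - normsq x| \/
     delta * normsq x < `|k%:R ^+ 2 * q2 (gram M) x - (m + k)%:R / k%:R * normsq x|.
apply: (pbound_indep (S := S) mxi gZ.1 iZ) => [d' T' x M mx mM|x].
  have mW := mxmeas_gram mM; have mn := measurable_normsq mx.
  have m1 := measurable_q1 mW mx; have m2 := measurable_q2 mW mx.
  have mc (c : R) : measurable_fun [set: T'] (fun=> c) by exact: measurable_cst.
  apply: measurableU; first by apply: measurable_eqr_set => //; exact: measurable_det.
  apply: measurableU; apply: measurable_ltr_set; try exact: measurable_funM.
    apply: measurableT_comp => //; apply: measurable_funB => //; exact: measurable_funM.
  apply: measurableT_comp => //; apply: measurable_funB => //; exact: measurable_funM.
have tau : (m + k)%:R / k%:R = 1 + m%:R / k%:R :> R.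
  by rewrite natrD; field; rewrite gt_eqF.
(* A zero vector has no direction; both error events are then empty and only singularity remains,
   which the bound at any basis vector covers. *)
have [x0|x0] := eqVneq (normsq x) 0.
  have -> : x = 0 *: bvec ord0 by rewrite scale0r; exact/normsq_eq0.
  apply: pbound_sub (lexx _) (near unit k _ m mC _ _ _ Z _ gZ (bvec_unit ord0)) => //.
  move=> t; rewrite /S/= normsqZ q1Z q2Z expr0n !mul0r !mulr0 subr0 normr0 ltxx.
  by case=> [?|[]//]; left.
have x1 : 0 < normsq x by rewrite lt_def x0 normsq_nneg.
pose c := Num.sqrt (normsq x); have c2 : c ^+ 2 = normsq x by rewrite sqr_sqrtr// ltW.
have c0 : c != 0 by rewrite gt_eqF// sqrtr_gt0.
have xE : x = c *: (c^-1 *: x) by rewrite scalerA divff// scale1r.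
have vv : (c^-1 *: x)^T *m (c^-1 *: x) = 1%:M.
  by rewrite [LHS]mx11_scalar -/(normsq _) normsqZ exprVn c2 mulVf.
apply: pbound_sub (lexx _) (near unit k _ m mC _ _ _ Z _ gZ vv) => //.
have E1 W : q1 W x = normsq x * q1 W (c^-1 *: x) by rewrite {1}xE q1Z c2.
have E2 W : q2 W x = normsq x * q2 W (c^-1 *: x) by rewrite {1}xE q2Z c2.
move=> t; rewrite /S/= E1 E2 tau; set a := q1 _ _; set b := q2 _ _.
have -> : k%:R * (normsq x * a) - normsq x = (k%:R * a - 1) * normsq x by ring.
have -> : k%:R ^+ 2 * (normsq x * b) - (1 + m%:R / k%:R) * normsq x =
  (k%:R ^+ 2 * b - (1 + m%:R / k%:R)) * normsq x by ring.
rewrite ![`|_ * normsq x|]normrM (gtr0_norm x1) !ltr_pM2r//.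
Unshelve. all: by end_near. Qed.

End random_direction.

(** * Convergence in probability *)

Section whp.
Context {R : realType} (d : nat -> measure_display) (T : forall m, measurableType (d m))
  (P : forall m, probability (T m) R).

Definition whp (G : forall m, set (T m)) : Prop :=
  forall eta : R, 0 < eta -> \forall m \near \oo, pbound (P m) (~` G m) eta.

Definition cvgp (Y : forall m, T m -> R) (l : R) : Prop :=
  forall eps, 0 < eps -> whp (fun m => [set w | `|Y m w - l| <= eps]).

Lemma whp_sub (G H : forall m, set (T m)) :
  (\forall m \near \oo, G m `<=` H m) -> whp G -> whp H.
Proof.
move=> GH hG eta e0; have hGe := hG eta e0; near=> m.
apply: pbound_sub (lexx _) (near hGe m _) => //.
by move=> w nH /(near GH m _)h; apply: nH; exact: h.
Unshelve. all: by end_near. Qed.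

Lemma whpI (G H : forall m, set (T m)) :
  whp G -> whp H -> whp (fun m => G m `&` H m).
Proof.
move=> hG hH eta e0; have e2 : 0 < eta / 2 by rewrite divr_gt0.
have hGe := hG _ e2; have hHe := hH _ e2; near=> m.
apply: pbound_sub (pboundU (near hGe m _) (near hHe m _)) => //; last by lra.
by rewrite setCI.
Unshelve. all: by end_near. Qed.

Lemma whp_near (Q : nat -> Prop) : (\forall m \near \oo, Q m) ->
  whp (fun m => [set _ | Q m]).
Proof.
move=> hQ eta e0; near=> m.
apply: pbound_sub (ltW e0) (pbound_set0 _ (lexx 0)) => w /=; apply.
by near: m.
Unshelve. all: by end_near. Qed.

Lemma cvgp_seq (u : nat -> R) (l : R) : u @ \oo --> l -> cvgp (fun m _ => u m) l.
Proof.
move=> ul eps e0; apply: whp_near.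
by have /cvgr_distC_le := ul; apply.
Qed.

Lemma cvgp_whp (Y Y' : forall m, T m -> R) l :
  whp (fun m => [set w | Y m w = Y' m w]) -> cvgp Y l -> cvgp Y' l.
Proof.
move=> h hY eps e0; apply: whp_sub (whpI h (hY eps e0)).
by near=> m; move=> w /= [<-].
Unshelve. all: by end_near. Qed.

Lemma cvgpD Y Y' l l' : cvgp Y l -> cvgp Y' l' ->
  cvgp (fun m w => Y m w + Y' m w) (l + l').
Proof.
move=> h h' eps e0; have e2 : 0 < eps / 2 by rewrite divr_gt0.
apply: whp_sub (whpI (h _ e2) (h' _ e2)); near=> m; move=> w /= [a b].
have -> : Y m w + Y' m w - (l + l') = (Y m w - l) + (Y' m w - l') by ring.
by apply: le_trans (ler_normD _ _) _; lra.
Unshelve. all: by end_near. Qed.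

Lemma cvgp_comp Y l (f : R -> R) : {for l, continuous f} -> cvgp Y l ->
  cvgp (fun m w => f (Y m w)) (f l).
Proof.
move=> cf h eps e0; have /cvgr_distC_le/(_ _ e0) := cf.
move=> /nbhs_ballP[e /= e1 he].
have e2 : 0 < e / 2 by rewrite divr_gt0.
apply: whp_sub (h _ e2); near=> m; move=> w /= a; apply: he.
rewrite /ball/= distrC; apply: le_lt_trans a _; lra.
Unshelve. all: by end_near. Qed.

(** Reduced to sums and continuous maps by x y = ((x + y)^2 - (x - y)^2) / 4. *)
Lemma cvgpM Y Y' l l' : cvgp Y l -> cvgp Y' l' ->
  cvgp (fun m w => Y m w * Y' m w) (l * l').
Proof.
move=> h h'; have sq : forall x : R, {for x, continuous (fun y : R => y ^+ 2 / 4)}.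
  by move=> x; apply: cvgMl; exact: exprn_continuous.
have ng : forall x : R, {for x, continuous (fun y : R => - y)}.
  by move=> x; exact: opp_continuous.
have -> : l * l' = (l + l') ^+ 2 / 4 + - ((l + - l') ^+ 2 / 4) by field.
have := cvgpD (cvgp_comp (sq _) (cvgpD h h'))
  (cvgp_comp (ng _) (cvgp_comp (sq _) (cvgpD h (cvgp_comp (ng _) h')))).
apply: cvgp_whp; apply: whp_sub (whp_near (Q := fun=> True) _).
  by near=> m; move=> w /= _; field.
by near=> m.
Unshelve. all: by end_near. Qed.

End whp.

(** * Limits of squared norms and of inverse Wishart forms *)

Section limits.
Context {R : realType}.

Lemma unit_direction n (e : 'cV[R]_n.+1) :
  exists v : 'cV[R]_n.+1, v^T *m v = 1%:M /\ e = Num.sqrt (normsq e) *: v.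
Proof.
have [e0|e0] := eqVneq (normsq e) 0.
  by exists (bvec ord0); rewrite e0 sqrtr0 scale0r; split; [exact: bvec_unit|exact/normsq_eq0].
have e1 : 0 < normsq e by rewrite lt_def e0 normsq_nneg.
have c0 : Num.sqrt (normsq e) != 0 by rewrite gt_eqF// sqrtr_gt0.
exists ((Num.sqrt (normsq e))^-1 *: e); split; last by rewrite scalerA divff// scale1r.
by rewrite [LHS]mx11_scalar -/(normsq _) normsqZ exprVn sqr_sqrtr ?(ltW e1)// mulVf.
Qed.

Lemma normsq_shift n (x z : 'cV[R]_n) c :
  normsq (x + c *: z) = normsq x + 2 * ((c *: x^T) *m z) ord0 ord0 + normsq (c%:M *m z).
Proof.
rewrite mul_scalar_mx -scalemxAl /normsq.
have -> : (x + c *: z)^T = x^T + c *: z^T by apply/matrixP => i j; rewrite !mxE.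
have -> : (c *: z)^T = c *: z^T by apply/matrixP => i j; rewrite !mxE.
rewrite mulmxDl !mulmxDr -!scalemxAl -!scalemxAr.
have -> : z^T *m x = x^T *m z.
  by apply/matrixP => i j; rewrite !ord1 !mxE; apply: eq_bigr => t _; rewrite !mxE mulrC.
move: (x^T *m x) (x^T *m z) (z^T *m z) => A B C; rewrite !mxE.
ring.
Qed.

Lemma frob2_scalar n (c : R) : frob2 (c%:M : 'M[R]_n) = n%:R * c ^+ 4.
Proof.
rewrite /frob2 tr_scalar_mx -scalar_mxM mulr_natl -[n in _ *+ n]card_ord -sumr_const.
apply: eq_bigr => i _; rewrite (bigD1 i)//= big1 ?addr0 => [|j ji].
  by rewrite mxE eqxx mulr1n -expr2 -exprM.
by rewrite mxE eq_sym (negbTE ji) mulr0n expr0n.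
Qed.

Context (d : nat -> measure_display) (T : forall m, measurableType (d m))
  (P : forall m, probability (T m) R).

Lemma cvgp_cst (l : R) : cvgp P (fun _ _ => l) l.
Proof. by apply: (cvgp_seq P (u := fun=> l)); exact: cvg_cst. Qed.

(** Y e is |e| z for a standard Gaussian z of dimension p. In the expansion the cross term has
    variance of order D |e|^2, which vanishes, and |e|^2 |z|^2 concentrates at p |e|^2, which tends
    to s. *)
Lemma cvgp_normsq (p : nat -> nat) q (Y : forall m, T m -> 'M[R]_(p m, q.+1))
    (x : forall m, 'cV[R]_(p m)) (e : nat -> 'cV[R]_q.+1) (D s : R) :
  (\forall m \near \oo, gauss_mx (P m) (Y m)) -> (forall m, normsq (x m) = D) ->
  normsq (e m) @[m --> \oo] --> 0 -> (p m)%:R * normsq (e m) @[m --> \oo] --> s ->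
  cvgp P (fun m w => normsq (x m + Y m w *m e m)) (D + s).
Proof.
move=> gY xD e0 es; have [v hv] := choice (fun m => unit_direction (e m)).
pose c m : R := Num.sqrt (normsq (e m)); pose z m w := Y m w *m v m.
have c2 m : c m ^+ 2 = normsq (e m) by rewrite sqr_sqrtr ?normsq_nneg.
have gz : \forall m \near \oo, gauss_mx (P m) (z m).
  by apply: filterS gY => m; apply: gauss_mulr; case: (hv m).
have lin : cvgp P (fun m w => ((c m *: (x m)^T) *m z m w) ord0 ord0) 0.
  move=> eps eps0 eta eta0.
  have : D * normsq (e m) / eps ^+ 2 @[m --> \oo] --> D * 0 / eps ^+ 2.
    by apply: cvgMl; exact: cvgMr.
  rewrite mulr0 mul0r => /cvgr_le/(_ _ eta0) small.
  near=> m; have gm : gauss_mx (P m) (z m) by near: m.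
  have mz : mxmeas (z m) by case: gm.
  have h : pbound (P m) [set t | eps < `|((c m *: (x m)^T) *m z m t) ord0 ord0|]
      (D * normsq (e m) / eps ^+ 2).
    apply: pbound_measurable.
      apply: measurable_ltr_set => //; apply: measurableT_comp => //.
      by apply: mxmeas_mul => //; exact: mxmeas_cst.
    have := linear_dev (c m *: (x m)^T) gm eps0.
    have tE : (c m *: (x m)^T)^T = c m *: x m by apply/matrixP => i j; rewrite !mxE.
    have -> : ((c m *: (x m)^T) *m (c m *: (x m)^T)^T) ord0 ord0 = D * normsq (e m).
      by rewrite tE -scalemxAl -scalemxAr scalerA -expr2 c2 mxE -/(normsq _) xD mulrC.
    exact.
  apply: pbound_sub h; last by near: m.
  by move=> t /= /negP; rewrite subr0 -ltNge.
(* The mean is p |e|^2 and the variance 2 p |e|^4, the product of a convergent sequence and a null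
   one. *)
have quad : cvgp P (fun m w => normsq ((c m)%:M *m z m w) + - ((p m)%:R * normsq (e m))) 0.
  move=> eps eps0 eta eta0.
  have : 2 * (((p m)%:R * normsq (e m)) * normsq (e m)) / eps ^+ 2 @[m --> \oo] -->
      2 * (s * 0) / eps ^+ 2.
    by apply: cvgMl; apply: cvgMr; exact: cvgM.
  rewrite !mulr0 mul0r => /cvgr_le/(_ _ eta0) small.
  near=> m; have gm : gauss_mx (P m) (z m) by near: m.
  have mz : mxmeas (z m) by case: gm.
  have h : pbound (P m)
      [set t | eps < `|normsq ((c m)%:M *m z m t) - \tr ((c m)%:M *m (c m)%:M^T : 'M[R]_(p m))|]
      (2 * (((p m)%:R * normsq (e m)) * normsq (e m)) / eps ^+ 2).
    apply: pbound_measurable.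
      apply: measurable_ltr_set => //; apply: measurableT_comp => //.
      apply: measurable_funB => //; apply: measurable_normsq.
      by apply: mxmeas_mul => //; exact: mxmeas_cst.
    have := quad_dev (c m)%:M gm eps0.
    have -> : frob2 ((c m)%:M : 'M[R]_(p m)) = (p m)%:R * normsq (e m) * normsq (e m).
      by rewrite frob2_scalar -c2; ring.
    exact.
  apply: pbound_sub h; last by near: m.
  move=> t /= /negP; rewrite subr0 -ltNge tr_scalar_mx -scalar_mxM mxtrace_scalar.
  by rewrite -expr2 c2 mulr_natl.
have := cvgpD (cvgpD (cvgp_cst D) (cvgpM (cvgp_cst 2) lin)) (cvgpD quad (cvgp_seq P es)).
rewrite mulr0 addr0 add0r; apply: cvgp_whp.
apply: whp_sub (whp_near (Q := fun=> True) P _); last by near=> m.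
near=> m; move=> w /= _; have -> : Y m w *m e m = c m *: z m w by rewrite {1}(hv m).2 -scalemxAr.
rewrite normsq_shift xD.
ring.
Unshelve. all: by end_near. Qed.

(** Turns errors relative to Z into absolute ones: a convergent Z is at most |c| + 1 with high
    probability. *)
Lemma cvgp_close (Y Y' Z : forall m, T m -> R) (l c : R) : cvgp P Y' l -> cvgp P Z c ->
  (forall delta, 0 < delta -> whp P (fun m => [set w | `|Y m w - Y' m w| <= delta * Z m w])) ->
  cvgp P Y l.
Proof.
move=> hY hZ h eps eps0; have e2 : 0 < eps / 2 by rewrite divr_gt0.
have c1 : 0 < `|c| + 1 by rewrite ltr_wpDl.
have de0 : 0 < eps / 2 / (`|c| + 1) by rewrite divr_gt0.
apply: whp_sub (whpI (h _ de0) (whpI (hY _ e2) (hZ 1 ltr01))); near=> m; move=> w /= [a [b g]].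
have -> : Y m w - l = (Y m w - Y' m w) + (Y' m w - l) by ring.
apply: le_trans (ler_normD _ _) _.
have -> : eps = eps / 2 / (`|c| + 1) * (`|c| + 1) + eps / 2 by field; rewrite gt_eqF.
apply: lerD b; apply: le_trans a _; apply: ler_wpM2l; first exact: ltW.
move: g; rewrite ler_norml => /andP[_ g]; have := ler_norm c; lra.
Unshelve. all: by end_near. Qed.

Lemma cvgp_wishart (p k N : nat -> nat) (C c s : R)
    (Z : forall m, T m -> 'M[R]_(p m, N m)) (xi : forall m, T m -> 'cV[R]_(p m)) :
  0 < C -> (\forall m \near \oo, (N m).+1 = (p m + k m)%N) ->
  (\forall m \near \oo, (p m)%:R <= C * (k m)%:R) -> k @ \oo --> \oo ->
  (N m)%:R / (k m)%:R @[m --> \oo] --> s ->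
  (\forall m \near \oo, gauss_mx (P m) (Z m)) ->
  (\forall m \near \oo, mxmeas (xi m)) ->
  (\forall m \near \oo, indep_mx (P m) (xi m) (Z m)) ->
  cvgp P (fun m w => normsq (xi m w)) c ->
  [/\ whp P (fun m => [set w | \det (gram (Z m w)) <> 0]),
      cvgp P (fun m w => (k m)%:R * q1 (gram (Z m w)) (xi m w)) c &
      cvgp P (fun m w => (k m)%:R ^+ 2 * q2 (gram (Z m w)) (xi m w)) (s * c)].
Proof.
move=> C0 NE pC ki Ns gZ mxi iZ nc.
have key (delta : R) : 0 < delta -> whp P (fun m => [set w | [/\ \det (gram (Z m w)) <> 0,
   `|(k m)%:R * q1 (gram (Z m w)) (xi m w) - normsq (xi m w)| <= delta * normsq (xi m w) &
   `|(k m)%:R ^+ 2 * q2 (gram (Z m w)) (xi m w) - (N m)%:R / (k m)%:R * normsq (xi m w)| <=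
     delta * normsq (xi m w)]]).
  move=> de0 eta eta0.
  have [M _ hM] := wishart_random_direction C0 de0 eta0.
  have kM : \forall m \near \oo, (M <= k m)%N by exact: ki _ (nbhs_infty_ge M).
  near=> m.
  have Mm : (M <= k m)%N by near: m.
  have NEm : (N m).+1 = (p m + k m)%N by near: m.
  have pCm : (p m)%:R <= C * (k m)%:R by near: m.
  have gm : gauss_mx (P m) (Z m) by near: m.
  have mm : mxmeas (xi m) by near: m.
  have im : indep_mx (P m) (xi m) (Z m) by near: m.
  apply: pbound_sub (lexx _) (hM _ Mm _ _ NEm pCm _ _ _ _ _ gm mm im).
  move=> w /= nh; apply: contrapT => /not_orP[h1 /not_orP[/negP h2 /negP h3]].
  by apply: nh; split => //; rewrite leNgt.
split.
- by apply: whp_sub (key 1 ltr01); near=> m; move=> w [].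
- apply: (cvgp_close nc nc) => delta de0.
  by apply: whp_sub (key _ de0); near=> m; move=> w [].
- apply: (cvgp_close (cvgpM (cvgp_seq P Ns) nc) nc) => delta de0.
  by apply: whp_sub (key _ de0); near=> m; move=> w [].
Unshelve. all: by end_near. Qed.

End limits.

(** * Linear discriminant analysis *)

Section whitening.
Context {R : realType}.

(** The law is given through some square root A' of Sigma that may differ from A; then A^-1 A' is
    orthogonal and preserves the standard Gaussian law. One common A can thus whiten all
    observations. *)
Lemma mvnormal_whiten p (Q : probability 'cV[R]_p R) (mu : 'cV[R]_p) (Sigma A : 'M[R]_p) :
  A *m A^T = Sigma -> A \in unitmx -> is_mvnormal Q mu Sigma ->
  gauss_mx Q (fun x => invmx A *m (x - mu)).
Proof.
move=> AS uA [A' [G [A'S stdG QG]]].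
have mw : mxmeas (fun x : 'cV[R]_p => invmx A *m (x - mu)).
  apply: mxmeas_mul; first exact: mxmeas_cst.
  by apply: mxmeasB; [exact: mxmeas_id|exact: mxmeas_cst].
split=> // B mB.
have gid : gauss_mx G (fun z : 'cV[R]_p => z).
  split; first exact: mxmeas_id.
  move=> B' mB'; transitivity (G [set z | forall i, B' i ord0 (z i ord0)]).
    by congr (G _); apply/seteqP; split=> z /= h i => [|j]; rewrite ?ord1.
  rewrite (stdG (fun i => B' i ord0) (fun i => mB' i ord0)); apply: eq_bigr => i _.
  by rewrite big_ord_recl big_ord0 mule1.
have OO : (invmx A *m A') *m (invmx A *m A')^T = 1%:M.
  rewrite trmx_mul trmx_inv mulmxA -(mulmxA (invmx A)) A'S -AS mulmxA mulVmx// mul1mx.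
  by rewrite mulmxV// unitmx_tr.
have [_ <-//] := gauss_mull OO gid.
rewrite QG; last first.
  apply: measurable_finforall => i; apply: measurable_finforall => j.
  by have := mw i j measurableT _ (mB i j); rewrite setTI.
congr (G _); apply/seteqP; split=> z /= h i j; have := h i j.
  by rewrite addrC addKr mulmxA.
by rewrite addrC addKr mulmxA.
Qed.

Lemma pooled_gauss d (T : measurableType d) (P : probability T R) p n1 n2
    (X1 : 'I_n1 -> {RV P >-> 'cV[R]_p}) (X2 : 'I_n2 -> {RV P >-> 'cV[R]_p})
    (mu1 mu2 : 'cV[R]_p) (Sigma A : 'M[R]_p) :
  A *m A^T = Sigma -> A \in unitmx ->
  (forall j, is_mvnormal (distribution P (X1 j)) mu1 Sigma) ->
  (forall j, is_mvnormal (distribution P (X2 j)) mu2 Sigma) ->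
  independent_RVs (pooled_sample X1 X2) ->
  exists (Z1 : T -> 'M[R]_(p, n1)) (Z2 : T -> 'M[R]_(p, n2)),
    [/\ gauss_mx P (fun w => row_mx (Z1 w) (Z2 w)),
        forall w j, X1 j w = mu1 + A *m col j (Z1 w) &
        forall w j, X2 j w = mu2 + A *m col j (Z2 w)].
Proof.
move=> AS uA h1 h2 ind.
pose mu (k : 'I_n1 + 'I_n2) := match k with inl _ => mu1 | inr _ => mu2 end.
have hX k : is_mvnormal (distribution P (pooled_sample X1 X2 k)) (mu k) Sigma by case: k.
have gX k := mvnormal_whiten AS uA (hX k).
pose z k w := invmx A *m (pooled_sample X1 X2 k w - mu k).
exists (fun w => \matrix_(i, j) z (inl j) w i ord0), (fun w => \matrix_(i, j) z (inr j) w i ord0).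
have colE n (f : 'I_n -> 'cV[R]_p) j : col j (\matrix_(i, j) f j i ord0) = f j.
  by apply/matrixP => i l; rewrite !mxE (ord1 l).
split; last 2 first.
- by move=> w j; rewrite (colE _ (fun j => z (inl j) w)) mulKVmx// addrC subrK.
- by move=> w j; rewrite (colE _ (fun j => z (inr j) w)) mulKVmx// addrC subrK.
have mz k : mxmeas (z k).
  apply: mxmeas_mul; first exact: mxmeas_cst.
  apply: mxmeasB; last exact: mxmeas_cst.
  have mX : measurable_fun setT (pooled_sample X1 X2 k) by exact: measurable_funPT.
  exact: (iffLR (measurable_cvP _) mX).
split.
  apply: mxmeas_row_mx => i j.
    rewrite (_ : (fun _ => _) = (fun w => z (inl j) w i ord0)); first exact: mz.
    by apply/funext => w; rewrite mxE.
  rewrite (_ : (fun _ => _) = (fun w => z (inr j) w i ord0)); first exact: mz.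
  by apply/funext => w; rewrite mxE.
move=> B mB.
pose S k : set 'cV[R]_p := [set x | forall i (j : 'I_1), B i (unsplit k) ((invmx A *m (x - mu k)) i j)].
have mS k : measurable (S k).
  apply: measurable_finforall => i; apply: measurable_finforall => j.
  by have := (gX k).1 i j measurableT _ (mB i (unsplit k)); rewrite setTI.
transitivity (P [set w | forall k, S k (pooled_sample X1 X2 k w)]).
  congr (P _); apply/seteqP; split=> w /= h.
    move=> k i j; rewrite ord1; have := h i (unsplit k).
    by case: k => k /=; rewrite ?row_mxEl ?row_mxEr mxE.
  move=> i j; rewrite -[j]splitK; have := h (fintype.split j) i ord0.
  by case: (fintype.split j) => k /=; rewrite ?row_mxEl ?row_mxEr mxE.
rewrite ind//.
transitivity (\prod_(k : 'I_n1 + 'I_n2) \prod_(i < p) normal_prob 0 1 (B i (unsplit k)))%E.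
  apply: eq_bigr => k _.
  transitivity (\prod_(i < p) \prod_(j < 1) normal_prob 0 1 (B i (unsplit k)))%E.
    exact: (gX k).2 (fun i _ => B i (unsplit k)) (fun i _ => mB i (unsplit k)).
  by apply: eq_bigr => i _; rewrite big_ord_recl big_ord0 mule1.
rewrite exchange_big/=; apply: eq_bigr => i _.
by rewrite big_sumType/= big_split_ord.
Qed.

Lemma gram_cols p n (M : 'M[R]_(p, n)) :
  \sum_(j < n) col j M *m (col j M)^T = M *m M^T.
Proof.
apply/matrixP => a b; rewrite summxE [RHS]mxE; apply: eq_bigr => j _.
by rewrite !mxE big_ord_recl big_ord0 addr0 !mxE.
Qed.

Lemma sample_mean_affine p n (x : 'I_n -> 'cV[R]_p) (mu : 'cV[R]_p) (A : 'M[R]_p)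
    (Z : 'M[R]_(p, n)) : (0 < n)%N -> (forall j, x j = mu + A *m col j Z) ->
  sample_mean x = mu + A *m (n%:R^-1 *: (Z *m const_mx 1)).
Proof.
move=> n0 xE; have nR : n%:R != 0 :> R by rewrite pnatr_eq0 -lt0n.
rewrite /sample_mean (eq_bigr _ (fun j _ => xE j)) big_split/= sumr_const card_ord.
rewrite -mulmx_sumr scalerDr -(scaler_nat n mu) scalerA mulVf// scale1r -scalemxAr.
congr (_ + _ *: (_ *m _)); apply/matrixP => i j; rewrite summxE [RHS]mxE.
by apply: eq_bigr => l _; rewrite !mxE mulr1.
Qed.

(** Centering is right multiplication by 1 - J / n, with J the matrix of ones; this is a symmetric
    idempotent, so it occurs once in the scatter, and the mean drops out. *)
Lemma scatter_affine p n (x : 'I_n -> 'cV[R]_p) (mu : 'cV[R]_p) (A : 'M[R]_p)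
    (Z : 'M[R]_(p, n)) : (0 < n)%N -> (forall j, x j = mu + A *m col j Z) ->
  scatter x = A *m (Z *m (1%:M - n%:R^-1 *: const_mx 1) *m Z^T) *m A^T.
Proof.
move=> n0 xE; have nR : n%:R != 0 :> R by rewrite pnatr_eq0 -lt0n.
pose C : 'M[R]_n := 1%:M - n%:R^-1 *: const_mx 1.
have CE : C *m C^T = C.
  have JJ : (const_mx 1 : 'M[R]_n) *m (const_mx 1 : 'M[R]_n) = n%:R *: (const_mx 1 : 'M[R]_n).
    apply/matrixP => i j; rewrite !mxE (eq_bigr (fun=> 1)) => [|l _]; last by rewrite !mxE mulr1.
    by rewrite sumr_const card_ord mulr1.
  have -> : C^T = C by apply/matrixP => i j; rewrite !mxE eq_sym.
  rewrite /C mulmxBl mul1mx mulmxBr mulmx1 -scalemxAl -scalemxAr JJ !scalerA.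
  by rewrite -mulrA mulVf// mulr1 subrr subr0.
rewrite /scatter (eq_bigr (fun j => col j (A *m (Z *m C)) *m (col j (A *m (Z *m C)))^T)).
  by rewrite gram_cols !trmx_mul !mulmxA -(mulmxA _ C) CE.
move=> j _; suff -> : x j - sample_mean x = col j (A *m (Z *m C)) by [].
rewrite (sample_mean_affine n0 xE) xE opprD addrACA subrr add0r -mulmxBr !colE -mulmxA.
congr (_ *m _); rewrite /C mulmxBr mulmx1 mulmxBl -scalemxAr -scalemxAl -mulmxA.
congr (_ - _ *: (_ *m _)); apply/matrixP => a b; rewrite mxE -colE.
by rewrite !mxE.
Qed.

End whitening.

(** * Splitting the sample into class means and within-class scatter *)

Section structure.
Context {R : realType}.

Let ones n (c : R) : 'rV[R]_n := c *: const_mx 1.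

Let ones_tr n c : (ones n c)^T = c *: (const_mx 1 : 'cV[R]_n).
Proof. by apply/matrixP => i j; rewrite !mxE. Qed.

Let ones_row n c c' : ones n c *m (ones n c')^T = (c * c' * n%:R)%:M.
Proof.
rewrite [LHS]mx11_scalar; congr (_%:M); rewrite mxE (eq_bigr (fun=> c * c')).
  by rewrite sumr_const card_ord mulr_natr.
by move=> i _; rewrite !mxE !mulr1.
Qed.

Let ones_col n c : (ones n c)^T *m ones n c = (c * c) *: (const_mx 1 : 'M[R]_n).
Proof. by apply/matrixP => i j; rewrite !mxE big_ord_recl big_ord0 !mxE addr0 !mulr1. Qed.

(** The columns of Y are the whitened data against the class indicators scaled to unit length 1 /
    sqrt n_i; one more factor 1 / sqrt n_i turns them into class means. *)
Definition mean_dir1 n : 'cV[R]_(1 + 1) := col_mx ((Num.sqrt n%:R)^-1)%:M 0.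
Definition mean_dir2 n : 'cV[R]_(1 + 1) := col_mx 0 ((Num.sqrt n%:R)^-1)%:M.

Lemma normsq_mean_dirs n1 n2 (a b : R) :
  normsq (a *: mean_dir1 n1 + b *: mean_dir2 n2) = a ^+ 2 / n1%:R + b ^+ 2 / n2%:R.
Proof.
rewrite !scale_col_mx add_col_mx !scaler0 addr0 add0r normsq_col_mx !normsqZ.
have E n : normsq (((Num.sqrt n%:R : R)^-1)%:M : 'cV[R]_1) = n%:R^-1.
  by rewrite normsqE big_ord_recl big_ord0 addr0 mxE eqxx mulr1n exprVn sqr_sqrtr.
by rewrite !E.
Qed.

Lemma lda_structure d (T : measurableType d) (P : probability T R) p n1 n2 b
    (X1 : 'I_n1 -> {RV P >-> 'cV[R]_p}) (X2 : 'I_n2 -> {RV P >-> 'cV[R]_p})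
    (mu1 mu2 : 'cV[R]_p) (Sigma A : 'M[R]_p) :
  (0 < n1)%N -> (0 < n2)%N -> (n1 + n2)%N = (2 + b)%N ->
  A *m A^T = Sigma -> A \in unitmx ->
  (forall j, is_mvnormal (distribution P (X1 j)) mu1 Sigma) ->
  (forall j, is_mvnormal (distribution P (X2 j)) mu2 Sigma) ->
  independent_RVs (pooled_sample X1 X2) ->
  exists (W : T -> 'M[R]_(p, b)) (Y : T -> 'M[R]_(p, 1 + 1)),
    [/\ gauss_mx P W, gauss_mx P Y, indep_mx P Y W &
      forall w, [/\ sample_mean (fun j => X1 j w) = mu1 + A *m (Y w *m mean_dir1 n1),
        sample_mean (fun j => X2 j w) = mu2 + A *m (Y w *m mean_dir2 n2) &
        pooled_cov (fun j => X1 j w) (fun j => X2 j w) =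
          b%:R^-1 *: (A *m gram (W w) *m A^T)]].
Proof.
move=> n10 n20 nb AS uA h1 h2 ind.
have [Z1 [Z2 [gZ X1E X2E]]] := pooled_gauss AS uA h1 h2 ind.
have sq n : (0 < n)%N -> (Num.sqrt n%:R)^-1 * (Num.sqrt n%:R)^-1 = n%:R^-1 :> R.
  by move=> n0; rewrite -invfM -expr2 sqr_sqrtr.
pose c1 : R := (Num.sqrt n1%:R)^-1; pose c2 : R := (Num.sqrt n2%:R)^-1.
pose B : 'M[R]_(1 + 1, n1 + n2) := block_mx (ones n1 c1) 0 0 (ones n2 c2).
have BT : B^T = block_mx (ones n1 c1)^T 0 0 (ones n2 c2)^T by rewrite tr_block_mx !trmx0.
have BB : B *m B^T = 1%:M.
  rewrite BT mulmx_block !mul0mx !mulmx0 !addr0 !add0r !ones_row !sq//.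
  by rewrite !mulVf ?pnatr_eq0 -?lt0n// -scalar_mx_block.
have BTB : B^T *m B = block_mx (n1%:R^-1 *: const_mx 1) 0 0 (n2%:R^-1 *: const_mx 1).
  by rewrite BT mulmx_block !mul0mx !mulmx0 !addr0 !add0r !ones_col !sq.
have [|L [LL BL]] := @orthonormal_complement R b (1 + 1) (n1 + n2) B; first by rewrite nb.
(* The projection onto the complement of the indicators is the block-diagonal centering matrix, so
   its quadratic form in the data is the pooled scatter. *)
have LTL : L^T *m L = block_mx (1%:M - n1%:R^-1 *: const_mx 1) 0 0
    (1%:M - n2%:R^-1 *: const_mx 1).
  have uBB : B *m B^T \in unitmx by rewrite BB unitmx1.
  have := projection_complement nb uBB LL BL; rewrite BB invmx1 mulmx1 => h.
  have -> : L^T *m L = 1%:M - B^T *m B by rewrite -h addrAC subrr add0r.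
  rewrite BTB (scalar_mx_block n1 n2 1).
  by rewrite opp_block_mx add_block_mx !oppr0 !addr0.
have LB : L *m B^T = 0 by rewrite -[LHS]trmxK trmx_mul trmxK BL trmx0.
pose Z w := row_mx (Z1 w) (Z2 w).
have gQ : gauss_mx P (fun w => row_mx (Z w *m B^T) (Z w *m L^T)).
  apply: gauss_mx_eq (gauss_mulr (L := row_mx B^T L^T) _ gZ) => [w|].
    by rewrite mul_mx_row.
  rewrite tr_row_mx !trmxK mul_col_row BB BL LB LL.
  by rewrite [RHS](scalar_mx_block (1 + 1) b 1).
exists (fun w => Z w *m L^T), (fun w => Z w *m B^T); split.
- exact: gauss_mx_rsub gQ.
- exact: gauss_mx_lsub gQ.
- exact: gauss_row_indep gQ.
move=> w; split.
- rewrite (sample_mean_affine n10 (X1E w)); congr (_ + _ *m _).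
  rewrite -mulmxA BT mul_block_col !mul0mx mulmx0 !addr0 mul_row_col mulmx0 addr0.
  by rewrite ones_tr -scalemxAl mul_mx_scalar scalerA sq// -scalemxAr.
- rewrite (sample_mean_affine n20 (X2E w)); congr (_ + _ *m _).
  rewrite -mulmxA BT mul_block_col !mul0mx mulmx0 !add0r mul_row_col mulmx0 add0r.
  by rewrite ones_tr -scalemxAl mul_mx_scalar scalerA sq// -scalemxAr.
rewrite /pooled_cov (scatter_affine n10 (X1E w)) (scatter_affine n20 (X2E w)).
have -> : (n1 + n2)%:R - 2 = b%:R :> R by rewrite nb natrD addrAC subrr add0r.
rewrite -mulmxDl -mulmxDr; congr (_ *: (_ *m _ *m _)).
rewrite /gram trmx_mul trmxK mulmxA -(mulmxA _ _ L) LTL mul_row_block !mulmx0 addr0 add0r.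
by rewrite tr_row_mx mul_row_col.
Qed.

Lemma score_whiten p b (A W : 'M[R]_p) (u v : 'cV[R]_p) : A \in unitmx -> W \in unitmx ->
  (0 < b)%N ->
  ((A *m u)^T *m invmx (b%:R^-1 *: (A *m W *m A^T)) *m (A *m v)) ord0 ord0 =
  b%:R * (u^T *m invmx W *m v) ord0 ord0.
Proof.
move=> uA uW b0; have bR : b%:R != 0 :> R by rewrite pnatr_eq0 -lt0n.
have -> : invmx (b%:R^-1 *: (A *m W *m A^T)) = b%:R *: (invmx A^T *m invmx W *m invmx A).
  have uS : b%:R^-1 *: (A *m W *m A^T) \in unitmx.
    by rewrite unitmxZ ?unitfE ?invr_eq0// !unitmx_mul uA uW unitmx_tr uA.
  rewrite -[RHS]mulmx1 -(mulmxV uS) mulmxA -scalemxAl -scalemxAr scalerA divff// scale1r.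
  rewrite !mulmxA mulmxKV// mulmxKV// mulVmx ?unitmx_tr// mul1mx//.
rewrite trmx_mul -scalemxAr -scalemxAl mxE !mulmxA mulmxK ?unitmx_tr//.
by rewrite mulmxKV.
Qed.

(** Used with s - t twice the offset of a class mean from the midpoint of the sample means, and s +
    t their difference, in whitened coordinates. *)
Lemma q1_polar p (W : 'M[R]_p) (s t : 'cV[R]_p) : W^T = W ->
  ((s - t)^T *m invmx W *m (s + t)) ord0 ord0 = q1 W s - q1 W t.
Proof.
move=> WT; have IT : (invmx W)^T = invmx W by rewrite trmx_inv WT.
have E : t^T *m invmx W *m s = s^T *m invmx W *m t.
  have <- : (t^T *m invmx W *m s)^T = s^T *m invmx W *m t.
    by rewrite !trmx_mul trmxK IT mulmxA.
  by apply/matrixP => i j; rewrite [RHS]mxE !ord1.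
have -> : (s - t)^T = s^T - t^T by apply/matrixP => i j; rewrite !mxE.
rewrite /q1 !mulmxBl !mulmxDr E.
move: (s^T *m _ *m s) (s^T *m _ *m t) (t^T *m _ *m t) => a b c.
rewrite !mxE; ring.
Qed.

Lemma q1N p (W : 'M[R]_p) s : q1 W (- s) = q1 W s.
Proof. by rewrite -scaleN1r q1Z sqrrN expr1n mul1r. Qed.

End structure.

(** * The normal distribution function and Gaussian half-spaces *)

Section normal_cdf.
Context {R : realType}.
Let gam : probability (measurableTypeR R) R := normal_prob 0 1.

Lemma normal_prob_le (A : set R) : measurable A ->
  (gam A <= (normal_peak 1)%:E * (lebesgue_measure : set R -> \bar R) A)%E.
Proof.
move=> mA; rewrite -integral_cst//.
have -> : gam A = (\int[lebesgue_measure]_(x in A) (normal_pdf 0 1 x)%:E)%E by [].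
apply: ge0_le_integral => //.
- by move=> x _; rewrite lee_fin normal_pdf_ge0.
- apply/measurable_EFinP; apply: measurable_funTS; exact: measurable_normal_pdf.
- by move=> x _; rewrite lee_fin normal_pdf_ub// oner_eq0.
Qed.

(** The density is bounded by its peak, so Phi is monotone and Lipschitz. *)
Lemma Phi_incr (x y : R) : x <= y -> 0 <= Phi y - Phi x <= normal_peak 1 * (y - x).
Proof.
move=> xy.
have mx : measurable (`]-oo, x]%classic : set R) by exact: measurable_itv.
have mI : measurable (`]x, y]%classic : set R) by exact: measurable_itv.
have E : gam `]-oo, y]%classic = (gam `]-oo, x]%classic + gam `]x, y]%classic)%E.
  rewrite -measureU//; last first.
    by apply/seteqP; split=> t //=; rewrite !in_itv/= => -[a /andP[b _]]; move: b; rewrite ltNge a.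
  congr (gam _); apply/seteqP; split=> t /=; rewrite !in_itv/=.
    by move=> ty; have [?|?] := leP t x; [left|right]; rewrite ?ty ?andbT.
  by case=> [tx|/andP[_ ty]//]; exact: le_trans xy.
have fx : gam `]-oo, x]%classic \is a fin_num by exact: fin_num_measure.
have fI : gam `]x, y]%classic \is a fin_num by exact: fin_num_measure.
have -> : Phi y - Phi x = fine (gam `]x, y]%classic).
  by rewrite /Phi -/(gam _) -/(gam _) E fineD// addrAC subrr add0r.
rewrite fine_ge0//= -lee_fin fineK//.
apply: le_trans (normal_prob_le mI) _; rewrite lebesgue_measure_itv/= lte_fin.
case: ifPn => [_|]; first by rewrite -EFinB -EFinM lee_fin.
rewrite -leNgt => yx; rewrite mule0 lee_fin.
have -> : y = x by apply/eqP; rewrite eq_le xy yx.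
by rewrite subrr mulr0.
Qed.

Lemma Phi_continuous : continuous (@Phi R).
Proof.
have k0 : 0 < normal_peak 1 :> R by rewrite normal_peak_gt0// oner_eq0.
move=> x; apply/cvgrPdist_le => e e0; near=> y.
apply: (@le_trans _ _ (normal_peak 1 * `|x - y|)).
  have [xy|/ltW yx] := leP x y.
    have /andP[h0 h1] := Phi_incr xy.
    by rewrite distrC (distrC x) ger0_norm// ger0_norm// subr_ge0.
  have /andP[h0 h1] := Phi_incr yx.
  by rewrite ger0_norm// ger0_norm// subr_ge0.
rewrite -ler_pdivlMl//; near: y; apply: cvgr_dist_le => //.
by rewrite mulr_gt0// invr_gt0.
Unshelve. all: by end_near. Qed.

Lemma Phi_opp (x : R) : Phi (- x) = 1 - Phi x.
Proof.
have mx : measurable (`]-oo, x]%classic : set R) by exact: measurable_itv.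
have mx' : measurable (`]-oo, x[%classic : set R) by exact: measurable_itv.
(* Points have no mass, which reconciles the closed half-line in [Phi] with the open one produced by
   reflection and complement. *)
have g1 : gam [set x] = 0%E.
  apply/eqP; rewrite eq_le measure_ge0 andbT.
  have := normal_prob_le (measurable_set1 x).
  by rewrite lebesgue_measure_set1 mule0.
have E1 : gam `]-oo, x]%classic = gam `]-oo, x[%classic.
  have -> : `]-oo, x]%classic = `]-oo, x[%classic `|` [set x].
    apply/seteqP; split=> t /=; rewrite !in_itv/=.
      by rewrite le_eqVlt => /orP[/eqP|]; [right|left].
    by case=> [/ltW//|->].
  by rewrite measureU//= ?g1 ?adde0//; apply/seteqP; split=> t //= -[h tx]; move: h; rewrite tx in_itv/= ltxx.
have fx : gam `]-oo, x[%classic \is a fin_num by exact: fin_num_measure.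
have : gam (~` `]-oo, x[%classic) = (1 - gam `]-oo, x[%classic)%E by exact: probability_setC.
have -> : gam (~` `]-oo, x[%classic) = gam `]-oo, - x]%classic.
  transitivity (gam [set y | (`]-oo, - x]%classic : set R) (- y)]).
    congr (gam _); apply/seteqP; split=> t /=; rewrite !in_itv/= lerN2 leNgt; last by move/negP.
    by move/negP.
  exact: normal_prob_opp.
rewrite /Phi -/(gam _) -/(gam _) E1 => ->.
by rewrite fineB.
Qed.

Lemma gauss_half_space d (T : measurableType d) (P : probability T R) p
    (z : T -> 'cV[R]_p) (v : 'cV[R]_p) (b s : R) :
  gauss_mx P z -> 0 < b -> 0 < normsq v ->
  fine (P [set t | (0 < b * ((z t)^T *m v) ord0 ord0 + s) = false]) =
    Phi (- s / (b * Num.sqrt (normsq v))) /\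
  fine (P [set t | (0 < b * ((z t)^T *m v) ord0 ord0 + s) = true]) =
    1 - Phi (- s / (b * Num.sqrt (normsq v))).
Proof.
move=> gz b0 v0; pose c := Num.sqrt (normsq v); have c0 : 0 < c by rewrite sqrtr_gt0.
have c2 : c ^+ 2 = normsq v by rewrite sqr_sqrtr// ltW.
have uu : (c^-1 *: v^T) *m (c^-1 *: v^T)^T = 1%:M.
  have -> : (c^-1 *: v^T)^T = c^-1 *: v by apply/matrixP => i j; rewrite !mxE.
  rewrite -scalemxAl -scalemxAr scalerA -invfM -expr2 c2 [v^T *m v]mx11_scalar.
  by rewrite -/(normsq v) scale_scalar_mx mulVf// gt_eqF.
have /gauss_mx11[mu Pu] := gauss_mull uu gz.
have E t : ((z t)^T *m v) ord0 ord0 = c * ((c^-1 *: v^T) *m z t) ord0 ord0.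
  rewrite -scalemxAl [X in _ = _ * X]mxE mulrA divff ?gt_eqF// mul1r.
  have -> : (z t)^T *m v = (v^T *m z t)^T by rewrite trmx_mul trmxK.
  by rewrite mxE.
have F : [set t | (0 < b * ((z t)^T *m v) ord0 ord0 + s) = false] =
    [set t | (`]-oo, - s / (b * c)]%classic : set R) (((c^-1 *: v^T) *m z t) ord0 ord0)].
  apply/seteqP; split=> t /=; rewrite in_itv/= E ler_pdivlMr ?mulr_gt0//; set x := _ ord0 ord0.
    by move/negbT; rewrite -leNgt; lra.
  by move=> h; apply/negbTE; rewrite -leNgt; move: h; lra.
have mI : measurable (`]-oo, - s / (b * c)]%classic : set R) by exact: measurable_itv.
have PF : P [set t | (0 < b * ((z t)^T *m v) ord0 ord0 + s) = false] =
    gam `]-oo, - s / (b * c)]%classic by rewrite F Pu.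
have mF : measurable [set t | (0 < b * ((z t)^T *m v) ord0 ord0 + s) = false].
  by rewrite F; have := mu measurableT _ mI; rewrite setTI.
split; first by rewrite PF.
have -> : [set t | (0 < b * ((z t)^T *m v) ord0 ord0 + s) = true] =
    ~` [set t | (0 < b * ((z t)^T *m v) ord0 ord0 + s) = false].
  by apply/seteqP; split=> t /=; case: (0 < _) => // /(_ erefl).
rewrite probability_setC// PF fineB//.
by rewrite -PF; exact: fin_num_measure.
Qed.

End normal_cdf.

(** * The misclassification rate as a function of q1 and q2 *)

Section misclassification.
Context {R : realType}.

(** Given the samples, acceptance is a half-space condition on the whitened observation: the offset
    of the class mean contributes the constant q1 W s - q1 W t. *)
Lemma lda_half_space p n1 n2 b (x1 : 'I_n1 -> 'cV[R]_p) (x2 : 'I_n2 -> 'cV[R]_p)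
    (mu : 'cV[R]_p) (A W : 'M[R]_p) (s t : 'cV[R]_p) x :
  A \in unitmx -> W \in unitmx -> W^T = W -> (0 < b)%N ->
  mu - 2^-1 *: (sample_mean x1 + sample_mean x2) = A *m (2^-1 *: (s - t)) ->
  sample_mean x1 - sample_mean x2 = A *m (s + t) ->
  pooled_cov x1 x2 = b%:R^-1 *: (A *m W *m A^T) ->
  lda_c x1 x2 x =
    (0 < b%:R * ((invmx A *m (x - mu))^T *m (invmx W *m (s + t))) ord0 ord0 +
         (b%:R / 2 * (q1 W s - q1 W t) + lda_correction p n1 n2)).
Proof.
move=> uA uW WT b0 E1 E2 SE; rewrite /lda_c/= E2 SE.
have -> : x - 2^-1 *: (sample_mean x1 + sample_mean x2) =
    A *m (invmx A *m (x - mu) + 2^-1 *: (s - t)).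
  by rewrite mulmxDr -E1 mulKVmx// addrA subrK.
rewrite score_whiten// -q1_polar//; set z := invmx A *m _.
have -> : (z + 2^-1 *: (s - t))^T = z^T + 2^-1 *: (s - t)^T.
  by apply/matrixP => i j; rewrite !mxE.
rewrite 2!mulmxDl -!scalemxAl mulmxA.
move: (z^T *m _ *m _) ((s - t)^T *m _ *m _) => a c.
rewrite [(a + _) _ _]mxE [(2^-1 *: c) _ _]mxE; congr (0 < _); ring.
Qed.

Lemma normsq_invmx p (W : 'M[R]_p) v : W^T = W -> normsq (invmx W *m v) = q2 W v.
Proof. by move=> WT; rewrite /normsq /q2 trmx_mul trmx_inv WT !mulmxA. Qed.

(** Here del is the whitened mean difference and g1, g2 are the whitened errors of the sample means.
    Class 1 uses s = del - g2, t = g1 and class 2 uses s = - g2, t = del + g1; the sum s + t is the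
    same for both. *)
Lemma misclassification_formula p n1 n2 b (x1 : 'I_n1 -> 'cV[R]_p) (x2 : 'I_n2 -> 'cV[R]_p)
    (mu1 mu2 del g1 g2 : 'cV[R]_p) (A W Sigma : 'M[R]_p) (Q1 Q2 : probability 'cV[R]_p R) :
  A *m A^T = Sigma -> A \in unitmx -> W \in unitmx -> W^T = W -> (0 < b)%N ->
  is_mvnormal Q1 mu1 Sigma -> is_mvnormal Q2 mu2 Sigma ->
  mu1 - mu2 = A *m del ->
  sample_mean x1 = mu1 + A *m g1 -> sample_mean x2 = mu2 + A *m g2 ->
  pooled_cov x1 x2 = b%:R^-1 *: (A *m W *m A^T) ->
  0 < q2 W (del + g1 - g2) ->
  let c := b%:R * Num.sqrt (q2 W (del + g1 - g2)) in
  misclassification_rate Q1 Q2 (lda_c x1 x2) =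
    2^-1 * Phi (- (b%:R / 2 * (q1 W (del - g2) - q1 W g1) + lda_correction p n1 n2) / c) +
    2^-1 * (1 - Phi (- (b%:R / 2 * (q1 W g2 - q1 W (del + g1)) + lda_correction p n1 n2) / c)).
Proof.
move=> AS uA uW WT b0 h1 h2 mE m1 m2 SE q0 c.
have bR : 0 < b%:R :> R by rewrite ltr0n.
pose v := invmx W *m (del + g1 - g2).
have v0 : 0 < normsq v by rewrite normsq_invmx.
have D1 : sample_mean x1 - sample_mean x2 = A *m (del + g1 - g2).
  rewrite m1 m2 opprD addrACA mE -mulmxBr -mulmxDr; congr (_ *m _).
  by rewrite addrA.
have m2E : mu2 = mu1 - A *m del by rewrite -mE opprB addrC subrK.
have M1 : mu1 - 2^-1 *: (sample_mean x1 + sample_mean x2) = A *m (2^-1 *: ((del - g2) - g1)).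
  rewrite m1 m2 m2E -scalemxAr !mulmxBr.
  move: (A *m del) (A *m g1) (A *m g2) => a1 a2 a3.
  by apply/matrixP => i j; rewrite !mxE; field.
have M2 : mu2 - 2^-1 *: (sample_mean x1 + sample_mean x2) =
    A *m (2^-1 *: (- g2 - (del + g1))).
  rewrite m1 m2 m2E -scalemxAr mulmxBr mulmxN mulmxDr.
  move: (A *m del) (A *m g1) (A *m g2) => a1 a2 a3.
  by apply/matrixP => i j; rewrite !mxE; field.
have D1' : del + g1 - g2 = (del - g2) + g1 by rewrite addrAC.
have D2' : del + g1 - g2 = - g2 + (del + g1) by rewrite addrC.
have [H1 _] := gauss_half_space
  (b%:R / 2 * (q1 W (del - g2) - q1 W g1) + lda_correction p n1 n2)
  (mvnormal_whiten AS uA h1) bR v0.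
have [_ H2] := gauss_half_space
  (b%:R / 2 * (q1 W (- g2) - q1 W (del + g1)) + lda_correction p n1 n2)
  (mvnormal_whiten AS uA h2) bR v0.
rewrite /c -normsq_invmx // -/v -(q1N W g2) -H1 -H2 /misclassification_rate.
congr (_ * _ + _ * _).
  apply: (congr1 (fun S => fine (Q1 S))); apply/funext => x /=; congr (_ = _).
  by rewrite (lda_half_space x uA uW WT b0 M1 _ SE) -D1'.
apply: (congr1 (fun S => fine (Q2 S))); apply/funext => x /=; congr (_ = _).
by rewrite (lda_half_space x uA uW WT b0 M2 _ SE) -D2'.
Qed.

(** Convergence in probability is about the measure of the event itself, so outer bounds need this
    in the end. The acceptance region is jointly measurable in the samples and the observation, and
    each error is the measure of a section. *)
Lemma measurable_misclassification d (T : measurableType d) (P : probability T R) p n1 n2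
    (X1 : 'I_n1 -> {RV P >-> 'cV[R]_p}) (X2 : 'I_n2 -> {RV P >-> 'cV[R]_p})
    (Q1 Q2 : probability 'cV[R]_p R) :
  measurable_fun setT (fun w => misclassification_rate Q1 Q2
    (lda_c (fun j => X1 j w) (fun j => X2 j w))).
Proof.
have mX (X : {RV P >-> 'cV[R]_p}) : mxmeas (fun wx : T * 'cV[R]_p => X wx.1).
  apply/measurable_cvP; exact: measurableT_comp.
have mm n (X : 'I_n -> {RV P >-> 'cV[R]_p}) :
    mxmeas (fun wx : T * 'cV[R]_p => sample_mean (fun j => X j wx.1)).
  apply: mxmeasZ => //; apply: mxmeas_sum => j; exact: mX.
have ms n (X : 'I_n -> {RV P >-> 'cV[R]_p}) :
    mxmeas (fun wx : T * 'cV[R]_p => scatter (fun j => X j wx.1)).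
  apply: mxmeas_sum => j; apply: mxmeas_mul; last apply: mxmeas_tr.
    by apply: mxmeasB; [exact: mX|exact: mm].
  by apply: mxmeasB; [exact: mX|exact: mm].
have msnd : mxmeas (fun wx : T * 'cV[R]_p => wx.2).
  by apply/measurable_cvP; exact: measurable_snd.
have mD : mxmeas (fun wx : T * 'cV[R]_p =>
    (wx.2 - 2^-1 *: (sample_mean (fun j => X1 j wx.1) + sample_mean (fun j => X2 j wx.1)))^T *m
    invmx (pooled_cov (fun j => X1 j wx.1) (fun j => X2 j wx.1)) *m
    (sample_mean (fun j => X1 j wx.1) - sample_mean (fun j => X2 j wx.1))).
  apply: mxmeas_mul; last by apply: mxmeasB; exact: mm.
  apply: mxmeas_mul.
    apply: mxmeas_tr; apply: mxmeasB => //; apply: mxmeasZ => //.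
    by apply: mxmeasD; exact: mm.
  apply: mxmeas_inv; apply: mxmeasZ => //; apply: mxmeasD; exact: ms.
have mS : measurable [set wx : T * 'cV[R]_p |
    lda_c (fun j => X1 j wx.1) (fun j => X2 j wx.1) wx.2].
  apply: measurable_ltr_set => //.
  apply: measurable_funD => //; exact: mD.
have mQ (Q : probability 'cV[R]_p R) (S : set (T * 'cV[R]_p)) : measurable S ->
    measurable_fun setT (fun w => fine (Q [set x | S (w, x)])).
  move=> mS'; apply: measurableT_comp => //.
  have := measurable_fun_xsection Q mS'; congr (measurable_fun _ _).
  by apply/funext => w /=; congr (Q _); apply/funext => x; rewrite /xsection/= inE.
apply: measurable_funD; apply: measurable_funM => //; last exact: mQ mS.
have := mQ Q1 _ (measurableC mS); congr (measurable_fun _ _).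
apply/funext => w /=; congr (fine (Q1 _)); apply/funext => x /=; apply/propext.
by split=> [/negP/negbTE|->].
Qed.

End misclassification.

(** * Limits of the dimension ratios *)

Section dimension_limits.
Context {R : realType}.

Lemma cvg_near_eq (u v : nat -> R) (l : R) : (\forall m \near \oo, u m = v m) ->
  u @ \oo --> l -> v @ \oo --> l.
Proof. by move=> uv; apply: cvg_trans; exact: near_eq_cvg. Qed.

Lemma inv_natr_cvg0 (f : nat -> nat) : f @ \oo --> \oo -> (f m)%:R^-1 @[m --> \oo] --> (0 : R).
Proof.
move=> fi; apply/cvgrPdist_le => e e0.
have h : \forall m \near \oo, e^-1 <= (f m)%:R by exact: fi _ (nbhs_infty_ger e^-1).
near=> m; have fm : e^-1 <= (f m)%:R by near: m.
rewrite sub0r normrN ger0_norm ?invr_ge0// -[leRHS]invrK lef_pV2//.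
  by rewrite posrE (lt_le_trans _ fm)// invr_gt0.
by rewrite posrE invr_gt0.
Unshelve. all: by end_near. Qed.

Lemma near_natr_gt0 (f : nat -> nat) : f @ \oo --> \oo -> \forall m \near \oo, (0 < f m)%N.
Proof. by move=> fi; exact: fi _ (nbhs_infty_ge 1). Qed.

Variables (p n1 n2 : nat -> nat) (y1 y2 : R).
Hypotheses (hp : p @ \oo --> \oo) (hn1 : n1 @ \oo --> \oo) (hn2 : n2 @ \oo --> \oo)
  (hy1 : 0 < y1) (hy2 : 0 < y2)
  (hpn1 : (p m)%:R / (n1 m)%:R @[m --> \oo] --> y1)
  (hpn2 : (p m)%:R / (n2 m)%:R @[m --> \oo] --> y2)
  (hylt1 : y1 * y2 / (y1 + y2) < 1).

Let N m := (n1 m + n2 m)%N.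
(** The within-class matrix has p rows and n - 2 columns, so its pivot has n - 2 - (p - 1) degrees
    of freedom. *)
Let k m := (N m - 1 - p m)%N.
(** The limit of k / p, equal to (1 - y) / y; its positivity is the assumption y < 1. *)
Let L : R := y1^-1 + y2^-1 - 1.

Let L_gt0 : 0 < L.
Proof.
have y12 : 0 < y1 + y2 by rewrite addr_gt0.
have -> : L = (1 - y1 * y2 / (y1 + y2)) / (y1 * y2 / (y1 + y2)).
  by rewrite /L; field; rewrite !gt_eqF.
by rewrite divr_gt0 ?subr_gt0// divr_gt0// mulr_gt0.
Qed.

Let ratio : ((N m)%:R - 1 - (p m)%:R) / (p m)%:R @[m --> \oo] --> L.
Proof.
have i1 : (n1 m)%:R / (p m)%:R @[m --> \oo] --> y1^-1.
  under eq_fun do rewrite -invf_div; apply: cvgV hpn1; exact: lt0r_neq0.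
have i2 : (n2 m)%:R / (p m)%:R @[m --> \oo] --> y2^-1.
  under eq_fun do rewrite -invf_div; apply: cvgV hpn2; exact: lt0r_neq0.
have lim : (n1 m)%:R / (p m)%:R + (n2 m)%:R / (p m)%:R - (p m)%:R^-1 - 1 @[m --> \oo] --> L.
  have -> : L = y1^-1 + y2^-1 - 0 - 1 by rewrite subr0.
  apply: cvgB; last exact: cvg_cst.
  by apply: cvgB; [exact: cvgD|exact: inv_natr_cvg0].
apply: cvg_near_eq lim; have p0 := near_natr_gt0 hp; near=> m.
have pm : (0 < p m)%N by near: m.
by rewrite /N natrD; field; rewrite pnatr_eq0 -lt0n.
Unshelve. all: by end_near. Qed.

(** Eventually k >= (L / 2) p, which provides C = 2 / L and carries the divergence of p over to k;
    the truncated subtractions become exact. *)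
Lemma dimension_facts : exists C : R, [/\ 0 < C,
  \forall m \near \oo, [/\ (p m < N m)%N, (1 < N m)%N, (0 < k m)%N &
    (k m)%:R = (N m)%:R - 1 - (p m)%:R :> R],
  \forall m \near \oo, (p m)%:R <= C * (k m)%:R & k @ \oo --> \oo].
Proof.
have L2 : 0 < L / 2 by rewrite divr_gt0.
have p0 := near_natr_gt0 hp; have n10 := near_natr_gt0 hn1; have n20 := near_natr_gt0 hn2.
have lo : \forall m \near \oo, L / 2 * (p m)%:R < (N m)%:R - 1 - (p m)%:R.
  have /cvgr_gt/(_ (L / 2)) := ratio; rewrite ltr_pdivrMr// ltr_pMr// ltr1n => /(_ isT) h.
  near=> m; have pm : (0 < p m)%N by near: m.
  rewrite -ltr_pdivlMr ?ltr0n//; by near: m.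
have ex : \forall m \near \oo, [/\ (p m < N m)%N, (1 < N m)%N, (0 < k m)%N &
    (k m)%:R = (N m)%:R - 1 - (p m)%:R :> R].
  near=> m; have lom : L / 2 * (p m)%:R < (N m)%:R - 1 - (p m)%:R by near: m.
  have n1m : (0 < n1 m)%N by near: m.
  have n2m : (0 < n2 m)%N by near: m.
  have N2 : (1 < N m)%N by rewrite -(add1n 1) leq_add.
  have lom' : 0 < (N m)%:R - 1 - (p m)%:R :> R by apply: le_lt_trans lom; rewrite mulr_ge0// ltW.
  have pN : ((p m).+1 < N m)%N.
    by rewrite -(ltr_nat R) -natr1; move: lom'; lra.
  have kE : (k m)%:R = (N m)%:R - 1 - (p m)%:R :> R.
    rewrite /k natrB ?natrB//; first exact: ltnW.
    by rewrite leq_subRL ?(ltnW N2)// add1n ltnW.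
  split => //; first exact: ltnW.
  by rewrite -(ltr0n R) kE.
have kp : \forall m \near \oo, (p m)%:R <= 2 / L * (k m)%:R.
  near=> m; have [_ _ _ ->] : [/\ (p m < N m)%N, (1 < N m)%N, (0 < k m)%N &
    (k m)%:R = (N m)%:R - 1 - (p m)%:R :> R] by near: m.
  have lom : L / 2 * (p m)%:R < (N m)%:R - 1 - (p m)%:R by near: m.
  by rewrite -[2 / L]invf_div ler_pdivlMl// ltW.
have C0 : 0 < 2 / L by rewrite divr_gt0.
exists (2 / L); split => //.
apply/cvgnyPge => A.
have h : \forall m \near \oo, 2 / L * A%:R <= (p m)%:R.
  exact: hp _ (nbhs_infty_ger _).
near=> m; have h1 : 2 / L * A%:R <= (p m)%:R by near: m.
have h2 : (p m)%:R <= 2 / L * (k m)%:R by near: m.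
by have := le_trans h1 h2; rewrite ler_pM2l// ler_nat.
Unshelve. all: by end_near. Qed.

(** As n - 2 = k + p - 1, the ratio is 1 + p / k - 1 / k, and p / k tends to 1 / L = y / (1 - y). *)
Lemma wishart_ratio_limit :
  (N m - 2)%:R / (k m)%:R @[m --> \oo] --> (1 - y1 * y2 / (y1 + y2))^-1.
Proof.
have [C [_ ex _ ki]] := dimension_facts.
have kp : (p m)%:R / (k m)%:R @[m --> \oo] --> L^-1.
  apply: (@cvg_near_eq (fun m => (((N m)%:R - 1 - (p m)%:R) / (p m)%:R)^-1)).
    near=> m; have [_ _ _ ->] : [/\ (p m < N m)%N, (1 < N m)%N, (0 < k m)%N &
      (k m)%:R = (N m)%:R - 1 - (p m)%:R :> R] by near: m.
    by rewrite invf_div.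
  by apply: cvgV ratio; exact: lt0r_neq0.
have lim : 1 + (p m)%:R / (k m)%:R - (k m)%:R^-1 @[m --> \oo] --> 1 + L^-1 - 0.
  by apply: cvgB; [apply: cvgD => //; exact: cvg_cst|exact: inv_natr_cvg0].
have -> : (1 - y1 * y2 / (y1 + y2))^-1 = 1 + L^-1 - 0.
  have y12 : 0 < y1 + y2 by rewrite addr_gt0.
  have e1 : 0 < y1 + y2 - y1 * y2 by move: hylt1; rewrite ltr_pdivrMr// mul1r subr_gt0.
  have e2 : 1 - y1 * y2 / (y1 + y2) = (y1 + y2 - y1 * y2) / (y1 + y2).
    by field; rewrite gt_eqF.
  have e3 : L = (y1 + y2 - y1 * y2) / (y1 * y2) by rewrite /L; field; rewrite !gt_eqF.
  rewrite e2 e3 subr0 !invf_div -{1}(divff (lt0r_neq0 e1)) -mulrDl; congr (_ / _).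
  by ring.
apply: cvg_near_eq lim; near=> m.
have [_ N2 k0 kE] : [/\ (p m < N m)%N, (1 < N m)%N, (0 < k m)%N &
      (k m)%:R = (N m)%:R - 1 - (p m)%:R :> R] by near: m.
rewrite (natrB _ N2); have -> : (N m)%:R = (k m)%:R + (p m)%:R + 1 :> R by rewrite kE; ring.
by field; rewrite pnatr_eq0 -lt0n.
Unshelve. all: by end_near. Qed.

(** Since n - p - 3 = k - 2, the scaling leaves k / (k - 2) times the bias difference. The factor k
    / (n - 2) is the one that normalizes the score. *)
Lemma correction_limit :
  (k m)%:R * lda_correction (p m) (n1 m) (n2 m) / (N m - 2)%:R @[m --> \oo] -->
  (y1 - y2) / 2.
Proof.
have [C [_ ex _ ki]] := dimension_facts.
have n10 := near_natr_gt0 hn1; have n20 := near_natr_gt0 hn2.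
have k2 : \forall m \near \oo, (2 < k m)%N by exact: ki _ (nbhs_infty_gt 2).
have b0 : \forall m \near \oo, (2 < N m)%N.
  near=> m; have k2m : (2 < k m)%N by near: m.
  by apply: leq_trans k2m _; rewrite /k -subnDA leq_subr.
have lim : (1 - 2 * (k m)%:R^-1)^-1 * (((p m)%:R / (n1 m)%:R - (p m)%:R / (n2 m)%:R) / 2)
    @[m --> \oo] --> (1 - 2 * 0)^-1 * ((y1 - y2) / 2).
  apply: cvgM; last by apply: cvgMl; exact: cvgB.
  apply: cvgV; first by rewrite mulr0 subr0 oner_eq0.
  apply: cvgB; first exact: cvg_cst.
  by apply: cvgMr; exact: inv_natr_cvg0.
rewrite mulr0 subr0 invr1 mul1r in lim; apply: cvg_near_eq lim; near=> m.
have [_ N2 k0 kE] : [/\ (p m < N m)%N, (1 < N m)%N, (0 < k m)%N &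
      (k m)%:R = (N m)%:R - 1 - (p m)%:R :> R] by near: m.
have k2m : (2 < k m)%N by near: m.
have n1m : (0 < n1 m)%N by near: m.
have n2m : (0 < n2 m)%N by near: m.
have N3 : (2 < N m)%N by near: m.
have kR : (2 : R) < (k m)%:R by rewrite ltr_nat.
have NR : (2 : R) < (N m)%:R by rewrite ltr_nat.
have n1R : (n1 m)%:R != 0 :> R by rewrite pnatr_eq0 -lt0n.
have n2R : (n2 m)%:R != 0 :> R by rewrite pnatr_eq0 -lt0n.
rewrite /lda_correction -/(N m) (natrB _ N2).
have -> : (N m)%:R - (p m)%:R - 3 = (k m)%:R - 2 :> R by rewrite kE; ring.
move: kR NR n1R n2R; move: ((k m)%:R : R) ((N m)%:R : R) => x z x2 z2 h1 h2.
field; rewrite h1 h2 /= !subr_eq0 !gt_eqF//; lra.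
Unshelve. all: by end_near. Qed.

End dimension_limits.

Lemma cvg_in_probability_cvgp (R : realType) (d : nat -> measure_display)
    (T : forall m, measurableType (d m)) (P : forall m, probability (T m) R)
    (Y : forall m, T m -> R) (l : R) :
  (forall m, measurable_fun setT (Y m)) -> cvgp P Y l -> cvg_in_probability P Y l.
Proof.
move=> mY h eps e0; apply/fine_cvgP; split.
  by near=> m; apply: fin_num_measure; apply: measurable_ltr_set => //;
    apply: measurableT_comp => //; exact: measurable_funB.
apply/cvgrPdist_le => eta eta0; have := h _ e0 _ eta0; apply: filterS => m hm.
have mS : measurable [set w | eps < `|Y m w - l|].
  by apply: measurable_ltr_set => //; apply: measurableT_comp => //; exact: measurable_funB.
rewrite sub0r normrN ger0_norm ?fine_ge0//= -lee_fin fineK ?fin_num_measure//.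
apply: pboundP => //; apply: pbound_sub (lexx _) hm => w /= /lt_geF; by move=> ->.
Unshelve. all: by end_near. Qed.

Lemma indep_mx_affine (R : realType) d (T : measurableType d) (P : probability T R) p q b
    (Y : T -> 'M[R]_(p, q)) (W : T -> 'M[R]_(p, b)) (x : 'cV[R]_p) (e : 'cV[R]_q) :
  indep_mx P Y W -> indep_mx P (fun w => x + Y w *m e) W.
Proof.
apply: (indep_mx_comp (f := fun M => x + M *m e) (g := id)); last exact: mxmeas_uncvec.
apply: mxmeasD; first exact: mxmeas_cst.
by apply: mxmeas_mul; [exact: mxmeas_uncvec|exact: mxmeas_cst].
Qed.

Lemma mahalanobis_whiten (R : realType) p (Sigma A : 'M[R]_p) (mu1 mu2 : 'cV[R]_p) :
  A *m A^T = Sigma -> A \in unitmx ->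
  mahalanobis Sigma mu1 mu2 ^+ 2 = normsq (invmx A *m (mu1 - mu2)).
Proof.
move=> AS uA; rewrite /mahalanobis -AS.
have -> : invmx (A *m A^T) = (invmx A)^T *m invmx A.
  have uS : A *m A^T \in unitmx by rewrite unitmx_mul unitmx_tr uA.
  rewrite -[RHS]mulmx1 -(mulmxV uS) mulmxA trmx_inv -(mulmxA (invmx A^T)).
  by rewrite (mulmxA (invmx A)) mulVmx// mul1mx mulVmx ?unitmx_tr// mul1mx.
have -> : (mu1 - mu2)^T *m ((invmx A)^T *m invmx A) *m (mu1 - mu2) =
    (invmx A *m (mu1 - mu2))^T *m (invmx A *m (mu1 - mu2)).
  by rewrite trmx_mul !mulmxA.
by rewrite sqr_sqrtr// normsq_nneg.
Qed.

Theorem proposition2p1 (R : realType)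
  (p n1 n2 : nat -> nat)
  (hp : p @ \oo --> \oo) (hn1 : n1 @ \oo --> \oo) (hn2 : n2 @ \oo --> \oo)
  (mu1 mu2 : forall m : nat, 'cV[R]_(p m))
  (hmu : forall m, mu1 m <> mu2 m)
  (Sigma : forall m : nat, 'M[R]_(p m))
  (hcov : forall m, is_covariance (Sigma m))
  (hunit : forall m, Sigma m \in unitmx)
  (d : nat -> measure_display)
  (Omega : forall m : nat, measurableType (d m))
  (P : forall m : nat, probability (Omega m) R)
  (X1 : forall m : nat, 'I_(n1 m) -> {RV (P m) >-> 'cV[R]_(p m)})
  (X2 : forall m : nat, 'I_(n2 m) -> {RV (P m) >-> 'cV[R]_(p m)})
  (hX1 : forall m (j : 'I_(n1 m)),
     is_mvnormal (distribution (P m) (X1 m j)) (mu1 m) (Sigma m))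
  (hX2 : forall m (j : 'I_(n2 m)),
     is_mvnormal (distribution (P m) (X2 m j)) (mu2 m) (Sigma m))
  (hindep : forall m, independent_RVs (pooled_sample (X1 m) (X2 m)))
  (Q1 Q2 : forall m : nat, probability 'cV[R]_(p m) R)
  (hQ1 : forall m, is_mvnormal (Q1 m) (mu1 m) (Sigma m))
  (hQ2 : forall m, is_mvnormal (Q2 m) (mu2 m) (Sigma m))
  (y1 y2 y Delta : R)
  (hy1 : 0 < y1) (hy2 : 0 < y2)
  (hpn1 : (p m)%:R / (n1 m)%:R @[m --> \oo] --> y1)
  (hpn2 : (p m)%:R / (n2 m)%:R @[m --> \oo] --> y2)
  (hy : y = y1 * y2 / (y1 + y2)) (hylt1 : y < 1)
  (hDelta : forall m, mahalanobis (Sigma m) (mu1 m) (mu2 m) = Delta) :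
  cvg_in_probability P
    (fun m w => misclassification_rate (Q1 m) (Q2 m)
       (lda_c (fun j => X1 m j w) (fun j => X2 m j w)))
    (Phi (- (Delta ^+ 2 / (2 * Num.sqrt (Delta ^+ 2 + y1 + y2)))
          * Num.sqrt (1 - y))).
Proof.
apply: cvg_in_probability_cvgp => [m|]; first exact: measurable_misclassification.
rewrite hy in hylt1 *.
(* The square root of Sigma comes with the law Q1 and is fixed for both classes. *)
have exA m : exists A : 'M[R]_(p m), A *m A^T = Sigma m.
  by have [A [_ [AS _ _]]] := hQ1 m; exists A.
pose A m := sval (cid (exA m)); have AS m : A m *m (A m)^T = Sigma m := svalP (cid (exA m)).
have uA m : A m \in unitmx by have := hunit m; rewrite -AS unitmx_mul => /andP[].
pose del m := invmx (A m) *m (mu1 m - mu2 m).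
have delE m : mu1 m - mu2 m = A m *m del m by rewrite mulKVmx.
have del2 m : normsq (del m) = Delta ^+ 2.
  by rewrite -(mahalanobis_whiten _ _ (AS m) (uA m)) hDelta.
pose N m := (n1 m + n2 m)%N; pose b m := (N m - 2)%N; pose k m := (N m - 1 - p m)%N.
(* The decomposition exists once both samples are nonempty; keeping this as an implication allows a
   choice for every m, with zero matrices as default. *)
have exWY m : exists WY : (Omega m -> 'M[R]_(p m, b m)) * (Omega m -> 'M[R]_(p m, 1 + 1)),
    (0 < n1 m)%N -> (0 < n2 m)%N ->
    [/\ gauss_mx (P m) WY.1, gauss_mx (P m) WY.2, indep_mx (P m) WY.2 WY.1 &
      forall w, [/\ sample_mean (fun j => X1 m j w) = mu1 m + A m *m (WY.2 w *m mean_dir1 (n1 m)),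
        sample_mean (fun j => X2 m j w) = mu2 m + A m *m (WY.2 w *m mean_dir2 (n2 m)) &
        pooled_cov (fun j => X1 m j w) (fun j => X2 m j w) =
          (b m)%:R^-1 *: (A m *m gram (WY.1 w) *m (A m)^T)]].
  have [/andP[n1m n2m]|h] := boolP ((0 < n1 m)%N && (0 < n2 m)%N); last first.
    by exists (fun=> 0, fun=> 0) => a c; move: h; rewrite a c.
  have nb : (n1 m + n2 m)%N = (2 + b m)%N.
    by rewrite /b subnKC// /N -(add1n 1) leq_add.
  have [W [Y [gW gY iYW h]]] := lda_structure n1m n2m nb (AS m) (uA m) (@hX1 m) (@hX2 m) (@hindep m).
  by exists (W, Y).
pose W m := (sval (cid (exWY m))).1; pose Y m := (sval (cid (exWY m))).2.
have n10 := near_natr_gt0 hn1; have n20 := near_natr_gt0 hn2.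
have gW : \forall m \near \oo, gauss_mx (P m) (W m).
  near=> m; have n1m : (0 < n1 m)%N by near: m.
  have n2m : (0 < n2 m)%N by near: m.
  by have [] := svalP (cid (exWY m)) n1m n2m.
have gY : \forall m \near \oo, gauss_mx (P m) (Y m).
  near=> m; have n1m : (0 < n1 m)%N by near: m.
  have n2m : (0 < n2 m)%N by near: m.
  by have [] := svalP (cid (exWY m)) n1m n2m.
have iYW : \forall m \near \oo, indep_mx (P m) (Y m) (W m).
  near=> m; have n1m : (0 < n1 m)%N by near: m.
  have n2m : (0 < n2 m)%N by near: m.
  by have [] := svalP (cid (exWY m)) n1m n2m.
have [C [C0 dims pC ki]] := dimension_facts hp hn1 hn2 hy1 hy2 hpn1 hpn2 hylt1.
have s_lim := wishart_ratio_limit hp hn1 hn2 hy1 hy2 hpn1 hpn2 hylt1.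
have al_lim := correction_limit hp hn1 hn2 hy1 hy2 hpn1 hpn2 hylt1.
set s := (1 - _)^-1 in s_lim.
have s0 : 0 < s by rewrite invr_gt0 subr_gt0.
pose e m (a c : R) := a *: mean_dir1 (n1 m) + c *: mean_dir2 (n2 m).
(* Every vector in the error formula has the form x + a g1 + c g2 with x equal to 0 or del, and is
   independent of W; its squared norm tends to D + a^2 y1 + c^2 y2. *)
have key (x : forall m, 'cV[R]_(p m)) (D a c : R) : (forall m, normsq (x m) = D) ->
  [/\ whp P (fun m => [set w | \det (gram (W m w)) <> 0]),
      cvgp P (fun m w => (k m)%:R * q1 (gram (W m w)) (x m + Y m w *m e m a c))
        (D + (a ^+ 2 * y1 + c ^+ 2 * y2)) &
      cvgp P (fun m w => (k m)%:R ^+ 2 * q2 (gram (W m w)) (x m + Y m w *m e m a c))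
        (s * (D + (a ^+ 2 * y1 + c ^+ 2 * y2)))].
  move=> xD; apply: (cvgp_wishart (N := b) (C := C)) => //.
  - near=> m; have [pN N2 _ _] : [/\ (p m < N m)%N, (1 < N m)%N, (0 < k m)%N &
      (k m)%:R = (N m)%:R - 1 - (p m)%:R :> R] by near: m.
    rewrite /b /k -subSn// subSS subnKC// -ltnS subn1 prednK//.
    exact: leq_trans N2.
  - near=> m; have [mY _] : gauss_mx (P m) (Y m) by near: m.
    apply: mxmeasD; first exact: mxmeas_cst.
    by apply: mxmeas_mul => //; exact: mxmeas_cst.
  - near=> m; apply: indep_mx_affine; by near: m.
  - apply: cvgp_normsq => //.
      under eq_fun do rewrite normsq_mean_dirs.
      rewrite (_ : 0 = a ^+ 2 * 0 + c ^+ 2 * 0); last by rewrite !mulr0 addr0.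
      by apply: cvgD; apply: cvgMr; exact: inv_natr_cvg0.
    have E m : (p m)%:R * normsq (e m a c) =
      a ^+ 2 * ((p m)%:R / (n1 m)%:R) + c ^+ 2 * ((p m)%:R / (n2 m)%:R).
      by rewrite normsq_mean_dirs; ring.
    under eq_fun do rewrite E.
    by apply: cvgD; exact: cvgMr.
have Ye m w a c : Y m w *m e m a c =
    a *: (Y m w *m mean_dir1 (n1 m)) + c *: (Y m w *m mean_dir2 (n2 m)).
  by rewrite mulmxDr -!scalemxAr.
have z2 m : normsq (0 : 'cV[R]_(p m)) = 0 by rewrite /normsq mulmx0 mxE.
(* The five instances are del - g2, g1, g2, del + g1 and del + g1 - g2. *)
have [dW h1 _] := key del _ 0 (-1) del2.
have [_ h2 _] := key (fun m => 0) 0 1 0 z2.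
have [_ h3 _] := key (fun m => 0) 0 0 1 z2.
have [_ h4 _] := key del _ 1 0 del2.
have [_ _ h5] := key del _ 1 (-1) del2.
set c5 := s * _ in h5.
have c50 : 0 < c5.
  by rewrite mulr_gt0// sqrrN expr1n !mul1r ltr_wpDl ?sqr_ge0// addr_gt0.
have q5 : Num.sqrt c5 != 0 by rewrite gt_eqF// sqrtr_gt0.
have hV := cvgp_comp (inv_continuous q5) (cvgp_comp (@sqrt_continuous R c5) h5).
have hal := cvgp_seq P al_lim.
have hm := cvgp_cst P (-1 : R); have hh := cvgp_cst P (2^-1 : R).
have hT1 := cvgpM hm (cvgpM (cvgpD (cvgpM hh (cvgpD h1 (cvgpM hm h2))) hal) hV).
have hT2 := cvgpM hm (cvgpM (cvgpD (cvgpM hh (cvgpD h3 (cvgpM hm h4))) hal) hV).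
have hF := cvgpD (cvgpM hh (cvgp_comp (@Phi_continuous R _) hT1))
  (cvgpM hh (cvgpD (cvgp_cst P 1) (cvgpM hm (cvgp_comp (@Phi_continuous R _) hT2)))).
(* The bias (y2 - y1) / 2 of the uncorrected score cancels against the limit (y1 - y2) / 2 of the
   correction, so the numerators tend to Delta^2 / 2 and - Delta^2 / 2; by symmetry of Phi both
   classes then have the same error. *)
have -> : Phi (- (Delta ^+ 2 / (2 * Num.sqrt (Delta ^+ 2 + y1 + y2))) *
    Num.sqrt (1 - y1 * y2 / (y1 + y2))) =
  2^-1 * Phi (-1 * ((2^-1 * ((Delta ^+ 2 + (0 ^+ 2 * y1 + (-1) ^+ 2 * y2)) +
      -1 * (0 + (1 ^+ 2 * y1 + 0 ^+ 2 * y2))) + (y1 - y2) / 2) * (Num.sqrt c5)^-1)) +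
  2^-1 * (1 + -1 * Phi (-1 * ((2^-1 * ((0 + (0 ^+ 2 * y1 + 1 ^+ 2 * y2)) +
      -1 * (Delta ^+ 2 + (1 ^+ 2 * y1 + 0 ^+ 2 * y2))) + (y1 - y2) / 2) * (Num.sqrt c5)^-1))).
  set u := 1 - _.
  have u0 : 0 < u by rewrite subr_gt0.
  have sE : s = u^-1 by [].
  have cE : c5 = (Delta ^+ 2 + y1 + y2) * u^-1 by rewrite /c5 sE; ring.
  have a0 : 0 < Delta ^+ 2 + y1 + y2 by rewrite -addrA ltr_wpDl ?sqr_ge0// addr_gt0.
  rewrite cE sqrtrM ?(ltW a0)// sqrtrV ?(ltW u0)//.
  have r1 : Num.sqrt (Delta ^+ 2 + y1 + y2) != 0 by rewrite gt_eqF// sqrtr_gt0.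
  have r2 : Num.sqrt u != 0 by rewrite gt_eqF// sqrtr_gt0.
  move: r1 r2; move: (Num.sqrt (Delta ^+ 2 + y1 + y2)) (Num.sqrt u) => r q r1 r2.
  set t := - (_ / _) * _.
  have -> : -1 * ((2^-1 * ((Delta ^+ 2 + (0 ^+ 2 * y1 + (-1) ^+ 2 * y2)) +
      -1 * (0 + (1 ^+ 2 * y1 + 0 ^+ 2 * y2))) + (y1 - y2) / 2) * (r * q^-1)^-1) = t.
    by rewrite /t; field; rewrite r1 r2.
  have -> : -1 * ((2^-1 * ((0 + (0 ^+ 2 * y1 + 1 ^+ 2 * y2)) +
      -1 * (Delta ^+ 2 + (1 ^+ 2 * y1 + 0 ^+ 2 * y2))) + (y1 - y2) / 2) * (r * q^-1)^-1) = - t.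
    by rewrite /t; field; rewrite r1 r2.
  by rewrite Phi_opp; field.
apply: cvgp_whp hF.
(* The error formula divides by sqrt q2, which is nonzero with high probability because k^2 q2 has
   the positive limit c5. *)
have hq0 : whp P (fun m => [set w | 0 < (k m)%:R ^+ 2 * q2 (gram (W m w)) (del m + Y m w *m e m 1 (-1))]).
  have c52 : 0 < c5 / 2 by rewrite divr_gt0.
  apply: whp_sub (h5 _ c52); near=> m; move=> w /=.
  rewrite ler_norml => /andP[h _]; lra.
apply: whp_sub (whpI dW hq0); near=> m; move=> w [dw qw].
have n1m : (0 < n1 m)%N by near: m.
have n2m : (0 < n2 m)%N by near: m.
have [_ N2 k0 _] : [/\ (p m < N m)%N, (1 < N m)%N, (0 < k m)%N &
      (k m)%:R = (N m)%:R - 1 - (p m)%:R :> R] by near: m.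
have N3 : (2 < N m)%N.
  have : (2 < k m)%N by near: m; exact: ki _ (nbhs_infty_gt 2).
  by move=> h; apply: leq_trans h _; rewrite /k -subnDA leq_subr.
have b0 : (0 < b m)%N by rewrite subn_gt0.
have [_ _ _ /(_ w)[m1 m2 SE]] := svalP (cid (exWY m)) n1m n2m.
have uW : gram (W m w) \in unitmx by rewrite unitmxE unitfE; apply/eqP.
have WT : (gram (W m w))^T = gram (W m w) by rewrite /gram trmx_mul trmxK.
have kR : 0 < (k m)%:R :> R by rewrite ltr0n.
have bR : 0 < (b m)%:R :> R by rewrite ltr0n.
move: qw => /=; rewrite !Ye !scale0r !scale1r !scaleN1r !add0r !addr0 addrA pmulr_rgt0 ?exprn_gt0// => qw.
rewrite (misclassification_formula (AS m) (uA m) uW WT b0 (hQ1 m) (hQ2 m) (delE m) m1 m2 SE qw).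
rewrite [Num.sqrt (_ ^+ 2 * _)]sqrtrM ?sqr_ge0// sqrtr_sqr (gtr0_norm kR).
rewrite -/(Y m) -/(N m).
have r0 : Num.sqrt (q2 (gram (W m w)) (del m + Y m w *m mean_dir1 (n1 m) - Y m w *m mean_dir2 (n2 m))) != 0.
  by rewrite gt_eqF// sqrtr_gt0.
move: r0; set r := Num.sqrt _ => r0.
set Q1' := q1 _ (del m - _); set Q2' := q1 _ (Y m w *m mean_dir1 _).
set Q3' := q1 _ (Y m w *m mean_dir2 _); set Q4' := q1 _ (del m + _).
set al := lda_correction _ _ _.
(* Numerator and denominator of each ratio are both multiplied by k / b, which yields exactly the
   normalized quantities whose limits are known. *)
congr (_ * Phi _ + _ * (_ + _)).
- field; rewrite r0 !gt_eqF//.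
- rewrite mulN1r; congr (- Phi _); field; rewrite r0 !gt_eqF//.
Unshelve. all: by end_near. Qed.
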